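(* Let $N\in\mathbb N$, $\kappa,k\in\mathbb Z_+$, and let $\mathbf s=\{s_i\}_{i=0}^{2n_N-1}$ be a regular sequence of real numbers with set of normal indices $\mathcal N(\mathbf s)=\{n_j\}_{j=1}^N$ ($n_1<\dots<n_N$). Let $m_j(z)$ and $l_j$ $(1\le j\le N)$ be defined by the Schur recursion described in the context, and let the polynomials $P_j^+(z)$, $Q_j^+(z)$ $(-1\le j\le 2N)$ be defined by $P_{-1}^+\equiv0$, $P_0^+\equiv1$, $Q_{-1}^+\equiv1$, $Q_0^+\equiv0$ and, for $1\le i\le N$, $$P^+_{2i-1}=-zm_iP^+_{2i-2}+P^+_{2i-3},\quad P^+_{2i}=l_iP^+_{2i-1}+P^+_{2i-2},$$ $$Q^+_{2i-1}=-zm_iQ^+_{2i-2}+Q^+_{2i-3},\quad Q^+_{2i}=l_iQ^+_{2i-1}+Q^+_{2i-2}.$$ Then: (1) The even moment problem $MP_\kappa^k(\mathbf s,2n_N-1)$ is solvable (i.e. $\mathcal M_\kappa^k(\mathbf s,2n_N-1)\ne\emptyset$) if and only if $$\kappa_N:=\nu_-(S_{n_N})\le\kappa\quad\text{and}\quad k_N^+:=\nu_-(S^+_{n_N})\le k .$$ (2) $f\in\mathcal M_\kappa^k(\mathbf s,2n_N-1)$ if and only if $f$ admits the representation $$f(z)=\frac{Q^+_{2N}(z)+Q^+_{2N-1}(z)\tau(z)}{P^+_{2N}(z)+P^+_{2N-1}(z)\tau(z)},$$ where $$\tau\in\mathbf N_{\kappa-\kappa_N}^{k-k_N^+}\quad\text{and}\quad\tau(z)=o(1),\quad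 z\widehat\to\infty .$$
   Context: Classes. A function $f$, meromorphic on $\mathbb C\setminus\mathbb R$ with $f(\bar z)=\overline{f(z)}$ and domain of holomorphy $\mathfrak h_f$, belongs to $\mathbf N_\kappa$ ($\kappa\in\mathbb Z_+=\mathbb N\cup\{0\}$) if for all finite sets $z_1,\dots,z_n\in\mathbb C_+\cap\mathfrak h_f$ the form $\sum_{i,j}\frac{f(z_i)-\overline{f(z_j)}}{z_i-\bar z_j}\xi_i\bar\xi_j$ has at most $\kappa$ negative squares, and for some choice exactly $\kappa$. $\mathbf N_\kappa^k$ is the set of $f\in\mathbf N_\kappa$ with $zf(z)\in\mathbf N_k$ (classes with a negative index are empty). $z\widehat\to\infty$ means $z\to\infty$ nontangentially, i.e. inside sectors $\varepsilon<\arg z<\pi-\varepsilon$, $\varepsilon>0$. Problem. For a real sequence $\mathbf s=\{s_j\}_{j=0}^\ell$, $\mathcal M_\kappa^k(\mathbf s,\ell)$, the solution set of $MP_\kappa^k(\mathbf s,\ell)$, is the set of $f\in\mathbf N_\kappa^k$ with $f(z)=-\frac{s_0}{z}-\cdots-\frac{s_\ell}{z^{\ell+1}}+o\left(\frac1{z^{\ell+1}}\right)$ for $z=iy$, $y\uparrow\infty$. Matrices. $S_n=(s_{i+j})_{i,j=0}^{n-1}$, $S_n^+=(s_{i+j+1})_{i,j=0}^{n-1}$, $D_n=\det S_n$, $D_n^+=\det S_n^+$; $\nu_-(S)$ is the number of negative eigenvalues of $S$. $n\ge1$ is a normal index of $\mathbf s$ if $D_n\ne0$. The sequence $\mathbf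 s=\{s_i\}_{i=0}^{2n_N-1}$ is regular if $D^+_{n_j}\ne0$ for all $j=1,\dots,N$. Toeplitz notation. $T(c_0,\dots,c_n)$ is the upper triangular $(n+1)\times(n+1)$ matrix with entries $c_{j-i}$ for $i\le j$ and $0$ for $i>j$. Schur recursion (here $\ell=2n_N-1$). Put $n_0=0$, $\mathbf s^{(0)}=\mathbf s$. Given $\mathbf s^{(j-1)}=\{s_i^{(j-1)}\}_{i=0}^{\ell-2n_{j-1}}$, let $\nu=n_j-n_{j-1}$ (then $s^{(j-1)}_0=\dots=s^{(j-1)}_{\nu-2}=0$, $s^{(j-1)}_{\nu-1}\ne0$), $D_\nu^{(j-1)}=\det(s^{(j-1)}_{i+p})_{i,p=0}^{\nu-1}$, $(D_\nu^{(j-1)})^+=\det(s^{(j-1)}_{i+p+1})_{i,p=0}^{\nu-1}$. Then, for $1\le j\le N$, $$m_j(z)=\frac{(-1)^{\nu+1}}{D_\nu^{(j-1)}}\Delta_j(z)=\sum_{i=0}^{\nu-1}m_i^{(j)}z^i,\qquad l_j=(-1)^{\nu+1}s^{(j-1)}_{\nu-1}\frac{D_\nu^{(j-1)}}{(D_\nu^{(j-1)})^+},$$ where $\Delta_j(z)$ is the determinant of the $\nu\times\nu$ matrix whose first $\nu-1$ rows are $(s^{(j-1)}_{i+1},s^{(j-1)}_{i+2},\dots,s^{(j-1)}_{i+\nu})$, $i=0,\dots,\nu-2$, and whose last row is $(1,z,\dots,z^{\nu-1})$. For $1\le j\le N-1$ the sequences $\{\mathfrak s_i^{(j)}\}_{i=-1}^{\ell-2n_j}$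 and $\mathbf s^{(j)}=\{s_i^{(j)}\}_{i=0}^{\ell-2n_j}$ are determined by $$T(m^{(j)}_{\nu-1},\dots,m^{(j)}_0,-\mathfrak s^{(j)}_{-1},\dots,-\mathfrak s^{(j)}_{\ell-2n_j})\,T(s^{(j-1)}_{\nu-1},\dots,s^{(j-1)}_{\ell-2n_{j-1}})=I,$$ $$T(l_j,-s_0^{(j)},\dots,-s^{(j)}_{\ell-2n_j})\,T(\mathfrak s^{(j)}_{-1},\dots,\mathfrak s^{(j)}_{\ell-2n_j})=I .$$ *)

(* Defs.v *)
From HB Require Import structures.
From mathcomp Require Import all_boot all_order all_algebra.
From mathcomp Require Import complex polyrcf.
From mathcomp Require Import all_classical all_reals all_analysis.
Set Implicit Arguments.
Unset Strict Implicit.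
Unset Printing Implicit Defensive.
Import Order.TTheory GRing.Theory Num.Theory.
Import numFieldNormedType.Exports.
Local Open Scope classical_set_scope.
Local Open Scope complex_scope.
Local Open Scope ring_scope.

Section Functions.
Variable R : realType.
Local Notation C := R[i].
Implicit Types (f g tau : C -> C) (z : C).

Definition holomorphic_at f z :=
  \forall w \near (z : C^o), derivable (f : C^o -> C^o) w 1.

Definition pole_at f z0 := exists (g : C -> C) (p : nat),
  [/\ (0 < p)%N, holomorphic_at g z0, g z0 != 0 &
      \forall z \near (z0 : C^o)^', f z = g z / (z - z0) ^+ p].

(* A function meromorphic on C \ R is represented by a total function; its
   values on R and at its poles carry no meaning.  Removable singularities
   are not allowed, so that every other value does. *)
Definition meromorphic f := forall z, complex.Im z != 0 ->
  holomorphic_at f z \/ pole_at f z.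

Definition hol_dom f : set C :=
  [set z | complex.Im z != 0 /\ holomorphic_at f z].

(* Equality of meromorphic functions f = p / q, q being not identically zero
   on either half-plane. *)
Definition mero_eq_quotient f (p q : C -> C) :=
  forall z0, complex.Im z0 != 0 ->
  \forall z \near (z0 : C^o)^', q z != 0 /\ f z = p z / q z.

(* The form is a combination of squares |L_i xi|^2 of linearly independent
   linear forms, with real coefficients of which exactly m are negative. *)
Definition negative_squares (n : nat) (form : 'cV[C]_n -> C) (m : nat) :=
  exists (L : 'M[C]_n) (d : 'I_n -> R),
  [/\ L \in unitmx,
      forall xi, form xi = \sum_i (d i)%:C * `|(L *m xi) i 0| ^+ 2 &
      #|[set i | d i < 0]%SET| = m].

Definition nevanlinna_form f (n : nat) (z : 'I_n -> C) (xi : 'cV[C]_n) : C :=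
  \sum_i \sum_j (f (z i) - (f (z j))^*) / (z i - (z j)^*)
    * xi i 0 * (xi j 0)^*.

Definition admissible f (n : nat) (z : 'I_n -> C) :=
  injective z /\ forall i, 0 < complex.Im (z i) /\ hol_dom f (z i).

(* The index is an integer: for a negative one the class is empty, since a
   number of negative squares is a natural number. *)
Definition nevanlinna (kappa : int) : set (C -> C) := [set f |
  [/\ meromorphic f,
      forall z, hol_dom f z -> f z^* = (f z)^*,
      forall n (z : 'I_n -> C), admissible f z ->
        exists2 m : nat, negative_squares (nevanlinna_form f z) m
                       & m%:Z <= kappa &
      exists n (z : 'I_n -> C), admissible f z /\
        exists2 m : nat, negative_squares (nevanlinna_form f z) m
                       & m%:Z = kappa]].

Definition nevanlinna2 (kappa k : int) : set (C -> C) :=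
  [set f | nevanlinna kappa f /\ nevanlinna k (fun z => z * f z)].

Definition littleo_pinfty (u v : R -> C) := forall eps : R, 0 < eps ->
  \forall y \near +oo, `|u y| <= eps%:C * `|v y|.

Definition moment_solutions (kappa k : int) (s : seq R) (l : nat) :
    set (C -> C) :=
  [set f | nevanlinna2 kappa k f /\
    littleo_pinfty
      (fun y => f (0 +i* y) -
                (- \sum_(j < l.+1) (s`_j)%:C / (0 +i* y) ^+ j.+1))
      (fun y => 1 / (0 +i* y) ^+ l.+1)].

Definition nontangential_o1 tau := forall eps : R, 0 < eps ->
  forall delta : R, 0 < delta ->
  \forall r \near +oo, forall theta : R, eps < theta < pi - eps ->
  `|tau ((r * cos theta) +i* (r * sin theta))| < delta%:C.

Definition cpoly (p : {poly R}) (z : C) : C :=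
  (map_poly (real_complex R) p).[z].

End Functions.

Section Hankel.
Variable R : realType.
Implicit Types (s c : seq R).

Definition hankel s n : 'M[R]_n := \matrix_(i, j) s`_(i + j).
Definition hankel_plus s n : 'M[R]_n := \matrix_(i, j) s`_(i + j).+1.

(* Negative eigenvalues, counted with multiplicity. *)
Definition nu_minus n (A : 'M[R]_n) : nat :=
  (\sum_(a <- rootsR (char_poly A) | (a < 0)%R) mup a (char_poly A))%N.

(* The middle condition says that the entries s_0, ..., s_(2n-2) of S_n belong
   to the finite sequence s. *)
Definition normal_index s n : bool :=
  [&& (0 < n)%N, (2 * n - 1 <= size s)%N & \det (hankel s n) != 0].

(* T(c_0, ..., c_n), when d = size c = n.+1 *)
Definition toeplitz d c : 'M[R]_d :=
  \matrix_(i, j) if (i <= j)%N then c`_(j - i) else 0.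

Definition schur_Delta (nu : nat) s : {poly R} :=
  \det (\matrix_(i < nu, p < nu)
          if (i < nu.-1)%N then (s`_(i + p).+1)%:P else 'X^p).

Definition schur_m (nu : nat) s : {poly R} :=
  ((-1) ^+ nu.+1 / \det (hankel s nu)) *: schur_Delta nu s.

Definition schur_l (nu : nat) s : R :=
  (-1) ^+ nu.+1 * s`_nu.-1 * (\det (hankel s nu) / \det (hankel_plus s nu)).

(* sq j is the sequence s^(j), and fs j is the sequence
   (\mathfrak s^(j)_(i-1))_(i >= 0), whose indices are shifted by one. *)
Definition schur_recursion (N : nat) (n : nat -> nat) s
    (m : nat -> {poly R}) (l : nat -> R) :=
  exists sq fs : nat -> seq R,
  [/\ sq 0%N = s,
      forall j, (1 <= j <= N)%N -> let nu := (n j - n j.-1)%N in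
        m j = schur_m nu (sq j.-1) /\ l j = schur_l nu (sq j.-1) &
      forall j, (1 <= j <= N.-1)%N -> let nu := (n j - n j.-1)%N in
        let d := (2 * n N - 2 * n j)%N in
        [/\ size (sq j) = d,
            size (fs j) = d.+1,
            toeplitz (nu + d.+1)
                (rev [seq (m j)`_i | i <- iota 0 nu] ++ [seq - x | x <- fs j])
              *m toeplitz (nu + d.+1) (drop nu.-1 (sq j.-1)) = 1%:M &
            toeplitz d.+1 (l j :: [seq - x | x <- sq j])
              *m toeplitz d.+1 (fs j) = 1%:M]].

(* The pair (X_(2i-1), X_(2i)) of the solution with (X_(-1), X_0) = X0. *)
Fixpoint three_term (m : nat -> {poly R}) (l : nat -> R)
    (X0 : {poly R} * {poly R}) (i : nat) : {poly R} * {poly R} :=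
  if i is i'.+1 then
    let X := three_term m l X0 i' in
    let Xodd := - 'X * m i * X.2 + X.1 in
    (Xodd, l i *: Xodd + X.2)
  else X0.

Definition P_plus m l := three_term m l (0, 1).
Definition Q_plus m l := three_term m l (1, 0).

End Hankel.

(* Main.v *)
Require Import Defs.
From mathcomp Require Import all_boot all_order all_algebra.
From mathcomp Require Import complex polyrcf.
From mathcomp Require Import all_classical all_reals all_analysis.
From mathcomp Require Import ring lra zify.
Set Implicit Arguments.
Unset Strict Implicit.
Unset Printing Implicit Defensive.
Import Order.TTheory GRing.Theory Num.Theory.
Import numFieldNormedType.Exports.
Local Open Scope classical_set_scope.
Local Open Scope ring_scope.

(** Write [step_up m l f] for the function [F] with
    [f = 1 / (- z m + 1 / (l + F))].  Applied with [m_1, l_1], then with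
    [m_2, l_2], and so on, it turns [f = F_0] into [F_1, ..., F_N], and composing
    the inverse maps gives [f = (Q_2N + Q_(2N-1) F_N) / (P_2N + P_(2N-1) F_N)]
    ([linked_quotient]).  The theorem says what this bijection [f <-> F_N] does
    to asymptotic expansions and to numbers of negative squares.

    Expansions.  The Toeplitz relations state that truncated power series in
    [1/z] are reciprocal to each other, so that [F_(j-1)] has the expansion
    prescribed by [s^(j-1)] exactly if [F_j] has the one prescribed by [s^(j)]
    ([step_up_approx], [step_down_approx]); for [j = N] only [F_N = o(1)] is
    left, and the determinants in the definitions of [m_N] and [l_N] do the same
    job ([step_data_last]).  This needs [s^(j-1)] to begin with the right number
    of zeros, hence to have the expected normal indices.  A Hankel determinant
    vanishes exactly if there is a Pade approximant with too good an order, and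
    Pade approximants of [F_(j-1)] and of [F_j] correspond to each other; so
    normal indices and regularity are inherited along the recursion
    ([recursion_steps]).

    Negative squares.  The kernel of [- 1 / F] is congruent to that of [F], and
    adding a real polynomial to a function that is [o(z)] on the imaginary axis
    changes the number of negative squares by the number of negative eigenvalues
    of the Bezoutian of the polynomial ([polynomial_indices]): points moved to
    infinity on the axis see the polynomial only.  Hence a chain adds a constant
    [a] to the index of [F_N], and constants [a', c, c'] to those of [- F_N],
    [z F_N] and [- z F_N], with [a + a' <= n_N] and [c + c' <= n_N]
    ([chain_indices]).  For [F_N = 0] the Hankel matrix of the expansion of
    [F_0] bounds [a] and [a'] from below by its numbers of negative and positive
    eigenvalues ([negG_hankel]), of which there are [n_N] since the matrix is
    nonsingular.  So [a = nu_-(S)], and likewise [c = nu_-(S^+)].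

    Two points remain.  If [tau] has finite index and tends to [0] on the
    imaginary axis, then it does so in every sector: otherwise a point of the
    sector where [tau] is not small, paired with a point of the axis at a
    comparable distance, would give one more negative square, again and again
    ([axis_nontangential]).  And the admissible parameters form a nonempty set,
    as sums of simple poles show ([nevanlinna2_nonempty]).

    A function is given here with a value at every point, and such values are
    lost under the operations above.  All arguments are therefore made up to a
    closed discrete set of points ([generic], [quasi], [gen_infty]), the index
    included ([negG], [nevanlinnaP]), and [reg] restores the values at the end.
    That products, inverses and limits of such functions are again meromorphic
    rests on the factorization of a holomorphic function at a zero, hence on
    Cauchy's formula, which is derived for squares from Goursat's lemma. *)

(** * The modulus of a complex number *)

Section ComplexBasics.
Variable R : realType.
Local Notation C := R[i].
Implicit Types (z w : C) (r : R).

(** The library norm of a complex number is itself a complex number; estimates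
    are made with its real part. *)
Definition cabs z : R := complex.Re `|z|.

Lemma realC_eq0 r : (r%:C%C == 0 :> C) = (r == 0).
Proof. exact: (inj_eq (@complexI R) _ 0). Qed.

Lemma normcabs z : `|z| = (cabs z)%:C%C.
Proof. by rewrite /cabs normc_def. Qed.

Lemma cabs_ge0 z : 0 <= cabs z.
Proof. by rewrite -ler0c -normcabs. Qed.

Lemma cabsD z w : cabs (z + w) <= cabs z + cabs w.
Proof. by rewrite -lecR rmorphD /= -!normcabs ler_normD. Qed.

Lemma cabsM z w : cabs (z * w) = cabs z * cabs w.
Proof. by apply: complexI; rewrite rmorphM /= -!normcabs normrM. Qed.

Lemma cabsN z : cabs (- z) = cabs z.
Proof. by rewrite /cabs normrN. Qed.

Lemma cabsB z w : cabs (z - w) = cabs (w - z).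
Proof. by rewrite -cabsN opprB. Qed.

Lemma cabsV z : cabs z^-1 = (cabs z)^-1.
Proof. by apply: complexI; rewrite fmorphV /= -!normcabs normfV. Qed.

Lemma cabs_eq0 z : (cabs z == 0) = (z == 0).
Proof. by rewrite -[RHS]normr_eq0 normcabs realC_eq0. Qed.

Lemma cabs_gt0 z : (0 < cabs z) = (z != 0).
Proof. by rewrite lt_def cabs_ge0 andbT cabs_eq0. Qed.

Lemma cabs0 : cabs 0 = 0.
Proof. by apply/eqP; rewrite cabs_eq0. Qed.

Lemma cabs1 : cabs 1 = 1.
Proof. by rewrite /cabs normr1. Qed.

Lemma cabs_real r : cabs r%:C%C = `|r|.
Proof. by rewrite /cabs normc_def /= expr0n addr0 sqrtr_sqr. Qed.

Lemma cabsX z n : cabs (z ^+ n) = cabs z ^+ n.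
Proof. by elim: n => [|n IH]; rewrite ?expr0 ?cabs1 // !exprS cabsM IH. Qed.

Lemma cabs_sum (I : Type) (s : seq I) (P : pred I) (F : I -> C) :
  cabs (\sum_(i <- s | P i) F i) <= \sum_(i <- s | P i) cabs (F i).
Proof.
elim/big_ind2: _ => [|x1 x2 y1 y2 h1 h2|//]; first by rewrite cabs0.
exact: le_trans (cabsD _ _) (lerD h1 h2).
Qed.

Lemma Re_le_cabs z : `|complex.Re z| <= cabs z.
Proof. by rewrite -lecR -normcabs normc_ge_Re. Qed.

Lemma cabsi : cabs 'i%C = 1.
Proof. by rewrite /cabs normc_def /= expr0n add0r expr1n sqrtr1. Qed.

Lemma Im_le_cabs z : `|complex.Im z| <= cabs z.
Proof.
by rewrite -[leRHS]mulr1 -cabsi -cabsM -normrN -ReiNIm Re_le_cabs.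
Qed.

Lemma cabs_le_ReIm z : cabs z <= `|complex.Re z| + `|complex.Im z|.
Proof.
rewrite [z in leLHS]complexE (le_trans (cabsD _ _)) // cabsM cabsi mul1r.
by rewrite !cabs_real.
Qed.

Lemma cabs_conj z : cabs (Num.conj z) = cabs z.
Proof. by rewrite /cabs norm_conjC. Qed.

Lemma Im_conj z : complex.Im (Num.conj z) = - complex.Im z.
Proof. by case: z. Qed.

Lemma Im_conj_neq0 z : (complex.Im (Num.conj z) != 0) = (complex.Im z != 0).
Proof. by rewrite Im_conj oppr_eq0. Qed.

Lemma cabs_sub z w : cabs z - cabs w <= cabs (z - w).
Proof. by rewrite lerBlDr (le_trans _ (cabsD _ _)) // subrK. Qed.

Lemma nbhs_cabs z0 (A : set C) :
  nbhs (z0 : C^o) A <-> exists2 r, 0 < r & forall z, cabs (z - z0) < r -> A z.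
Proof.
split=> [/nbhs_ballP[e e0 H]|[r r0 H]].
  have re : e = (complex.Re e)%:C%C by rewrite RRe_real ?gtr0_real.
  exists (complex.Re e); first by move: e0 => /=; rewrite ltcE => /andP[_].
  move=> z hz; apply: H; rewrite -ball_normE /= re.
  by rewrite distrC normcabs ltcR.
apply/nbhs_ballP; exists r%:C%C => /=; first by rewrite ltcE /= eqxx.
by move=> z; rewrite -ball_normE /= distrC normcabs ltcR => /H.
Qed.

Lemma dnbhs_cabs z0 (A : set C) :
  nbhs (z0 : C^o)^' A <->
  exists2 r, 0 < r & forall z, z != z0 -> cabs (z - z0) < r -> A z.
Proof.
split=> [/nbhs_cabs[r r0 H]|[r r0 H]].
  by exists r => // z zz0 hz; exact: H.
by apply/nbhs_cabs; exists r => // z hz zz0; exact: H.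
Qed.

Lemma cvgC {T : Type} (F : set_system T) {FF : Filter F} (f : T -> C) (l : C) :
  f x @[x --> F] --> (l : C^o) <->
  forall e : R, 0 < e -> \forall x \near F, cabs (f x - l) < e.
Proof.
split=> [H e e0|H].
  by apply: (H [set y | cabs (y - l) < e]); apply/nbhs_cabs; exists e.
move=> A /nbhs_cabs[r r0 HA]; near=> x; apply: HA.
by near: x; exact: H.
Unshelve. all: end_near. Qed.

Lemma derivable_cabs (f : C -> C) z :
  derivable (f : C^o -> C^o) z 1 <->
  exists d : C, forall e : R, 0 < e -> exists2 r : R, 0 < r &
    forall w, cabs (w - z) < r ->
      cabs (f w - f z - d * (w - z)) <= e * cabs (w - z).
Proof.
split=> [/cvg_ex[d hd]|[d hd]].
  exists d => e e0; have /cvgC/(_ _ e0) := hd.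
  move=> /dnbhs_cabs[r r0 H]; exists r => // w hw.
  have [->|wz] := eqVneq w z.
    by rewrite !subrr mulr0 subrr !cabs0 mulr0.
  have wz0 : w - z != 0 by rewrite subr_eq0.
  have := H (w - z) wz0; rewrite subr0 => /(_ hw)/=.
  rewrite [_ *: 1]mulr1 subrK -[_ *: _]/(_ * _) => h.
  have -> : f w - f z - d * (w - z) =
      ((w - z)^-1 * (f w - f z) - d) * (w - z) by field.
  by rewrite cabsM ler_pM2r ?cabs_gt0 // ltW.
apply/cvg_ex; exists d; apply/cvgC => e e0.
have e20 : 0 < e / 2 by rewrite divr_gt0.
have [r r0 H] := hd _ e20; apply/dnbhs_cabs; exists r => // h h0.
rewrite subr0 => hr; rewrite /= [_ *: 1]mulr1 -[_ *: _]/(_ * _).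
have := H (h + z); rewrite addrK => /(_ hr) hh.
have -> : h^-1 * (f (h + z) - f z) - d = (f (h + z) - f z - d * h) * h^-1.
  by field.
rewrite cabsM cabsV ltr_pdivrMr ?cabs_gt0 // (le_lt_trans hh) //.
by rewrite ltr_pM2r ?cabs_gt0 // ltr_pdivrMr // ltr_pMr // (ltr1n _ 2).
Qed.

End ComplexBasics.

(** * Integrals of complex functions over segments *)

Section Integration.
Variable R : realType.
Local Notation C := R[i].
Local Notation mu := (@lebesgue_measure R).
Implicit Types (a b c x y : R) (F G : R -> C).

Definition contseg a b F := forall x, a <= x <= b -> forall e : R, 0 < e ->
  exists2 d : R, 0 < d & forall y, a <= y <= b -> `|y - x| < d ->
    cabs (F y - F x) < e.

(** Real and imaginary parts are integrated separately, which costs a factor 2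
    in [cintg_bound]. *)
Definition cintg a b F : C :=
  ((\int[mu]_(x in `[a, b]) complex.Re (F x)) +i*
   (\int[mu]_(x in `[a, b]) complex.Im (F x)))%C.

Lemma contseg_part (p : C -> R) a b F :
  (forall z w, p (z - w) = p z - p w) -> (forall z, `|p z| <= cabs z) ->
  contseg a b F -> mu.-integrable `[a, b] (EFin \o (p \o F)).
Proof.
move=> pB ple cF; apply: continuous_compact_integrable.
  exact: segment_compact.
apply/subspace_continuousP => x; rewrite /= in_itv /= => xab.
apply/cvgrPdist_lt => e e0; have [d d0 H] := cF x xab e e0.
rewrite near_withinE; near=> y; rewrite /= in_itv /= => yab.
rewrite -pB (le_lt_trans (ple _)) // cabsB H // distrC.
Unshelve. all: end_near. Qed.

Lemma contseg_Re a b F : contseg a b F ->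
  mu.-integrable `[a, b] (EFin \o (fun x => complex.Re (F x))).
Proof.
apply: contseg_part; last exact: Re_le_cabs.
by move=> z w; rewrite raddfB.
Qed.

Lemma contseg_Im a b F : contseg a b F ->
  mu.-integrable `[a, b] (EFin \o (fun x => complex.Im (F x))).
Proof.
apply: contseg_part; last exact: Im_le_cabs.
by move=> z w; rewrite raddfB.
Qed.

Lemma eq_cintg a b F G : (forall x, a <= x <= b -> F x = G x) ->
  cintg a b F = cintg a b G.
Proof.
move=> FG; congr Complex; apply: eq_Rintegral => x;
  by rewrite inE /= in_itv /= => /FG ->.
Qed.

Lemma cintgD a b F G : contseg a b F -> contseg a b G ->
  cintg a b (fun x => F x + G x) = cintg a b F + cintg a b G.
Proof.
move=> cF cG; apply/eqP; rewrite eq_complex /=.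
rewrite -!RintegralD //; do ?exact: contseg_Re; do ?exact: contseg_Im.
by apply/andP; split; apply/eqP; apply: eq_Rintegral => x _; rewrite raddfD.
Qed.

Lemma cintgZ a b k F : contseg a b F ->
  cintg a b (fun x => k * F x) = k * cintg a b F.
Proof.
move=> cF; have cR := contseg_Re cF; have cI := contseg_Im cF.
have mab : measurable (`[a, b] : set R) by [].
have Z (g : R -> R) (t : R) : mu.-integrable `[a, b] (EFin \o g) ->
    mu.-integrable `[a, b] (EFin \o (fun x => t * g x)).
  move=> ig; rewrite (_ : _ \o _ = (fun x => t%:E * (EFin \o g) x)%E) //.
  exact: integrableZl.
case: k => k1 k2; apply/eqP; rewrite eq_complex /=; apply/andP; split; apply/eqP.
  rewrite -!RintegralZl // -RintegralB //; try exact: Z.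
  by apply: eq_Rintegral => x _; case: (F x).
rewrite -!RintegralZl // -RintegralD //; try exact: Z.
by apply: eq_Rintegral => x _; case: (F x).
Qed.

Lemma cintg_split a b c F : a <= c <= b -> contseg a b F ->
  cintg a b F = cintg a c F + cintg c b F.
Proof.
move=> /andP[ac cb] cF.
have H (g : R -> R) : mu.-integrable `[a, b] (EFin \o g) ->
    \int[mu]_(x in `[a, b]) g x =
    \int[mu]_(x in `[a, c]) g x + \int[mu]_(x in `[c, b]) g x.
  move=> ig; rewrite -(@Rintegral_itv_obnd_cbnd _ c).
    by rewrite -(@Rintegral_itvB _ g (BLeft a) (BRight b) c) ?bnd_simp // addrC subrK.
  apply: integrableS ig => //; apply: subset_itvr.
  by rewrite bnd_simp (le_trans ac).
by rewrite /cintg H ?[X in (_ +i* X)%C]H //; [exact: contseg_Im|exact: contseg_Re].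
Qed.

Lemma fine_mu_itv a b : a <= b -> fine (mu `[a, b]) = b - a.
Proof.
move=> ab; have -> := lebesgue_measure_itv `[a, b]; rewrite /= lte_fin.
by case: ltgtP ab => // -> _; rewrite subrr.
Qed.

Lemma cintg_bound a b F M : a <= b -> contseg a b F ->
  (forall x, a <= x <= b -> cabs (F x) <= M) ->
  cabs (cintg a b F) <= 2 * M * (b - a).
Proof.
move=> ab cF FM.
have H (g : R -> R) : mu.-integrable `[a, b] (EFin \o g) ->
    (forall x, a <= x <= b -> `|g x| <= M) ->
    `|\int[mu]_(x in `[a, b]) g x| <= M * (b - a).
  move=> ig gM; apply: (le_trans (le_normr_Rintegral _ ig)) => //.
  have -> : M * (b - a) = \int[mu]_(x in `[a, b]) (fun=> M) x.
    by rewrite Rintegral_cst // fine_mu_itv.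
  apply: le_Rintegral => //.
  - have := integrable_abse ig; exact.
  - by apply: continuous_compact_integrable => //; [exact: segment_compact
      |apply: continuous_subspaceT => x; exact: cvg_cst].
apply: le_trans (cabs_le_ReIm _) _.
rewrite -mulrA mulr_natl mulr2n lerD //=; apply: H.
- exact: contseg_Re.
- by move=> x /FM; apply: le_trans; exact: Re_le_cabs.
- exact: contseg_Im.
- by move=> x /FM; apply: le_trans; exact: Im_le_cabs.
Qed.

Lemma contseg_cst a b k : contseg a b (fun=> k).
Proof. by move=> x _ e e0; exists 1 => // y _ _; rewrite subrr cabs0. Qed.

Lemma contseg_id a b : contseg a b (fun x => x%:C%C).
Proof.
move=> x _ e e0; exists e => // y _ h.
by rewrite -rmorphB /= cabs_real.
Qed.

Lemma contsegZ a b k F : contseg a b F -> contseg a b (fun x => k * F x).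
Proof.
move=> cF x xab e e0; have k0 : 0 < cabs k + 1 by rewrite ltr_wpDl ?cabs_ge0.
have [d d0 H] := cF x xab _ (divr_gt0 e0 k0).
exists d => // y yab h; rewrite -mulrBr cabsM.
have := H y yab h; rewrite ltr_pdivlMr // mulrC; apply: le_lt_trans.
by rewrite ler_wpM2r ?cabs_ge0 // lerDl.
Qed.

Lemma cintg_cst a b k : a <= b -> cintg a b (fun=> k) = k * (b - a)%:C%C.
Proof.
move=> ab; rewrite /cintg !Rintegral_cst // fine_mu_itv //.
by case: k => k1 k2; apply/eqP; rewrite eq_complex /= !mulr0 subr0 add0r !eqxx.
Qed.

Lemma cintg_id a b : a <= b ->
  cintg a b (fun x => x%:C%C) = ((b ^+ 2 - a ^+ 2) / 2)%:C%C.
Proof.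
move=> ab; rewrite /cintg /= Rintegral_cst // mul0r; congr Complex.
move: ab; rewrite le_eqVlt => /predU1P[->|ab].
  by rewrite subrr mul0r set_itv1 Rintegral_set1.
rewrite /Rintegral (@continuous_FTC2 _ _ (fun x => x ^+ 2 / 2)) //=.
- by rewrite mulrBl.
- by apply: continuous_subspaceT => x; exact: cvg_id.
- split => /=.
  + by move=> x _; apply: derivableM => //; exact: exprn_derivable.
  + by apply: cvg_at_right_filter; apply: cvgM; [exact: exprn_continuous|exact: cvg_cst].
  + by apply: cvg_at_left_filter; apply: cvgM; [exact: exprn_continuous|exact: cvg_cst].
- move=> x _; rewrite derive1E.
  rewrite deriveM // derive_cst scaler0 add0r.
  have -> := @exp_derive R 2 x 1.
  rewrite /GRing.scale /= mulr1; by field.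
Qed.

End Integration.

(** * Goursat's lemma on rectangles *)

Section Goursat.
Variable R : realType.
Local Notation C := R[i].
Implicit Types (a b c x y : R) (f g : C -> C) (z w : C).

Definition cdiff f z := exists d : C, forall e : R, 0 < e ->
  exists2 r : R, 0 < r & forall w, cabs (w - z) < r ->
    cabs (f w - f z - d * (w - z)) <= e * cabs (w - z).

Definition ccont f z := forall e : R, 0 < e ->
  exists2 r : R, 0 < r & forall w, cabs (w - z) < r -> cabs (f w - f z) < e.

Lemma cdiff_cont f z : cdiff f z -> ccont f z.
Proof.
move=> [d hd] e e0; have [r r0 H] := hd 1 ltr01.
have k0 : 0 < cabs d + 1 by rewrite ltr_wpDl ?cabs_ge0.
exists (Num.min r (e / (cabs d + 1))); first by rewrite lt_min r0 divr_gt0.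
move=> w; rewrite lt_min => /andP[wr]; rewrite ltr_pdivlMr // => we.
have -> : f w - f z = (f w - f z - d * (w - z)) + d * (w - z) by rewrite subrK.
rewrite (le_lt_trans (cabsD _ _)) // (le_lt_trans _ we) // cabsM.
by rewrite [leRHS]mulrDr mulr1 addrC [cabs d * _]mulrC lerD // -[leRHS]mul1r H.
Qed.

Definition inrect x0 x1 y0 y1 z :=
  (x0 <= complex.Re z <= x1) && (y0 <= complex.Im z <= y1).

(** The integral over the boundary of a rectangle, counterclockwise. *)
Definition rint f x0 x1 y0 y1 : C :=
  cintg x0 x1 (fun x => f (x +i* y0)%C) - cintg x0 x1 (fun x => f (x +i* y1)%C)
  + 'i%C * (cintg y0 y1 (fun y => f (x1 +i* y)%C)
            - cintg y0 y1 (fun y => f (x0 +i* y)%C)).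

Definition rcont f x0 x1 y0 y1 := forall z, inrect x0 x1 y0 y1 z -> ccont f z.

Definition onbd x0 x1 y0 y1 : set C := [set z | inrect x0 x1 y0 y1 z /\
  [|| complex.Re z == x0, complex.Re z == x1, complex.Im z == y0
    | complex.Im z == y1]].

(** A one-constructor type: it keeps tactics from unfolding the limit. *)
Variant bcont f x0 x1 y0 y1 : Prop := BCont of forall z,
  onbd x0 x1 y0 y1 z ->
  f w @[w --> within (onbd x0 x1 y0 y1) (nbhs (z : C^o))] --> (f z : C^o).

Lemma bcontP f x0 x1 y0 y1 : bcont f x0 x1 y0 y1 <->
  forall z, onbd x0 x1 y0 y1 z -> forall e : R, 0 < e -> exists2 r : R, 0 < r &
    forall w, onbd x0 x1 y0 y1 w -> cabs (w - z) < r -> cabs (f w - f z) < e.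
Proof.
split=> [[H] z hz|H].
  move=> e e0; have /cvgC/(_ e e0) := H z hz.
  rewrite near_withinE => /nbhs_cabs[r r0 K]; exists r => // w hw wz; exact: K.
apply: BCont => z hz; apply/cvgC => e e0.
rewrite near_withinE; apply/nbhs_cabs.
by have [r r0 K] := H z hz e e0; exists r => // w wz hw; exact: K.
Qed.

Lemma rcont_bcont f x0 x1 y0 y1 : rcont f x0 x1 y0 y1 -> bcont f x0 x1 y0 y1.
Proof.
move=> H; apply/bcontP => z [hz _] e e0; have [r r0 K] := H z hz e e0.
by exists r => // w _; exact: K.
Qed.

Lemma bcont_x f x0 x1 y0 y1 y : y0 <= y1 -> (y == y0) || (y == y1) ->
  bcont f x0 x1 y0 y1 -> contseg x0 x1 (fun x => f (x +i* y)%C).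
Proof.
move=> hy yy /bcontP H; have B t : x0 <= t <= x1 -> onbd x0 x1 y0 y1 (t +i* y)%C.
  move=> ht; split; last by rewrite /= yy !orbT.
  by rewrite /inrect /= ht; case/orP: yy => /eqP->; rewrite ?lexx ?hy.
move=> x /B hx e e0; have [r r0 K] := H _ hx e e0; exists r => // t /B ht tx.
apply: K => //; have -> : ((t +i* y) - (x +i* y) = (t - x)%:C)%C.
  by apply/eqP; rewrite eq_complex /= subrr !eqxx.
by rewrite cabs_real.
Qed.

Lemma bcont_y f x0 x1 y0 y1 x : x0 <= x1 -> (x == x0) || (x == x1) ->
  bcont f x0 x1 y0 y1 -> contseg y0 y1 (fun y => f (x +i* y)%C).
Proof.
move=> hx xx /bcontP H; have B t : y0 <= t <= y1 -> onbd x0 x1 y0 y1 (x +i* t)%C.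
  move=> ht; split; last by rewrite /= orbA xx.
  by rewrite /inrect /= ht andbT; case/orP: xx => /eqP->; rewrite ?lexx ?hx.
move=> y /B hy e e0; have [r r0 K] := H _ hy e e0; exists r => // t /B ht ty.
apply: K => //; have -> : ((x +i* t) - (x +i* y) = 'i * (t - y)%:C)%C.
  by apply/eqP; rewrite eq_complex /=; apply/andP; split; apply/eqP; ring.
by rewrite cabsM cabsi mul1r cabs_real.
Qed.

Lemma bcont_bot f x0 x1 y0 y1 : y0 <= y1 -> bcont f x0 x1 y0 y1 ->
  contseg x0 x1 (fun x => f (x +i* y0)%C).
Proof. by move=> h; apply: bcont_x; rewrite ?eqxx. Qed.

Lemma bcont_top f x0 x1 y0 y1 : y0 <= y1 -> bcont f x0 x1 y0 y1 ->
  contseg x0 x1 (fun x => f (x +i* y1)%C).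
Proof. by move=> h; apply: bcont_x; rewrite ?eqxx ?orbT. Qed.

Lemma bcont_left f x0 x1 y0 y1 : x0 <= x1 -> bcont f x0 x1 y0 y1 ->
  contseg y0 y1 (fun y => f (x0 +i* y)%C).
Proof. by move=> h; apply: bcont_y; rewrite ?eqxx. Qed.

Lemma bcont_right f x0 x1 y0 y1 : x0 <= x1 -> bcont f x0 x1 y0 y1 ->
  contseg y0 y1 (fun y => f (x1 +i* y)%C).
Proof. by move=> h; apply: bcont_y; rewrite ?eqxx ?orbT. Qed.

Lemma rint_splitx f x0 c x1 y0 y1 : x0 <= c <= x1 -> y0 <= y1 ->
  rcont f x0 x1 y0 y1 ->
  rint f x0 x1 y0 y1 = rint f x0 c y0 y1 + rint f c x1 y0 y1.
Proof.
move=> h h' H; rewrite /rint (cintg_split h (bcont_bot h' (rcont_bcont H))).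
by rewrite (cintg_split h (bcont_top h' (rcont_bcont H))); ring.
Qed.

Lemma rint_splity f x0 x1 y0 c y1 : x0 <= x1 -> y0 <= c <= y1 ->
  rcont f x0 x1 y0 y1 ->
  rint f x0 x1 y0 y1 = rint f x0 x1 y0 c + rint f x0 x1 c y1.
Proof.
move=> h h' H; rewrite /rint (cintg_split h' (bcont_left h (rcont_bcont H))).
by rewrite (cintg_split h' (bcont_right h (rcont_bcont H))); ring.
Qed.

Lemma rint_bound f x0 x1 y0 y1 M : x0 <= x1 -> y0 <= y1 ->
  bcont f x0 x1 y0 y1 ->
  (forall z, onbd x0 x1 y0 y1 z -> cabs (f z) <= M) ->
  cabs (rint f x0 x1 y0 y1) <= 4 * M * ((x1 - x0) + (y1 - y0)).
Proof.
move=> hx hy H HM; rewrite /rint.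
have B (F : R -> C) a b : a <= b -> contseg a b F ->
  (forall t, a <= t <= b -> cabs (F t) <= M) -> cabs (cintg a b F) <= 2 * M * (b - a).
  exact: cintg_bound.
have b1 := B _ _ _ hx (bcont_bot hy H); have b2 := B _ _ _ hx (bcont_top hy H).
have b3 := B _ _ _ hy (bcont_left hx H); have b4 := B _ _ _ hy (bcont_right hx H).
have {}b1 := b1 _; have {}b2 := b2 _; have {}b3 := b3 _; have {}b4 := b4 _.
rewrite (le_trans (cabsD _ _)) // cabsM cabsi mul1r.
have -> : 4 * M * (x1 - x0 + (y1 - y0)) =
  (2 * M * (x1 - x0) + 2 * M * (x1 - x0)) +
  (2 * M * (y1 - y0) + 2 * M * (y1 - y0)) by ring.
rewrite lerD // (le_trans (cabsD _ _)) // cabsN lerD //.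
- by apply: b1 => t ht; apply: HM; rewrite /onbd /inrect /= ht ?hx ?hy ?lexx ?eqxx ?orbT.
- by apply: b2 => t ht; apply: HM; rewrite /onbd /inrect /= ht ?hx ?hy ?lexx ?eqxx ?orbT.
- by apply: b4 => t ht; apply: HM; rewrite /onbd /inrect /= ht ?hx ?hy ?lexx ?eqxx ?orbT.
- by apply: b3 => t ht; apply: HM; rewrite /onbd /inrect /= ht ?hx ?hy ?lexx ?eqxx ?orbT.
Qed.

Lemma rintD f g x0 x1 y0 y1 : x0 <= x1 -> y0 <= y1 ->
  bcont f x0 x1 y0 y1 -> bcont g x0 x1 y0 y1 ->
  rint (fun z => f z + g z) x0 x1 y0 y1 =
  rint f x0 x1 y0 y1 + rint g x0 x1 y0 y1.
Proof.
move=> hx hy cf cg; rewrite /rint.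
rewrite (cintgD (bcont_bot hy cf) (bcont_bot hy cg)).
rewrite (cintgD (bcont_top hy cf) (bcont_top hy cg)).
rewrite (cintgD (bcont_left hx cf) (bcont_left hx cg)).
rewrite (cintgD (bcont_right hx cf) (bcont_right hx cg)); ring.
Qed.

Lemma cdiff_affine k d z : cdiff (fun z => k + d * z) z.
Proof.
exists d => e e0; exists 1 => // w _.
have -> : k + d * w - (k + d * z) - d * (w - z) = 0 by ring.
by rewrite cabs0 mulr_ge0 ?cabs_ge0 // ltW.
Qed.

(** Functions with an evident primitive; the one explicit computation behind
    Goursat's lemma. *)
Lemma rint_affine k d x0 x1 y0 y1 : x0 <= x1 -> y0 <= y1 ->
  rint (fun z => k + d * z) x0 x1 y0 y1 = 0.
Proof.
move=> hx hy; rewrite /rint.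
have X (q : C) a b : a <= b -> cintg a b (fun x : R => q + d * x%:C%C) =
    q * (b - a)%:C%C + d * ((b ^+ 2 - a ^+ 2) / 2)%:C%C.
  move=> ab; rewrite cintgD ?cintg_cst ?cintgZ ?cintg_id //.
  - exact: contseg_id.
  - exact: contseg_cst.
  - by apply: contsegZ; exact: contseg_id.
have Y (q : C) a b : a <= b -> cintg a b (fun x : R => q + d * 'i%C * x%:C%C) =
    q * (b - a)%:C%C + d * 'i%C * ((b ^+ 2 - a ^+ 2) / 2)%:C%C.
  move=> ab; rewrite cintgD ?cintg_cst ?cintgZ ?cintg_id //.
  - exact: contseg_id.
  - exact: contseg_cst.
  - by apply: contsegZ; exact: contseg_id.
have EX y : (fun x : R => k + d * (x +i* y)%C) =
    (fun x => (k + d * ('i%C * y%:C%C)) + d * x%:C%C).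
  by apply/funext => x; rewrite [(x +i* y)%C]complexE /=; ring.
have EY x : (fun y : R => k + d * (x +i* y)%C) =
    (fun y => (k + d * x%:C%C) + d * 'i%C * y%:C%C).
  by apply/funext => y; rewrite [(x +i* y)%C]complexE /=; ring.
rewrite !EX !EY !X // !Y // !rmorphM !rmorphB !rmorphXn /=.
have i2 := sqr_i R; ring : i2.
Qed.

Lemma segment_dist a x y b : a <= x <= a + b -> a <= y <= a + b -> `|x - y| <= b.
Proof. by move=> /andP[? ?] /andP[? ?]; rewrite ler_norml; apply/andP; split; lra. Qed.

Lemma small_halves (a r : R) : 0 < r -> exists n : nat, a / 2 ^+ n < r.
Proof.
move=> r0; have [a0|a0] := leP a 0.
  by exists 0%N; rewrite expr0 divr1 (le_lt_trans a0).
have /archi_boundP h : 0 <= a / r by rewrite divr_ge0 ?ltW.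
exists (Num.bound (a / r)); rewrite ltr_pdivrMr ?exprn_gt0 //.
rewrite ltr_pdivrMr // in h; rewrite (lt_trans h) // mulrC ltr_pM2l //.
by rewrite -natrX ltr_nat ltn_expl.
Qed.

(** Goursat's argument: were the boundary integral nonzero, one of the four
    quarters would keep a quarter of it, and so on down to a point, where
    comparison with the affine approximation of [f] gives a contradiction. *)
Lemma goursat f x0 x1 y0 y1 : x0 <= x1 -> y0 <= y1 ->
  (forall z, inrect x0 x1 y0 y1 z -> cdiff f z) -> rint f x0 x1 y0 y1 = 0.
Proof.
move=> hx hy df; apply/eqP; rewrite -cabs_eq0; apply/negPn/negP => J0.
set c := cabs _ in J0; have {J0} c0 : 0 < c by rewrite lt_def J0 cabs_ge0.
pose w := x1 - x0; pose h := y1 - y0.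
have w0 : 0 <= w by rewrite subr_ge0.
have h0 : 0 <= h by rewrite subr_ge0.
pose W n := w / 2 ^+ n; pose H n := h / 2 ^+ n.
have W0 n : 0 <= W n by rewrite divr_ge0 // exprn_ge0.
have H0 n : 0 <= H n by rewrite divr_ge0 // exprn_ge0.
have WS n : W n = W n.+1 + W n.+1 by rewrite /W exprS; field; rewrite expf_neq0.
have HS n : H n = H n.+1 + H n.+1 by rewrite /H exprS; field; rewrite expf_neq0.
have [J JE] : {J : nat -> R * R -> R | forall n p,
    J n p = cabs (rint f p.1 (p.1 + W n) p.2 (p.2 + H n))}.
  by exists (fun n p => cabs (rint f p.1 (p.1 + W n) p.2 (p.2 + H n))).
pose ok n (p : R * R) := [/\ x0 <= p.1, p.1 + W n <= x1, y0 <= p.2,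
  p.2 + H n <= y1 & c / 4 ^+ n <= J n p].
have step n p : ok n p -> exists q, ok n.+1 q /\
   (p.1 <= q.1 /\ q.1 + W n.+1 <= p.1 + W n) /\
   (p.2 <= q.2 /\ q.2 + H n.+1 <= p.2 + H n).
  case=> o1 o2 o3 o4; rewrite JE => o5.
  have sub z : inrect p.1 (p.1 + W n) p.2 (p.2 + H n) z -> inrect x0 x1 y0 y1 z.
    move=> /andP[/andP[z1 z2] /andP[z3 z4]]; apply/andP; split; apply/andP; split.
    - exact: le_trans z1. - exact: le_trans o2.
    - exact: le_trans z3. - exact: le_trans o4.
  have cf : rcont f p.1 (p.1 + W n) p.2 (p.2 + H n).
    by move=> z /sub /df; exact: cdiff_cont.
  pose q (u v : bool) := (p.1 + (if u then W n.+1 else 0),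
                          p.2 + (if v then H n.+1 else 0)).
  have qok u v : c / 4 ^+ n.+1 <= J n.+1 (q u v) -> exists q, ok n.+1 q /\
   (p.1 <= q.1 /\ q.1 + W n.+1 <= p.1 + W n) /\
   (p.2 <= q.2 /\ q.2 + H n.+1 <= p.2 + H n).
    move=> hJ; exists (q u v).
    have B (t : bool) (l : R) : 0 <= l -> 0 <= (if t then l else 0) <= l.
      by case: t => l0; rewrite ?l0 !lexx.
    have /andP[b1 b2] := B u _ (W0 n.+1); have /andP[b3 b4] := B v _ (H0 n.+1).
    have k1 : p.1 <= (q u v).1 by rewrite /q /= lerDl.
    have k2 : p.2 <= (q u v).2 by rewrite /q /= lerDl.
    have k3 : (q u v).1 + W n.+1 <= p.1 + W n.
      by rewrite /q /= [W n]WS -addrA lerD2l lerD2r.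
    have k4 : (q u v).2 + H n.+1 <= p.2 + H n.
      by rewrite /q /= [H n]HS -addrA lerD2l lerD2r.
    split=> //; split=> //.
    - exact: le_trans k1. - exact: le_trans o2.
    - exact: le_trans k2. - exact: le_trans o4.
  have [/qok//|s1] := leP (c / 4 ^+ n.+1) (J n.+1 (q false false)).
  have [/qok//|s2] := leP (c / 4 ^+ n.+1) (J n.+1 (q false true)).
  have [/qok//|s3] := leP (c / 4 ^+ n.+1) (J n.+1 (q true false)).
  have [/qok//|s4] := leP (c / 4 ^+ n.+1) (J n.+1 (q true true)).
  exfalso; move: o5.
  have e1 : p.1 <= p.1 + W n.+1 <= p.1 + W n.
    by rewrite lerDl W0 /= lerD2l [leRHS]WS lerDl.
  have e2 : p.2 <= p.2 + H n.+1 <= p.2 + H n.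
    by rewrite lerDl H0 /= lerD2l [leRHS]HS lerDl.
  have hH : p.2 <= p.2 + H n by rewrite lerDl.
  have hW : p.1 <= p.1 + W n by rewrite lerDl.
  case/andP: (e1) => e11 e12; case/andP: (e2) => e21 e22.
  rewrite (rint_splitx e1 hH cf) (rint_splity e11 e2); last first.
    move=> z /andP[/andP[z1 z2] z3]; apply: cf; rewrite /inrect z3 z1 /=.
    by rewrite (le_trans z2).
  rewrite (rint_splity e12 e2); last first.
    move=> z /andP[/andP[z1 z2] z3]; apply: cf; rewrite /inrect z3 z2 /=.
    by rewrite (le_trans _ z1).
  apply/negP; rewrite -ltNge.
  move: s1 s2 s3 s4; rewrite !JE /q /= !addr0 -![_ + _ + W _]addrA.
  rewrite -![_ + _ + H _]addrA -WS -HS => s1 s2 s3 s4.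
  have tri (r1 r2 r3 r4 : C) :
      cabs (r1 + r2 + (r3 + r4)) <= cabs r1 + cabs r2 + (cabs r3 + cabs r4).
    by rewrite (le_trans (cabsD _ _)) // lerD // cabsD.
  rewrite (le_lt_trans (tri _ _ _ _)) //.
  have -> : c / 4 ^+ n = (c / 4 ^+ n.+1 + c / 4 ^+ n.+1) +
      (c / 4 ^+ n.+1 + c / 4 ^+ n.+1).
    by rewrite exprS; field; rewrite expf_neq0.
  exact: (ltrD (ltrD s1 s2) (ltrD s3 s4)).
have ok0 : ok 0%N (x0, y0).
  have eW : x0 + W 0%N = x1 by rewrite /W expr0 divr1 addrC subrK.
  have eH : y0 + H 0%N = y1 by rewrite /H expr0 divr1 addrC subrK.
  by rewrite /ok JE /= eW eH expr0 divr1 !lexx; split.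
pose st n := {p : R * R | ok n p}.
pose nx n (p : st n) : st n.+1 := exist _ _ (projT2 (cid (step n _ (svalP p)))).1.
pose s := fix s n : st n := if n is n'.+1 then nx n' (s n') else exist _ _ ok0.
pose X n := (sval (s n)).1; pose Y n := (sval (s n)).2.
have mono n : (X n <= X n.+1 /\ X n.+1 + W n.+1 <= X n + W n) /\
              (Y n <= Y n.+1 /\ Y n.+1 + H n.+1 <= Y n + H n).
  by have := (projT2 (cid (step n _ (svalP (s n))))).2.
have lim (Z D : nat -> R) : (forall n, 0 <= D n) ->
    (forall n, Z n <= Z n.+1 /\ Z n.+1 + D n.+1 <= Z n + D n) ->
    exists p, forall n, Z n <= p <= Z n + D n.
  move=> D0 ZD.
  have m1 n k : Z n <= Z (n + k)%N.
    by elim: k => [|k IH]; rewrite ?addn0 // addnS (le_trans IH) // (ZD _).1.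
  have m2 n k : Z (n + k)%N + D (n + k)%N <= Z n + D n.
    by elim: k => [|k IH]; rewrite ?addn0 // addnS (le_trans _ IH) // (ZD _).2.
  have ub n m : Z m <= Z n + D n.
    rewrite (le_trans (m1 m n)) // addnC (le_trans _ (m2 n m)) // lerDl //.
  exists (sup (range Z)) => n; apply/andP; split.
    apply: ub_le_sup; last by exists n.
    by exists (Z 0%N + D 0%N) => _ [m _ <-].
  by apply: ge_sup; [exists (Z 0%N); exists 0%N | move=> _ [m _ <-]].
have [px Hpx] := lim X W W0 (fun n => (mono n).1).
have [py Hpy] := lim Y H H0 (fun n => (mono n).2).
pose p := (px +i* py)%C.
have pin : inrect x0 x1 y0 y1 p.
  move: (svalP (s 0%N)) (Hpx 0%N) (Hpy 0%N) => [ o1 o2 o3 o4 _].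
  move=> /andP[p1 p2] /andP[p3 p4]; rewrite /inrect /=.
  by rewrite (le_trans o1 p1) (le_trans p2 o2) (le_trans o3 p3) (le_trans p4 o4).
have [d hd] := df p pin.
pose q := w + h; have q0 : 0 <= q by rewrite addr_ge0.
pose e := c / (4 * (q ^+ 2 + 1)).
have q1 : 0 < q ^+ 2 + 1 by rewrite ltr_wpDl // sqr_ge0.
have e0 : 0 < e by rewrite divr_gt0 // mulr_gt0.
have [r r0 Hr] := hd e e0.
have [n hn] := small_halves q r0.
have := svalP (s n); rewrite -/(X n) -/(Y n) => -[ o1 o2 o3 o4].
rewrite JE -/(X n) -/(Y n).
have sub z : inrect (X n) (X n + W n) (Y n) (Y n + H n) z -> inrect x0 x1 y0 y1 z.
  move=> /andP[/andP[z1 z2] /andP[z3 z4]]; apply/andP; split; apply/andP; split.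
  - exact: le_trans z1. - exact: le_trans o2.
  - exact: le_trans z3. - exact: le_trans o4.
have cf : rcont f (X n) (X n + W n) (Y n) (Y n + H n).
  by move=> z /sub /df; exact: cdiff_cont.
pose A z := (f p - d * p) + d * z.
have cA : rcont A (X n) (X n + W n) (Y n) (Y n + H n).
  by move=> z _; apply: cdiff_cont; exact: cdiff_affine.
pose B z := f z + ((- f p + d * p) + (- d) * z).
have cB : rcont B (X n) (X n + W n) (Y n) (Y n + H n).
  move=> z hz u u0; have u20 : 0 < u / 2 by rewrite divr_gt0.
  have [r1 r10 K1] := cf z hz _ u20.
  have [r2 r20 K2] := cdiff_cont (cdiff_affine (- f p + d * p) (- d) z) u20.
  exists (Num.min r1 r2); first by rewrite lt_min r10.
  move=> z'; rewrite lt_min => /andP[z1 z2].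
  rewrite /B opprD addrACA (le_lt_trans (cabsD _ _)) //.
  by rewrite [ltRHS](splitr u) ltrD ?K1 ?K2.
have fAB : f = (fun z => A z + B z) by apply/funext => z; rewrite /A /B; ring.
have lX : X n <= X n + W n by rewrite lerDl.
have lY : Y n <= Y n + H n by rewrite lerDl.
rewrite fAB (rintD lX lY (rcont_bcont cA) (rcont_bcont cB)) rint_affine // add0r.
apply/negP; rewrite -ltNge.
have dist z : inrect (X n) (X n + W n) (Y n) (Y n + H n) z ->
    cabs (z - p) <= q / 2 ^+ n.
  move=> /andP[/andP[z1 z2] /andP[z3 z4]].
  have /andP[p1 p2] := Hpx n; have /andP[p3 p4] := Hpy n.
  rewrite (le_trans (cabs_le_ReIm _)) // /q mulrDl -/(W n) -/(H n).
  by rewrite !raddfB /= lerD // (@segment_dist (X n) _ _ (W n), @segment_dist (Y n) _ _ (H n)) ?Hpx ?Hpy ?z1 ?z3.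
apply: (le_lt_trans (rint_bound lX lY (rcont_bcont cB) (M := e * (q / 2 ^+ n)) _)).
  move=> z [hz _]; have := Hr z (le_lt_trans (dist z hz) hn).
  have -> : B z = f z - f p - d * (z - p) by rewrite /B; ring.
  move=> hh; apply: (le_trans hh); rewrite ler_wpM2l ?dist //; exact: ltW.
rewrite ![_ + _ - _]addrAC !subrr !add0r -mulrDl -/q.
have -> : 4 ^+ n = 2 ^+ n * 2 ^+ n :> R.
  by rewrite -exprMn; congr (_ ^+ _); rewrite -natrM.
have t0 : 0 < 2 ^+ n * 2 ^+ n :> R by rewrite mulr_gt0 ?exprn_gt0.
rewrite ltr_pdivlMr //.
have -> : 4 * (e * (q / 2 ^+ n)) * (q / 2 ^+ n) * (2 ^+ n * 2 ^+ n)
   = 4 * e * q ^+ 2 by field; rewrite expf_neq0.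
have -> : 4 * e * q ^+ 2 = c * (q ^+ 2 / (q ^+ 2 + 1)).
  by rewrite /e; field; rewrite gt_eqF.
by rewrite gtr_pMr // ltr_pdivrMr // mul1r ltrDl.
Qed.

End Goursat.

(** * Cauchy's integral formula on a square *)

Section Cauchy.
Variable R : realType.
Local Notation C := R[i].
Implicit Types (f g phi : C -> C) (z w a : C).

Lemma eq_rint f g (x0 x1 y0 y1 : R) : x0 <= x1 -> y0 <= y1 ->
  (forall z, onbd x0 x1 y0 y1 z -> f z = g z) ->
  rint f x0 x1 y0 y1 = rint g x0 x1 y0 y1.
Proof.
move=> hx hy fg; rewrite /rint; congr (_ - _ + 'i%C * (_ - _));
  apply: eq_cintg => t ht; apply: fg;
  by rewrite /onbd /inrect /= ht ?hx ?hy ?lexx ?eqxx ?orbT.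
Qed.

Lemma rintZ k f (x0 x1 y0 y1 : R) : x0 <= x1 -> y0 <= y1 ->
  bcont f x0 x1 y0 y1 ->
  rint (fun z => k * f z) x0 x1 y0 y1 = k * rint f x0 x1 y0 y1.
Proof.
move=> hx hy cf; rewrite /rint.
rewrite (cintgZ _ (bcont_bot hy cf)) (cintgZ _ (bcont_top hy cf)).
rewrite (cintgZ _ (bcont_left hx cf)) (cintgZ _ (bcont_right hx cf)); ring.
Qed.

Lemma bcontM f g (x0 x1 y0 y1 : R) : bcont f x0 x1 y0 y1 ->
  bcont g x0 x1 y0 y1 -> bcont (fun z => f z * g z) x0 x1 y0 y1.
Proof. by move=> [cf] [cg]; split=> z hz; apply: cvgM; [exact: cf|exact: cg]. Qed.

Lemma bcontV f (x0 x1 y0 y1 : R) : (forall z, onbd x0 x1 y0 y1 z -> f z != 0) ->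
  bcont f x0 x1 y0 y1 -> bcont (fun z => (f z)^-1) x0 x1 y0 y1.
Proof. by move=> f0 [cf]; split=> z hz; apply: cvgV; [exact: f0|exact: cf]. Qed.

Lemma bcontD f g (x0 x1 y0 y1 : R) : bcont f x0 x1 y0 y1 ->
  bcont g x0 x1 y0 y1 -> bcont (fun z => f z + g z) x0 x1 y0 y1.
Proof. by move=> [cf] [cg]; split=> z hz; apply: (@cvgD C C^o); [exact: cf|exact: cg]. Qed.

Lemma bcont_cst (k : C) (x0 x1 y0 y1 : R) : bcont (fun=> k) x0 x1 y0 y1.
Proof. by split=> z hz; exact: (@cvg_cst C^o). Qed.

Lemma bcont_sub a (x0 x1 y0 y1 : R) : bcont (fun z => z - a) x0 x1 y0 y1.
Proof.
by apply/bcontP => z _ e e0; exists e => // w _; rewrite opprB addrA subrK.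
Qed.

Variable h : R.
Hypothesis h0 : 0 < h.
Local Notation bd := (onbd (- h) h (- h) h).
Local Notation bcf f := (bcont f (- h) h (- h) h).

Let hh : - h <= h. Proof. by rewrite ge0_cp // ltW. Qed.

Lemma bd_cabs w : bd w -> h <= cabs w.
Proof.
move=> [_ H]; have e : `|h| = h by rewrite gtr0_norm.
case/or4P: H => /eqP H; rewrite -[leLHS]e -?H ?normrN.
- by rewrite -normrN -H Re_le_cabs.
- exact: Re_le_cabs.
- by rewrite -normrN -H Im_le_cabs.
- exact: Im_le_cabs.
Qed.

Lemma bd_sub w a : bd w -> cabs a < h / 2 -> h / 2 <= cabs (w - a).
Proof.
move=> /bd_cabs hw ha; apply: le_trans (cabs_sub _ _).
by rewrite lerBrDr (le_trans _ hw) // [leRHS]splitr lerD2l ltW.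
Qed.

Lemma bd_neq w a : bd w -> cabs a < h / 2 -> w - a != 0.
Proof.
by move=> hw ha; rewrite -cabs_gt0 (lt_le_trans _ (bd_sub hw ha)) // divr_gt0.
Qed.

Lemma bcont_inv a : cabs a < h / 2 -> bcf (fun w => (w - a)^-1).
Proof.
by move=> ha; apply: bcontV => [z hz|]; [exact: bd_neq|exact: bcont_sub].
Qed.

(** Integrals of Cauchy type over the boundary of the square. *)
Definition Cau phi a := rint (fun w => phi w * (w - a)^-1) (- h) h (- h) h.

Lemma Cau_bound phi M a : bcf phi -> (forall w, bd w -> cabs (phi w) <= M) ->
  cabs a < h / 2 -> cabs (Cau phi a) <= 32 * M.
Proof.
move=> cphi pM ha; have M0 : 0 <= M.
  have hb : bd (h +i* h)%C by rewrite /onbd /inrect /= !lexx eqxx hh orbT.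
  by apply: le_trans (pM _ hb); exact: cabs_ge0.
apply: (le_trans (rint_bound hh hh (M := M * (2 / h)) _ _)).
- exact: (bcontM cphi (bcont_inv ha)).
- move=> w hw; rewrite cabsM ler_pM ?cabs_ge0 ?pM // cabsV.
  rewrite -[2 / h]invrK invf_div lef_pV2 ?posrE ?divr_gt0 ?bd_sub //.
  by rewrite cabs_gt0 bd_neq.
- by rewrite le_eqVlt; apply/orP; left; apply/eqP; field; rewrite gt_eqF.
Qed.

Lemma bd0 : cabs (0 : C) < h / 2.
Proof. by rewrite cabs0 divr_gt0. Qed.

Lemma bcont_div phi : bcf phi -> bcf (fun w => phi w / w).
Proof.
move=> cphi; apply: (bcontM cphi).
have := bcont_inv bd0.
rewrite (_ : (fun w => (w - 0)^-1) = (fun w => w^-1) :> (C -> C)) //.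
by apply/funext => w; rewrite subr0.
Qed.

Lemma bd_neq0 w : bd w -> w != 0.
Proof. by move=> hw; have := bd_neq hw bd0; rewrite subr0. Qed.

(** The expansion of the Cauchy kernel, [1 / (w - a) = 1 / w + a / (w (w -
    a))]; iterating it gives the Taylor expansion at the centre. *)
Lemma Cau_step phi a : bcf phi -> cabs a < h / 2 ->
  Cau phi a = Cau phi 0 + a * Cau (fun w => phi w / w) a.
Proof.
move=> cphi ha; rewrite /Cau -rintZ //; last first.
  exact: (bcontM (bcont_div cphi) (bcont_inv ha)).
rewrite -rintD //.
- apply: eq_rint => // w hw; have w0 := bd_neq0 hw; have wa := bd_neq hw ha.
  by rewrite subr0; field; rewrite w0 wa.
- exact: (bcontM cphi (bcont_inv bd0)).
- exact: (bcontM (bcont_cst _ _ _ _ _) (bcontM (bcont_div cphi) (bcont_inv ha))).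
Qed.

(** The difference quotient of the Cauchy kernel converges uniformly on the
    boundary. *)
Lemma Cau_cdiff phi M a : bcf phi -> (forall w, bd w -> cabs (phi w) <= M) ->
  cabs a < h / 2 -> cdiff (Cau phi) a.
Proof.
move=> cphi pM ha; pose psi w := phi w * (w - a)^-1 * (w - a)^-1.
have cpsi : bcf psi.
  exact: (bcontM (bcontM cphi (bcont_inv ha)) (bcont_inv ha)).
have [D DE] : {D : R | D = h / 2} by exists (h / 2).
have D0 : 0 < D by rewrite DE divr_gt0.
have psiM w : bd w -> cabs (psi w) <= M * D^-1 * D^-1.
  move=> hw; have k : cabs (w - a)^-1 <= D^-1.
    by rewrite cabsV DE lef_pV2 ?posrE ?divr_gt0 ?bd_sub // cabs_gt0 bd_neq.
  rewrite !cabsM ler_pM ?mulr_ge0 ?cabs_ge0 //.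
  by rewrite ler_pM ?cabs_ge0 ?pM.
exists (rint psi (- h) h (- h) h) => e e0.
pose K := 32 * (M * D^-1 * D^-1).
have K0 : 0 < K + 1 + e.
  rewrite ltr_wpDl // addr_ge0 // mulr_ge0 //.
  have hb : bd (h +i* h)%C by rewrite /onbd /inrect /= !lexx eqxx hh orbT.
  by apply: le_trans (psiM _ hb); exact: cabs_ge0.
exists (Num.min (D - cabs a) (e / (K + 1 + e))).
  by rewrite lt_min subr_gt0 DE ha divr_gt0.
move=> b; rewrite lt_min => /andP[b1 b2].
have hb : cabs b < h / 2.
  have -> : b = (b - a) + a by ring.
  by rewrite (le_lt_trans (cabsD _ _)) // -ltrBrDr -DE.
have c1 : bcf (fun w => phi w * (w - a)^-1).
  exact: (bcontM cphi (bcont_inv ha)).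
have c2 : bcf (fun w => psi w * (w - b)^-1).
  exact: (bcontM cpsi (bcont_inv hb)).
have -> : Cau phi b - Cau phi a - rint psi (- h) h (- h) h * (b - a) =
    (b - a) ^+ 2 * Cau psi b.
  have -> : Cau phi b = Cau phi a + (b - a) * rint psi (- h) h (- h) h
      + (b - a) ^+ 2 * Cau psi b.
    rewrite /Cau -!rintZ // -!rintD //.
    apply: eq_rint => // w hw; rewrite /psi.
      have wb := bd_neq hw hb; have wa := bd_neq hw ha.
      by field; rewrite wb wa.
    1-3: by first [exact: (bcontM (bcont_cst _ _ _ _ _) c2)
      |exact: (bcontD c1 (bcontM (bcont_cst _ _ _ _ _) cpsi))
      |exact: (bcontM (bcont_cst _ _ _ _ _) cpsi)].
  ring.
rewrite cabsM cabsX exprS expr1 [e * _]mulrC -mulrA ler_wpM2l ?cabs_ge0 //.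
rewrite (le_trans (ler_wpM2l (cabs_ge0 _) (Cau_bound cpsi psiM hb))) //.
move: b2; rewrite ltr_pdivlMr // => b2; apply: le_trans (ltW b2).
by rewrite ler_wpM2l ?cabs_ge0 // -/K -addrA lerDl addr_ge0 // ltW.
Qed.

Lemma cintg_Im_ge (a b m : R) (F : R -> C) : a <= b -> contseg a b F ->
  (forall x, a <= x <= b -> m <= complex.Im (F x)) ->
  m * (b - a) <= complex.Im (cintg a b F).
Proof.
move=> ab cF mF; rewrite /cintg /= -(fine_mu_itv ab) -Rintegral_cst //.
apply: le_Rintegral => //.
- by apply: continuous_compact_integrable => //; [exact: segment_compact
    |apply: continuous_subspaceT => x; exact: cvg_cst].
- exact: contseg_Im.
Qed.

(** The winding number of the square around its centre: each side contributes
    an imaginary part of at least 1. *)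
Lemma Cau1_neq0 : Cau (fun=> 1) 0 != 0.
Proof.
have cinv : bcf (fun w => 1 * (w - 0)^-1).
  exact: (bcontM (bcont_cst _ _ _ _ _) (bcont_inv bd0)).
have hn : h != 0 by rewrite gt_eqF.
have low (F : R -> C) : contseg (- h) h F -> (forall x, - h <= x <= h ->
    complex.Im (F x) = h / (h ^+ 2 + x ^+ 2)) -> 1 <= complex.Im (cintg (- h) h F).
  move=> cF FE; have := cintg_Im_ge (m := (2 * h)^-1) hh cF.
  have -> : (2 * h)^-1 * (h - - h) = 1 by field.
  apply => x hx; rewrite FE //.
  have x2 : x ^+ 2 <= h ^+ 2.
    by case/andP: hx => hx1 hx2; nra.
  have p0 : 0 < h ^+ 2 + x ^+ 2.
    by rewrite ltr_pwDl ?sqr_ge0 // exprn_gt0.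
  rewrite -div1r ler_pdivrMr ?mulr_gt0 // mulrAC ler_pdivlMr // mul1r.
  by rewrite mulrCA mulr_natl -expr2 mulr2n lerD2l.
have c1 := bcont_bot hh cinv; have c2 := contsegZ (-1) (bcont_top hh cinv).
have c3 := contsegZ 'i%C (bcont_right hh cinv).
have c4 := contsegZ (- 'i%C) (bcont_left hh cinv).
suff : 0 < complex.Im (Cau (fun=> 1) 0).
  by apply: contraTN => /eqP ->; rewrite ltxx.
have p0 x : h ^+ 2 + x ^+ 2 != 0.
  by rewrite gt_eqF // ltr_pwDl ?sqr_ge0 // exprn_gt0.
have inv (u v : R) : (u +i* v)%C^-1 = (u / (u ^+ 2 + v ^+ 2) +i* - (v / (u ^+ 2 + v ^+ 2)))%C :> C.
  by [].
rewrite /Cau /rint.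
have -> : forall A B D E : C, A - B + 'i%C * (D - E) =
  A + (-1) * B + 'i%C * D + (- 'i%C) * E by move=> *; ring.
rewrite -(cintgZ _ (bcont_top hh cinv)) -(cintgZ _ (bcont_right hh cinv)).
rewrite -(cintgZ _ (bcont_left hh cinv)).
have ImD (u v : C) : complex.Im (u + v) = complex.Im u + complex.Im v.
  by case: u; case: v.
rewrite !ImD.
have F1 : 1 <= complex.Im (cintg (- h) h (fun x => 1 * ((x +i* - h)%C - 0)^-1)).
  apply: low c1 _ => x hx; rewrite mul1r subr0 inv /= sqrrN addrC.
  by field; rewrite p0.
have F2 : 1 <= complex.Im (cintg (- h) h (fun x => -1 * (1 * ((x +i* h)%C - 0)^-1))).
  apply: low c2 _ => x hx; rewrite mul1r subr0 inv /= oppr0 mul0r addr0.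
  by rewrite addrC; field; rewrite p0.
have F3 : 1 <= complex.Im (cintg (- h) h (fun x => 'i%C * (1 * ((h +i* x)%C - 0)^-1))).
  apply: low c3 _ => x hx; rewrite mul1r subr0 inv /=.
  by field; rewrite p0.
have F4 : 1 <= complex.Im (cintg (- h) h (fun x => - 'i%C * (1 * ((- h +i* x)%C - 0)^-1))).
  apply: low c4 _ => x hx; rewrite mul1r subr0 inv /= sqrrN.
  by field; rewrite p0.
lra.
Qed.

Lemma rcontS f (x0 x1 y0 y1 x0' x1' y0' y1' : R) :
  x0 <= x0' -> x1' <= x1 -> y0 <= y0' -> y1' <= y1 ->
  rcont f x0 x1 y0 y1 -> rcont f x0' x1' y0' y1'.
Proof.
move=> h1 h2 h3 h4 H z /andP[/andP[z1 z2] /andP[z3 z4]]; apply: H.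
by rewrite /inrect (le_trans h1 z1) (le_trans z2 h2) (le_trans h3 z3) (le_trans z4 h4).
Qed.

(** A point where [f] is merely continuous does not spoil Goursat's lemma: it
    can be enclosed in arbitrarily small squares, and the four rectangles
    around such a square contribute nothing. *)
Lemma goursat_pt f a : `|complex.Re a| < h -> `|complex.Im a| < h ->
  (forall z, inrect (- h) h (- h) h z -> z != a -> cdiff f z) -> ccont f a ->
  rint f (- h) h (- h) h = 0.
Proof.
rewrite !ltr_norml => /andP[x1 x2] /andP[y1 y2] df ca.
set x := complex.Re a in x1 x2; set y := complex.Im a in y1 y2.
have rc : rcont f (- h) h (- h) h.
  by move=> z hz; have [->//|za] := eqVneq z a; apply/cdiff_cont/df.
apply/eqP; rewrite -cabs_eq0; apply/negPn/negP => J0.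
set c := cabs _ in J0; have {J0} c0 : 0 < c by rewrite lt_def J0 cabs_ge0.
have [r r0 Hr] := ca 1 ltr01.
pose M := cabs (f a) + 1; have M0 : 0 < M by rewrite ltr_wpDl ?cabs_ge0.
have [t [t0 tr tM t1 t2] [t3 t4]] : exists2 t : R,
    [/\ 0 < t, 2 * t < r, 16 * M * t < c, - h <= x - t & x + t <= h] &
    - h <= y - t /\ y + t <= h.
  have [u [u0 u1 u2 u3 u4]] : exists u : R, [/\ 0 < u, u <= r / 3,
      u <= c / (17 * M), u <= x + h & u <= h - x].
    exists (Num.min (r / 3) (Num.min (c / (17 * M)) (Num.min (x + h) (h - x)))).
    by rewrite !lt_min !ge_min !divr_gt0 ?mulr_gt0 ?lexx ?orbT //=;
      split=> //; apply/andP; split; lra.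
  have [v [v0 v1 v3 v4]] : exists v : R, [/\ 0 < v, v <= u, v <= y + h & v <= h - y].
    exists (Num.min u (Num.min (y + h) (h - y))).
    by rewrite !lt_min !ge_min !lexx ?orbT u0 //=; split=> //; apply/andP; split; lra.
  exists v; last by split; lra.
  split; [by []|lra| |lra|lra].
  have : v <= c / (17 * M) by lra.
  rewrite ler_pdivlMr ?mulr_gt0 // => hv; apply: lt_le_trans hv.
  by rewrite mulrC ltr_pM2l // ltr_pM2r // ltr_nat.
have e1 : - h <= x - t <= h by apply/andP; split; lra.
have e2 : x - t <= x + t <= h by apply/andP; split; lra.
have e3 : - h <= y - t <= h by apply/andP; split; lra.
have e4 : y - t <= y + t <= h by apply/andP; split; lra.
have l1 : x - t <= x + t by lra.
have l2 : y - t <= y + t by lra.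
have Z x0' x1' y0' y1' : - h <= x0' -> x1' <= h -> - h <= y0' -> y1' <= h ->
    x0' <= x1' -> y0' <= y1' -> ~~ inrect x0' x1' y0' y1' a ->
    rint f x0' x1' y0' y1' = 0.
  move=> h1 h2 h3 h4 h5 h6 na; apply: goursat => // z hz; apply: df.
    case/andP: hz => /andP[z1 z2] /andP[z3 z4].
    by rewrite /inrect (le_trans h1 z1) (le_trans z2 h2) (le_trans h3 z3) (le_trans z4 h4).
  by apply: contraNneq na => <-.
have cc : rcont f (x - t) (x + t) (y - t) (y + t).
  by apply: rcontS rc; lra.
have [[s1 s2] [s3 s4]] : (x - t <= h /\ - h <= x + t) /\ (y - t <= h /\ - h <= y + t).
  by case/andP: e1 => _ ->; case/andP: e3 => _ ->; rewrite !(le_trans _ l1) ?(le_trans _ l2).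
have [u1 u2] : x - t < x /\ x < x + t by rewrite ltrDl gtrBl.
have [u3 u4] : y - t < y /\ y < y + t by rewrite ltrDl gtrBl.
have Z1 : rint f (- h) (x - t) (- h) h = 0.
  apply: Z => //.
  by apply/negP => /andP[/andP[_ +] _]; rewrite -/x leNgt u1.
have Z2 : rint f (x + t) h (- h) h = 0.
  apply: Z => //.
  by apply/negP => /andP[/andP[+ _] _]; rewrite -/x leNgt u2.
have Z3 : rint f (x - t) (x + t) (- h) (y - t) = 0.
  apply: Z => //.
  by apply/negP => /andP[_ /andP[_ +]]; rewrite -/y leNgt u3.
have Z4 : rint f (x - t) (x + t) (y + t) h = 0.
  apply: Z => //.
  by apply/negP => /andP[_ /andP[+ _]]; rewrite -/y leNgt u4.
have rcS u v : - h <= u -> v <= h -> rcont f u v (- h) h.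
  by move=> hu hv; apply: (rcontS _ _ _ _ rc).
have JE : rint f (- h) h (- h) h = rint f (x - t) (x + t) (y - t) (y + t).
  rewrite (rint_splitx e1 hh rc) Z1 add0r (rint_splitx e2 hh); last exact: rcS.
  rewrite Z2 addr0 (rint_splity l1 e3); last exact: rcS.
  rewrite Z3 add0r (rint_splity l1 e4) ?Z4 ?addr0 //.
  by apply: (rcontS _ _ _ _ rc).
have {}JE : c = cabs (rint f (x - t) (x + t) (y - t) (y + t)) by rewrite /c JE.
have : c <= 4 * M * (x + t - (x - t) + (y + t - (y - t))).
  rewrite JE; apply: rint_bound => //; first exact: rcont_bcont.
  move=> z [/andP[zx zy] _]; have za : cabs (z - a) <= t + t.
    rewrite (le_trans (cabs_le_ReIm _)) // !raddfB /=.
    by rewrite lerD // ler_distl.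
  rewrite /M -lerBlDl (le_trans (cabs_sub _ _)) // ltW // Hr //.
  by rewrite (le_lt_trans za) // -mulr2n -[t *+ 2]mulr_natl.
have -> : 4 * M * (x + t - (x - t) + (y + t - (y - t))) = 16 * M * t by ring.
by rewrite leNgt tM.
Qed.

Lemma cdiff_ext f g z (r : R) : 0 < r ->
  (forall w, cabs (w - z) < r -> f w = g w) -> cdiff f z -> cdiff g z.
Proof.
move=> r0 fg [d hd]; exists d => e e0; have [r' r'0 H] := hd e e0.
exists (Num.min r r'); first by rewrite lt_min r0.
move=> w; rewrite lt_min => /andP[w1 w2].
by rewrite -!fg ?H // subrr cabs0.
Qed.

Lemma cdiffP f z : cdiff f z <-> derivable (f : C^o -> C^o) z 1.
Proof. by rewrite derivable_cabs. Qed.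

(** Goursat's lemma for the difference quotient [(f w - f a) / (w - a)],
    continued by the derivative at [a].  The winding number [Cau (fun=> 1) a]
    stands in place of the constant [2 * pi * i]. *)
Lemma cauchy_formula f a : (forall z, inrect (- h) h (- h) h z -> cdiff f z) ->
  cabs a < h / 2 -> f a * Cau (fun=> 1) a = Cau f a.
Proof.
move=> df ha; have hah : cabs a < h.
  by apply: lt_trans ha _; rewrite ltr_pdivrMr // ltr_pMr // (ltr1n _ 2).
have ain : inrect (- h) h (- h) h a.
  by rewrite /inrect -!ler_norml !(le_trans _ (ltW hah)) ?Re_le_cabs ?Im_le_cabs.
have [d hd] := df a ain.
pose F z := if z == a then d else (f z - f a) / (z - a).
have cf : bcf f by apply: rcont_bcont => z hz; exact/cdiff_cont/df.
have : rint F (- h) h (- h) h = 0.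
  apply: (@goursat_pt F a).
  - exact: le_lt_trans (Re_le_cabs _) hah.
  - exact: le_lt_trans (Im_le_cabs _) hah.
  - move=> z hz za; apply: (@cdiff_ext (fun z => (f z - f a) / (z - a)) _ _ (cabs (z - a))).
      by rewrite cabs_gt0 subr_eq0.
      move=> w wz; rewrite /F; case: eqVneq => // wa.
      by move: wz; rewrite wa cabsB ltxx.
    apply/cdiffP; apply: derivableM.
      by apply: derivableB => //; apply/cdiffP; exact: df.
    by apply: derivableV; [rewrite subr_eq0|apply: derivableB].
  - move=> e e0; have e20 : 0 < e / 2 by rewrite divr_gt0.
    have [r r0 Hr] := hd _ e20; exists r => // w wa; rewrite /F eqxx.
    case: eqVneq => [_|wna]; first by rewrite subrr cabs0.
    have w0 : w - a != 0 by rewrite subr_eq0.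
    have -> : (f w - f a) / (w - a) - d = (f w - f a - d * (w - a)) / (w - a).
      by field.
    rewrite cabsM cabsV ltr_pdivrMr ?cabs_gt0 // (le_lt_trans (Hr w wa)) //.
    rewrite ltr_pM2r ?cabs_gt0 // ltr_pdivrMr // ltr_pMr // (ltr1n _ 2) //.
have -> : rint F (- h) h (- h) h = Cau f a + (- f a) * Cau (fun=> 1) a.
  have i1 := bcont_inv ha; have i2 := bcontM (bcont_cst 1 _ _ _ _) i1.
  rewrite /Cau -rintZ // -rintD //.
  - apply: eq_rint => // w hw; have := bd_neq hw ha; rewrite /F subr_eq0.
    by case: eqVneq => // wa _; ring.
  - exact: (bcontM cf i1).
  - exact: (bcontM (bcont_cst _ _ _ _ _) i2).
by rewrite mulNr => /subr0_eq.
Qed.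

End Cauchy.

(** * Zeros of holomorphic functions *)

Section ZeroOrder.
Variable R : realType.
Local Notation C := R[i].
Implicit Types (f g u : C -> C) (z w a : C).

Lemma holomorphic_atP f z0 : holomorphic_at f z0 <->
  exists2 r : R, 0 < r & forall z, cabs (z - z0) < r -> cdiff f z.
Proof.
rewrite /holomorphic_at; split=> [/nbhs_cabs[r r0 H]|[r r0 H]].
  by exists r => // z /H /cdiffP.
by apply/nbhs_cabs; exists r => // z /H /cdiffP.
Qed.

Lemma cdiff_shift f z0 z : cdiff f (z0 + z) -> cdiff (fun w => f (z0 + w)) z.
Proof.
move=> [d hd]; exists d => e e0; have [r r0 H] := hd e e0.
exists r => // w wz; have E : z0 + w - (z0 + z) = w - z by ring.
by rewrite -E; apply: H; rewrite E.
Qed.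

Lemma scale_pow (x m y : R) n :
  x ^+ n * (32 * (m / y ^+ n)) = 32 * m * (x / y) ^+ n.
Proof. by rewrite expr_div_n mulrC -!mulrA [_^-1 * _]mulrC. Qed.

(** By Cauchy's formula [f] is the quotient of two integrals of Cauchy type,
    [Cau g] by the nonvanishing [Cau 1].  Dividing the density [g] by [w]
    repeatedly splits off factors [z - z0], until an integral is nonzero at
    the centre; if none is, [f] is bounded by a
    constant times every power of 1/2. *)
Lemma holomorphic_at_factor f z0 : holomorphic_at f z0 ->
  (\forall z \near (z0 : C^o), f z = 0) \/
  exists (p : nat) (u : C -> C), [/\ holomorphic_at u z0, u z0 != 0 &
    \forall z \near (z0 : C^o), f z = (z - z0) ^+ p * u z].
Proof.
move=> /holomorphic_atP[r1 r10 df].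
have z0d : cabs (z0 - z0) < r1 by rewrite subrr cabs0.
have [r2 r20 bf] := cdiff_cont (df _ z0d) ltr01.
pose h := Num.min r1 r2 / 3.
have m0 : 0 < Num.min r1 r2 by rewrite lt_min r10.
have h0 : 0 < h by rewrite divr_gt0.
have h3 : h + h < Num.min r1 r2.
  have -> : Num.min r1 r2 = h + h + h by rewrite /h; field.
  by rewrite ltrDl.
have hmin z : inrect (- h) h (- h) h z -> cabs z < Num.min r1 r2.
  move=> /andP[z1 z2]; apply: le_lt_trans h3.
  by rewrite (le_trans (cabs_le_ReIm _)) // lerD // ler_norml.
pose g z := f (z0 + z).
have E z : z0 + z - z0 = z by ring.
have dg z : inrect (- h) h (- h) h z -> cdiff g z.
  move=> /hmin; rewrite lt_min => /andP[z1 _].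
  by apply: cdiff_shift; apply: df; rewrite E.
pose M := cabs (f z0) + 1.
(* the density [g w / w ^ k]: its Cauchy integral, times [a ^ k], is the
   remainder of order [k] of the Taylor expansion *)
pose phi := fix phi (k : nat) : C -> C :=
  if k is k'.+1 then (fun w => phi k' w / w) else g.
have cphi k : bcont (phi k) (- h) h (- h) h.
  elim: k => [|k IH]; last exact: bcont_div.
  by apply: rcont_bcont => z hz; exact/cdiff_cont/dg.
have phiM k w : onbd (- h) h (- h) h w -> cabs (phi k w) <= M / h ^+ k.
  move=> hw; elim: k => [|k IH].
    rewrite expr0 divr1 /= /g /M -lerBlDl (le_trans (cabs_sub _ _)) // ltW // bf //.
    by rewrite E; case: hw => /hmin; rewrite lt_min => /andP[].
  rewrite /= cabsM cabsV exprS invfM [h^-1 * _]mulrC mulrA.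
  rewrite ler_pM ?invr_ge0 ?cabs_ge0 // lef_pV2 ?posrE ?(bd_cabs h0 hw) //.
  by rewrite (lt_le_trans h0) // (bd_cabs h0 hw).
pose c := Cau h (fun=> 1).
have c0 : c 0 != 0 by exact: Cau1_neq0.
have cfor a : cabs a < h / 2 -> g a * c a = Cau h g a by exact: cauchy_formula.
have h20 : 0 < h / 2 by rewrite divr_gt0.
have dCau k a : cabs a < h / 2 -> cdiff (Cau h (phi k)) a.
  by move=> ha; apply: (Cau_cdiff h0 (cphi k) (phiM k)).
have dc a : cabs a < h / 2 -> cdiff c a.
  move=> ha; apply: (Cau_cdiff h0 (bcont_cst _ _ _ _ _) (M := 1)) => //.
  by move=> w _; rewrite cabs1.
have [r3 r30 cc] : exists2 r3 : R, 0 < r3 & forall a, cabs a < r3 -> c a != 0.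
  have c1 : 0 < cabs (c 0) by rewrite cabs_gt0.
  have d0 : cabs (0 : C) < h / 2 by rewrite cabs0.
  have [r3 r30 H] := cdiff_cont (dc 0 d0) c1; exists r3 => // a ha.
  have := H a; rewrite subr0 => /(_ ha); apply: contraTneq => ->.
  by rewrite sub0r cabsN ltxx.
pose r := Num.min (h / 2) r3; have r0 : 0 < r by rewrite lt_min h20.
have fE z : cabs (z - z0) < r -> f z = Cau h g (z - z0) / c (z - z0).
  rewrite lt_min => /andP[z1 z2]; rewrite -cfor // mulfK ?cc //.
  by rewrite /g addrC subrK.
have iter k a : cabs a < h / 2 -> (forall j, (j < k)%N -> Cau h (phi j) 0 = 0) ->
    Cau h g a = a ^+ k * Cau h (phi k) a.
  move=> ha; elim: k => [|k IH] H; first by rewrite expr0 mul1r.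
  rewrite IH; last by move=> j jk; apply: H; rewrite ltnS ltnW.
  by rewrite (Cau_step h0 (cphi k) ha) H // add0r exprSr mulrA.
have [[k hk]|nk] := pselect (exists k, Cau h (phi k) 0 != 0); last first.
  left; apply/nbhs_cabs; exists r => // z hz; rewrite fE //.
  suff -> : Cau h g (z - z0) = 0 by rewrite mul0r.
  move: hz; set a := z - z0; rewrite lt_min => /andP[ha _].
  have al k : Cau h (phi k) 0 = 0.
    by apply/eqP/negPn/negP => hk; apply: nk; exists k.
  apply/eqP; rewrite -cabs_eq0; apply/negPn/negP => H.
  have Hp : 0 < cabs (Cau h g a) by rewrite lt_def H cabs_ge0.
  have [n] := small_halves (32 * M) Hp; apply/negP; rewrite -leNgt.
  rewrite (iter n a ha) // cabsM cabsX.
  have B := Cau_bound h0 (cphi n) (phiM n) ha.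
  apply: le_trans (ler_wpM2l (exprn_ge0 _ (cabs_ge0 _)) B) _.
  have M0 : 0 <= M by rewrite addr_ge0 ?cabs_ge0.
  have -> : cabs a ^+ n * (32 * (M / h ^+ n)) = 32 * M * (cabs a / h) ^+ n.
    exact: scale_pow.
  rewrite ler_wpM2l ?mulr_ge0 // -exprVn lerXn2r ?nnegrE ?divr_ge0 ?cabs_ge0 ?ltW //.
  by rewrite ltr_pdivrMr // mulrC.
have kex : exists k, Cau h (phi k) 0 != 0 by exists k.
have [p hp pmin] := ex_minnP kex.
right; exists p, (fun z => Cau h (phi p) (z - z0) / c (z - z0)); split.
- apply/holomorphic_atP; exists r => // z; rewrite lt_min => /andP[z1 z2].
  have sh g' : cdiff g' (z - z0) -> cdiff (fun w => g' (w - z0)) z.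
    move=> dg'; have := @cdiff_shift g' (- z0) z.
    rewrite addrC => /(_ dg'); apply: (@cdiff_ext _ _ _ _ 1) => // w _.
    by rewrite addrC.
  apply/cdiffP; apply: derivableM; first by apply/cdiffP/sh/dCau.
  apply: derivableV; first exact: cc.
  by apply/cdiffP/sh/dc.
- by rewrite subrr mulf_neq0 // invr_eq0.
- apply/nbhs_cabs; exists r => // z hz; rewrite fE // (iter p) ?mulrA //.
    by move: hz; rewrite lt_min => /andP[].
  move=> j jp; apply/eqP/negPn/negP => hj.
  by have := pmin j hj; rewrite leqNgt jp.
Qed.

End ZeroOrder.

(** * Meromorphic functions up to discrete sets *)

Section QuasiMeromorphic.
Variable R : realType.
Local Notation C := R[i].
Implicit Types (f g u F G : C -> C) (z w a : C) (E : set C).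

Lemma hol_cst (k : C) z : holomorphic_at (fun=> k) z.
Proof. by apply/holomorphic_atP; exists 1 => // w _; apply/cdiffP. Qed.

Lemma hol_id z : holomorphic_at (fun z => z) z.
Proof. by apply/holomorphic_atP; exists 1 => // w _; apply/cdiffP. Qed.

Lemma holD f g z : holomorphic_at f z -> holomorphic_at g z ->
  holomorphic_at (fun w => f w + g w) z.
Proof. by apply: filterS2 => w; exact: derivableD. Qed.

Lemma holM f g z : holomorphic_at f z -> holomorphic_at g z ->
  holomorphic_at (fun w => f w * g w) z.
Proof. by apply: filterS2 => w; exact: derivableM. Qed.

Lemma holN f z : holomorphic_at f z -> holomorphic_at (fun w => - f w) z.
Proof. by apply: filterS => w; exact: derivableN. Qed.

Lemma hol_pow f n z : holomorphic_at f z -> holomorphic_at (fun w => f w ^+ n) z.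
Proof.
move=> hf; elim: n => [|n IH].
  by under eq_fun do rewrite expr0; exact: hol_cst.
by under eq_fun do rewrite exprS; exact: holM.
Qed.

Lemma hol_sub a z : holomorphic_at (fun w => w - a) z.
Proof. by apply: holD; [exact: hol_id|exact: hol_cst]. Qed.

Lemma hol_cvg f z : holomorphic_at f z -> f w @[w --> (z : C^o)] --> (f z : C^o).
Proof.
move=> /nbhs_singleton /cdiffP /cdiff_cont cf; apply/(@cvgC _ _ (nbhs (z : C^o))) => e e0.
by apply/nbhs_cabs; exact: cf.
Qed.

Lemma hol_neq0 f z : holomorphic_at f z -> f z != 0 ->
  \forall w \near (z : C^o), f w != 0.
Proof.
move=> hf f0; have c0 : 0 < cabs (f z) by rewrite cabs_gt0.
have /cvgC/(_ _ c0) := hol_cvg hf; apply: filterS => w.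
by apply: contraTneq => ->; rewrite sub0r cabsN ltxx.
Qed.

Lemma holV f z : holomorphic_at f z -> f z != 0 ->
  holomorphic_at (fun w => (f w)^-1) z.
Proof.
by move=> hf f0; apply: filterS2 hf (hol_neq0 hf f0) => w df fw; exact: derivableV.
Qed.

Lemma hol_near f z : holomorphic_at f z ->
  \forall w \near (z : C^o), holomorphic_at f w.
Proof. by move=> /near_join. Qed.

Lemma hol_ext f g z : holomorphic_at f z ->
  (\forall w \near (z : C^o), f w = g w) -> holomorphic_at g z.
Proof.
move=> hf /near_join fg; apply: filterS2 hf fg => w.
move=> /cdiffP df /nbhs_cabs[r r0 H]; apply/cdiffP.
exact: (cdiff_ext r0 H).
Qed.

Lemma hol_poly (p : {poly C}) z : holomorphic_at (fun w => p.[w]) z.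
Proof.
elim/poly_ind: p => [|p c IH].
  by under eq_fun do rewrite horner0; exact: hol_cst.
under eq_fun do rewrite hornerMXaddC.
exact: (holD (holM IH (hol_id z)) (hol_cst c z)).
Qed.

Lemma hol_cpoly (p : {poly R}) z : holomorphic_at (cpoly p) z.
Proof. exact: hol_poly. Qed.

Lemma dnbhs_neq z : \forall w \near (z : C^o)^', w != z.
Proof. by apply/dnbhs_cabs; exists 1. Qed.

Lemma dnbhs_ex z (A : set C) (r : R) : (\forall w \near (z : C^o)^', A w) ->
  0 < r -> exists w, [/\ A w, w != z & cabs (w - z) < r].
Proof.
move=> /dnbhs_cabs[r' r'0 H] r0; pose s := Num.min r r' / 2.
have m0 : 0 < Num.min r r' by rewrite lt_min r0.
have s0 : 0 < s by rewrite divr_gt0.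
have E : cabs (z + s%:C%C - z) = s by rewrite addrC addKr cabs_real gtr0_norm.
have sm : s < Num.min r r' by rewrite ltr_pdivrMr // ltr_pMr // (ltr1n _ 2).
have zz : z + s%:C%C != z.
  by rewrite -subr_eq0 -cabs_eq0 E gt_eqF.
move: sm; rewrite lt_min => /andP[sr sr'].
by exists (z + s%:C%C); split=> //; [apply: H; rewrite ?E|rewrite E].
Qed.

Lemma near_dnbhs z (A : set C) : (\forall w \near (z : C^o), A w) ->
  \forall w \near (z : C^o)^', A w.
Proof. by move=> /nbhs_cabs[r r0 H]; apply/dnbhs_cabs; exists r => // w _; exact: H. Qed.

Lemma dnbhs_near_dnbhs z (A : set C) : (\forall w \near (z : C^o)^', A w) ->
  \forall w \near (z : C^o)^', \forall v \near (w : C^o), A v.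
Proof.
move=> /dnbhs_cabs[r r0 H]; apply/dnbhs_cabs; exists r => // w wz wr.
have w0 : 0 < cabs (w - z) by rewrite cabs_gt0 subr_eq0.
apply/nbhs_cabs; exists (Num.min (cabs (w - z)) (r - cabs (w - z))).
  by rewrite lt_min w0 subr_gt0.
move=> v; rewrite lt_min => /andP[v1 v2]; apply: H.
  by apply: contraTneq v1 => ->; rewrite cabsB ltxx.
have -> : v - z = (v - w) + (w - z) by ring.
by rewrite (le_lt_trans (cabsD _ _)) // -ltrBrDr.
Qed.

Lemma near_dnbhs_join z (A : set C) : (\forall w \near (z : C^o)^', A w) ->
  \forall w \near (z : C^o), \forall v \near (w : C^o)^', A v.
Proof.
move=> H; have := dnbhs_near_dnbhs H => /dnbhs_cabs[r r0 K].
apply/nbhs_cabs; exists r => [//|w wr]; have [wz|wz] := eqVneq w z.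
  by rewrite wz.
exact: near_dnbhs (K w wz wr).
Qed.

(** Identities between meromorphic functions hold outside a closed discrete
    subset of the nonreal numbers; this is the corresponding notion of a large
    set. *)
Definition generic E := forall z0, complex.Im z0 != 0 ->
  \forall z \near (z0 : C^o)^', E z.

Lemma generic_and E E' : generic E -> generic E' -> generic (E `&` E').
Proof. by move=> h h' z hz; exact: filterI (h z hz) (h' z hz). Qed.

Lemma genericS E E' : E `<=` E' -> generic E -> generic E'.
Proof. by move=> EE' h z hz; exact: filterS EE' (h z hz). Qed.

Lemma genericT E : (forall z, E z) -> generic E.
Proof. by move=> h z _; exact: filterE. Qed.

(** Unlike meromorphy, quasi-meromorphy ignores the values that a function
    takes on a discrete set, so that it passes to sums, products, inverses. *)
Definition quasi_at F z0 := exists (p : nat) (g : C -> C),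
  holomorphic_at g z0 /\
  \forall z \near (z0 : C^o)^', F z = g z / (z - z0) ^+ p.

Definition quasi F := forall z0, complex.Im z0 != 0 -> quasi_at F z0.

Lemma quasi_ext F G : generic [set z | F z = G z] -> quasi F -> quasi G.
Proof.
move=> FG qF z hz; have [p [g [hg H]]] := qF z hz; exists p, g; split=> //.
by apply: filterS2 H (FG z hz) => w /= -> <-.
Qed.

Lemma quasi_hol F : (forall z, complex.Im z != 0 -> holomorphic_at F z) -> quasi F.
Proof.
move=> hF z hz; exists 0%N, F; split; first exact: hF.
by apply: nearW => w; rewrite expr0 divr1.
Qed.

Lemma meromorphic_quasi f : meromorphic f -> quasi f.
Proof.
move=> mf z hz; have [hf|[g [p [p0 hg g0 H]]]] := mf z hz; last by exists p, g.
by exists 0%N, f; split=> //; apply: nearW => w; rewrite expr0 divr1.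
Qed.

Lemma quasiD F G : quasi F -> quasi G -> quasi (fun z => F z + G z).
Proof.
move=> qF qG z hz; have [p [f [hf Hf]]] := qF z hz; have [q [g [hg Hg]]] := qG z hz.
exists (p + q)%N, (fun w => f w * (w - z) ^+ q + g w * (w - z) ^+ p); split.
  exact: (holD (holM hf (hol_pow q (hol_sub z z))) (holM hg (hol_pow p (hol_sub z z)))).
near=> w; have wz : w - z != 0.
  by rewrite subr_eq0; near: w; exact: dnbhs_neq.
have -> : F w = f w / (w - z) ^+ p by near: w.
have -> : G w = g w / (w - z) ^+ q by near: w.
by rewrite exprD; field; rewrite !expf_neq0.
Unshelve. all: end_near. Qed.

Lemma quasiM F G : quasi F -> quasi G -> quasi (fun z => F z * G z).
Proof.
move=> qF qG z hz; have [p [f [hf Hf]]] := qF z hz; have [q [g [hg Hg]]] := qG z hz.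
exists (p + q)%N, (fun w => f w * g w); split; first exact: holM.
near=> w; have wz : w - z != 0.
  by rewrite subr_eq0; near: w; exact: dnbhs_neq.
have -> : F w = f w / (w - z) ^+ p by near: w.
have -> : G w = g w / (w - z) ^+ q by near: w.
by rewrite exprD; field; rewrite !expf_neq0.
Unshelve. all: end_near. Qed.

Lemma quasi_cpoly (p : {poly R}) : quasi (cpoly p).
Proof. by apply: quasi_hol => z _; exact: hol_cpoly. Qed.

Lemma quasi_cst (k : C) : quasi (fun=> k).
Proof. by apply: quasi_hol => z _; exact: hol_cst. Qed.

Lemma quasi_id : quasi (fun z => z).
Proof. by apply: quasi_hol => z _; exact: hol_id. Qed.

Lemma quasiN F : quasi F -> quasi (fun z => - F z).
Proof.
move=> /(quasiM (quasi_cst (-1))); apply: quasi_ext; apply: genericT => z.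
by rewrite /= mulN1r.
Qed.

Lemma quasi_atP F z0 : quasi_at F z0 ->
  (\forall z \near (z0 : C^o)^', F z = 0) \/
  exists (u : C -> C) (p q : nat), [/\ holomorphic_at u z0, u z0 != 0 &
   \forall z \near (z0 : C^o)^', F z = u z * (z - z0) ^+ p / (z - z0) ^+ q].
Proof.
move=> [q [g [hg H]]]; have [g0|[p [u [hu u0 ug]]]] := holomorphic_at_factor hg.
  by left; apply: filterS2 H (near_dnbhs g0) => z -> ->; rewrite mul0r.
right; exists u, p, q; split=> //; apply: filterS2 H (near_dnbhs ug) => z -> ->.
by rewrite [u z * _]mulrC.
Qed.

(** Zeros of meromorphic functions are isolated. *)
Lemma quasi_at_dichotomy F z0 : quasi_at F z0 ->
  (\forall z \near (z0 : C^o)^', F z = 0) \/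
  (\forall z \near (z0 : C^o)^', F z != 0).
Proof.
move=> /quasi_atP[|[u [p [q [hu u0 H]]]]]; [by left|right].
near=> z; have zz : z - z0 != 0.
  by rewrite subr_eq0; near: z; exact: dnbhs_neq.
have -> : F z = u z * (z - z0) ^+ p / (z - z0) ^+ q by near: z.
rewrite !mulf_neq0 ?invr_eq0 ?expf_neq0 //.
by near: z; apply: near_dnbhs; exact: hol_neq0.
Unshelve. all: end_near. Qed.

Lemma quasiV F : quasi F -> quasi (fun z => (F z)^-1).
Proof.
move=> qF z0 hz; have [F0|[u [p [q [hu u0 H]]]]] := quasi_atP (qF z0 hz).
  exists 0%N, (fun=> 0); split; first exact: hol_cst.
  by apply: filterS F0 => z ->; rewrite invr0 mul0r.
exists p, (fun z => (u z)^-1 * (z - z0) ^+ q); split.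
  exact: (holM (holV hu u0) (hol_pow q (hol_sub z0 z0))).
by apply: filterS H => z ->; rewrite !invfM invrK mulrAC.
Qed.

Lemma near_Im_sub z0 : complex.Im z0 != 0 -> \forall w \near (z0 : C^o),
  `|complex.Im (w - z0)| < `|complex.Im z0|.
Proof.
move=> hz; have i0 : 0 < `|complex.Im z0| by rewrite normr_gt0.
apply/nbhs_cabs; exists `|complex.Im z0| => // w hw.
exact: le_lt_trans (Im_le_cabs _) hw.
Qed.

Lemma near_Im_neq0 z0 : complex.Im z0 != 0 ->
  \forall w \near (z0 : C^o), complex.Im w != 0.
Proof.
move=> /near_Im_sub; apply: filterS => w; rewrite raddfB /=.
by apply: contraTneq => ->; rewrite sub0r normrN ltxx.
Qed.

Lemma near_Im_gt0 z0 : 0 < complex.Im z0 ->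
  \forall w \near (z0 : C^o), 0 < complex.Im w.
Proof.
move=> hz; apply: filterS (near_Im_sub (lt0r_neq0 hz)) => w.
by rewrite raddfB /= [ltRHS]gtr0_norm // ltr_norml ltrBrDr addNr => /andP[].
Qed.

Lemma quasi_hol_dom F : quasi F -> generic (hol_dom F).
Proof.
move=> qF z0 hz; have [p [g [hg H]]] := qF z0 hz.
near=> z; split.
  by near: z; apply: near_dnbhs; exact: near_Im_neq0.
have zz : z - z0 != 0.
  by rewrite subr_eq0; near: z; exact: dnbhs_neq.
apply: (@hol_ext (fun w => g w / (w - z0) ^+ p)).
  apply: holM; first by near: z; apply: near_dnbhs; exact: hol_near.
  by apply: holV; [apply: hol_pow; exact: hol_sub|rewrite expf_neq0].
near: z; apply: filterS (dnbhs_near_dnbhs H) => z; apply: filterS => w /=; exact: esym.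
Unshelve. all: end_near. Qed.

Lemma zero_set_open F : open [set z : C^o | \forall w \near (z : C^o)^', F w = 0].
Proof. by rewrite openE => z; exact: near_dnbhs_join. Qed.

Lemma nonzero_set_open F : open [set z : C^o | \forall w \near (z : C^o)^', F w != 0].
Proof. by rewrite openE => z; exact: near_dnbhs_join. Qed.

(** The identity theorem: along a segment of the upper half-plane, the points
    near which [F] vanishes form a relatively open and closed set. *)
Lemma quasi_identity F z0 z1 : quasi F -> 0 < complex.Im z0 ->
  0 < complex.Im z1 -> (\forall w \near (z0 : C^o)^', F w = 0) ->
  \forall w \near (z1 : C^o)^', F w = 0.
Proof.
move=> qF h0 h1 F0.
pose gam (t : R^o) : C^o := z0 + t%:C%C * (z1 - z0).
have cgam : continuous gam.
  move=> t; apply/cvgC => e e0.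
  have k0 : 0 < cabs (z1 - z0) + 1 by rewrite ltr_wpDl ?cabs_ge0.
  apply/nbhs_ballP; exists (e / (cabs (z1 - z0) + 1)); first by rewrite /= divr_gt0.
  move=> s; rewrite /ball /= => ts; rewrite /gam opprD addrACA subrr add0r -mulrBl.
  rewrite cabsM -rmorphB /= cabs_real distrC.
  move: ts; rewrite ltr_pdivlMr // => ts; apply: le_lt_trans ts.
  by rewrite ler_wpM2l // lerDl.
have Imgam t : 0 <= t <= 1 -> complex.Im (gam t) != 0.
  move=> /andP[t0 t1]; rewrite gt_eqF // /gam raddfD /=.
  have -> : complex.Im (t%:C%C * (z1 - z0)) = t * (complex.Im z1 - complex.Im z0).
    by case: (z1) (z0) => a b [c d] /=; rewrite mul0r addr0.
  have -> : complex.Im z0 + t * (complex.Im z1 - complex.Im z0) =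
     (1 - t) * complex.Im z0 + t * complex.Im z1 by ring.
  have [->|tn] := eqVneq t 0; first by rewrite subr0 mul1r mul0r addr0.
  have tp : 0 < t by rewrite lt_def tn.
  by rewrite ltr_wpDl ?mulr_gt0 // mulr_ge0 ?subr_ge0 // ltW.
pose Z : set R := `[0, 1] `&` [set t | \forall w \near (gam t : C^o)^', F w = 0].
have in01 (t : R) : `[0, 1]%classic t = (0 <= t <= 1) :> Prop by rewrite /= in_itv.
have ZE : Z = `[0, 1]%classic.
  apply: (@segment_connected R 0 1).
  - exists 0; split; first by rewrite in01 lexx ler01.
    by rewrite /= /gam mul0r addr0.
  - exists (gam @^-1` [set z : C^o | \forall w \near (z : C^o)^', F w = 0]) => //.
    by apply: open_comp; [move=> t _; exact: cgam|exact: zero_set_open].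
  - exists (~` (gam @^-1` [set z : C^o | \forall w \near (z : C^o)^', F w != 0])).
      apply: open_closedC; apply: open_comp; [move=> t _; exact: cgam|].
      exact: nonzero_set_open.
    apply/seteqP; split=> t [t01 H]; (split; [exact: t01|]).
      move=> /= H'; have [w [[h2 h3] _ _]] := dnbhs_ex (filterI H H') ltr01.
      by move: h3; rewrite h2 eqxx.
    rewrite in01 in t01.
    by have [h|h] := quasi_at_dichotomy (qF _ (Imgam t t01)); [exact: h|case: (H h)].
have : Z 1 by rewrite ZE in01 ler01 lexx.
by case=> _ /=; rewrite /gam mul1r addrC subrK.
Qed.

Lemma near_conj z0 (A : set C) : (\forall z \near (Num.conj z0 : C^o)^', A z) ->
  \forall z \near (z0 : C^o)^', A (Num.conj z).
Proof.
move=> /dnbhs_cabs[r r0 H]; apply/dnbhs_cabs; exists r => // z zz hz.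
apply: H; first by rewrite (inj_eq (can_inj conjCK)).
by rewrite -rmorphB /= cabs_conj.
Qed.

(** Symmetry with respect to the real axis, discrete sets excepted. *)
Definition gsym F := generic [set z | F (Num.conj z) = Num.conj (F z)].

(** One half-plane is covered by the identity theorem, the other one by
    symmetry. *)
Lemma quasi_generic_neq0 F z1 : quasi F -> gsym F -> 0 < complex.Im z1 ->
  ~ (\forall w \near (z1 : C^o)^', F w = 0) -> generic [set z | F z != 0].
Proof.
move=> qF sF h1 F1.
have up z : 0 < complex.Im z -> \forall w \near (z : C^o)^', F w != 0.
  move=> hz; have [|F0|//] := quasi_at_dichotomy (qF z _).
    by rewrite gt_eqF.
  by case: F1; exact: quasi_identity F0.
move=> z hz; have [zp|zn] := ltP 0 (complex.Im z); first exact: up.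
have zc : 0 < complex.Im (Num.conj z).
  by rewrite Im_conj oppr_gt0 lt_def eq_sym hz zn.
apply: filterS2 (near_conj (up _ zc)) (sF z hz) => w /= + E.
by rewrite E conjC_eq0.
Qed.

(** Values at single points are repaired by passing to the limit. *)
Definition reg F z0 : C := lim ((F : C -> C^o) @ (z0 : C^o)^').

Lemma reg_hol F g z0 : holomorphic_at g z0 ->
  (\forall w \near (z0 : C^o)^', F w = g w) -> reg F z0 = g z0.
Proof.
move=> hg Fg; rewrite /reg; apply: (@cvg_lim C^o); first exact: norm_hausdorff.
have /cvgC H := hol_cvg hg; apply/cvgC => e e0.
by apply: filterS2 Fg (near_dnbhs (H e e0)) => w ->.
Qed.

Lemma reg_generic F : quasi F -> generic [set z | reg F z = F z].
Proof.
move=> qF z hz; apply: filterS (quasi_hol_dom qF hz) => w [_ hw].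
by apply: reg_hol hw _; exact: filterE.
Qed.

Lemma reg_near_hol F g z0 : holomorphic_at g z0 ->
  (\forall w \near (z0 : C^o)^', F w = g w) -> holomorphic_at (reg F) z0.
Proof.
move=> hg Fg; apply: (hol_ext hg).
apply: filterS2 (hol_near hg) (near_dnbhs_join Fg) => w hw Fw.
by rewrite (reg_hol hw Fw).
Qed.

Lemma reg_meromorphic F : quasi F -> meromorphic (reg F).
Proof.
move=> qF z0 hz; have [F0|[u [p [q [hu u0 H]]]]] := quasi_atP (qF z0 hz).
  by left; exact: (reg_near_hol (hol_cst 0 z0) F0).
have [qp|pq] := leqP q p.
  left; apply: (reg_near_hol (holM hu (hol_pow (p - q) (hol_sub z0 z0)))).
  apply: filterS2 H (dnbhs_neq z0) => w -> wz.
  rewrite -{1}(subnK qp) exprD mulrA mulfK // expf_neq0 // subr_eq0 //.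
right; exists u, (q - p)%N; split=> //; first by rewrite subn_gt0.
apply: filterS2 (reg_generic qF hz) (filterI H (dnbhs_neq z0)) => w /= -> [-> wz].
have wz0 : w - z0 != 0 by rewrite subr_eq0.
by rewrite -{1}(subnK (ltnW pq)) exprD; field; rewrite !expf_neq0.
Qed.

Lemma pole_large f z0 (M : R) : pole_at f z0 ->
  \forall z \near (z0 : C^o)^', M < cabs (f z).
Proof.
move=> [g [p [p0 hg g0 H]]].
pose m := cabs (g z0) / 2; have m0 : 0 < m by rewrite divr_gt0 ?cabs_gt0.
pose K := `|M| + 1; have K0 : 0 < K by rewrite ltr_wpDl.
have /cvgC/(_ _ m0) Hg := hol_cvg hg.
have Hr : \forall z \near (z0 : C^o)^', cabs (z - z0) < Num.min 1 (m / K).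
  apply/dnbhs_cabs; exists (Num.min 1 (m / K)) => //.
  by rewrite lt_min ltr01 divr_gt0.
apply: filterS2 H (filterI (filterI (near_dnbhs Hg) Hr) (dnbhs_neq z0)).
move=> z -> [[h1]]; rewrite lt_min => /andP[h2 h3] zz.
have zz0 : 0 < cabs (z - z0) by rewrite cabs_gt0 subr_eq0.
have hm : m < cabs (g z).
  have -> : m = cabs (g z0) - m by rewrite /m; field.
  rewrite ltrBlDr -ltrBlDl (le_lt_trans _ h1) // cabsB; exact: cabs_sub.
have MK : M < K by rewrite (le_lt_trans (ler_norm M)) // ltrDl.
apply: (lt_trans MK); rewrite cabsM cabsV cabsX ltr_pdivlMr ?exprn_gt0 //.
apply: le_lt_trans hm; move: h3; rewrite ltr_pdivlMr // mulrC => /ltW h3.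
apply: le_trans h3; rewrite ler_wpM2l ?(ltW K0) // -(prednK p0) exprS.
by rewrite ler_piMr ?cabs_ge0 // exprn_ile1 ?cabs_ge0 // ltW.
Qed.

Lemma meromorphic_bounded f z0 (M : R) : meromorphic f -> complex.Im z0 != 0 ->
  (\forall z \near (z0 : C^o)^', cabs (f z) <= M) -> holomorphic_at f z0.
Proof.
move=> mf hz fM; have [//|/pole_large-/(_ M) Mf] := mf z0 hz; exfalso.
have [z [[/= h1 h2] _ _]] := dnbhs_ex (filterI fM Mf) ltr01.
by move: h2; rewrite ltNge h1.
Qed.

Lemma hol_eq_at f g z0 : holomorphic_at f z0 -> holomorphic_at g z0 ->
  (\forall z \near (z0 : C^o)^', f z = g z) -> f z0 = g z0.
Proof.
move=> hf hg fg.
by rewrite -(reg_hol hf (filterE _ (fun=> erefl))) (reg_hol hg fg).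
Qed.

Lemma hol_conj f z0 : holomorphic_at f (Num.conj z0) ->
  holomorphic_at (fun z => Num.conj (f (Num.conj z))) z0.
Proof.
move=> /holomorphic_atP[r r0 H]; apply/holomorphic_atP; exists r => // z hz.
have [|d hd] := H (Num.conj z); first by rewrite -rmorphB /= cabs_conj.
exists (Num.conj d) => e e0; have [r' r'0 K] := hd e e0.
exists r' => // w wz; have := K (Num.conj w).
rewrite -rmorphB /= cabs_conj => /(_ wz); rewrite -cabs_conj.
by rewrite rmorphB rmorphB rmorphM /= conjCK.
Qed.

(** The symmetry extends by continuity to all points of holomorphy. *)
Lemma gsym_hol_dom f z : meromorphic f -> gsym f -> hol_dom f z ->
  f (Num.conj z) = Num.conj (f z).
Proof.
move=> mf sf [hz hf]; have hc := hz; rewrite -Im_conj_neq0 in hc.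
have hc' : holomorphic_at f (Num.conj z).
  have /cvgC/(_ _ ltr01) H := hol_cvg hf.
  apply: (meromorphic_bounded (M := cabs (f z) + 1) mf hc).
  have := near_conj (z0 := Num.conj z); rewrite conjCK => nc.
  apply: filterS2 (nc _ (near_dnbhs H)) (nc _ (sf z hz)) => w /= h1.
  rewrite conjCK => ->; rewrite cabs_conj -lerBlDl ltW //.
  exact: le_lt_trans (cabs_sub _ _) h1.
have h2 : holomorphic_at (fun w => Num.conj (f (Num.conj w))) z by exact: hol_conj.
rewrite [in RHS](hol_eq_at hf h2) ?conjCK //.
by apply: filterS (sf z hz) => w /= ->; rewrite conjCK.
Qed.

Lemma hol_dom_gsym f : meromorphic f ->
  (forall z, hol_dom f z -> f (Num.conj z) = Num.conj (f z)) -> gsym f.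
Proof.
by move=> mf sf z hz; apply: filterS (quasi_hol_dom (meromorphic_quasi mf) hz).
Qed.

End QuasiMeromorphic.

(** * Negative squares of Hermitian forms *)

Section Hermitian.
Variable R : realType.
Local Notation C := R[i].
Local Open Scope sesquilinear_scope.

Lemma trmxC_mul m n p (A : 'M[C]_(m, n)) (B : 'M[C]_(n, p)) :
  (A *m B)^t* = B^t* *m A^t*.
Proof. by rewrite trmx_mul map_mxM. Qed.

Lemma trmxCE m n (A : 'M[C]_(m, n)) i j : A^t* i j = Num.conj (A j i).
Proof. by rewrite !mxE. Qed.

Lemma trmxC1 n : (1%:M : 'M[C]_n)^t* = 1%:M.
Proof. by rewrite trmx1 map_mx1. Qed.

Lemma conj_realC (r : R) : Num.conj (r%:C%C : C) = r%:C%C.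
Proof. exact: conjc_real. Qed.

Definition ddiag n (d : 'I_n -> R) : 'M[C]_n := diag_mx (\row_k (d k)%:C%C).

Lemma ddiag_form n (d : 'I_n -> R) (x : 'rV[C]_n) :
  (x *m ddiag d *m x^t*) 0 0 = \sum_k (d k)%:C%C * `|x 0 k| ^+ 2.
Proof.
rewrite /ddiag mxE; apply: eq_bigr => k _.
by rewrite mul_mx_diag !mxE normCK mulrAC mulrC.
Qed.

Lemma sq_form n (x : 'rV[C]_n) : (x *m x^t*) 0 0 = \sum_k `|x 0 k| ^+ 2.
Proof. by rewrite mxE; apply: eq_bigr => k _; rewrite trmxCE normCK. Qed.

Lemma sq_form_gt0 n (x : 'rV[C]_n) : x != 0 -> 0 < (x *m x^t*) 0 0.
Proof.
move=> x0; rewrite sq_form lt_def sumr_ge0 ?andbT; last by move=> k _; rewrite exprn_ge0.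
apply: contraNneq x0 => s0; apply/eqP/rowP => k; rewrite mxE.
have := psumr_eq0P (fun k _ => exprn_ge0 2 (normr_ge0 (x 0 k))) s0.
by move=> /(_ k isT)/eqP; rewrite expf_eq0 /= normr_eq0 => /eqP.
Qed.

Lemma herm_diag n (H : 'M[C]_n) : H^t* = H ->
  exists (P : 'M[C]_n) (d : 'I_n -> R), P *m P^t* = 1%:M /\
    H = P^t* *m ddiag d *m P.
Proof.
move=> Hh; have Hherm : H \is hermsymmx.
  by rewrite is_hermitianmxE expr0 scale1r; apply/eqP.
have rd := hermitian_spectral_diag_real Hherm.
have /orthomx_spectralP := hermitian_normalmx Hherm.
rewrite invmx_unitary ?spectral_unitarymx // => HE.
exists (spectralmx H), (fun k => complex.Re (spectral_diag H 0 k)); split.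
  exact/unitarymxP/spectral_unitarymx.
rewrite /ddiag; have <- : spectral_diag H = \row_k (complex.Re (spectral_diag H 0 k))%:C%C.
  by apply/rowP => k; rewrite mxE RRe_real // (mxOverP rd).
exact: HE.
Qed.

Lemma unitary_row_neq0 n (P : 'M[C]_n) k : P *m P^t* = 1%:M -> row k P != 0.
Proof.
move=> PP; apply/eqP => r0; have /matrixP/(_ k k) := PP.
rewrite mxE [RHS]mxE eqxx mulr1n big1 => [/esym/eqP|j _]; first by rewrite oner_eq0.
by have /rowP/(_ j) := r0; rewrite !mxE => ->; rewrite mul0r.
Qed.

(** The form is diagonal in an orthonormal basis, and rescaling turns its
    negative eigenvalues into [-1]. *)
Lemma negdef_normalize n (H : 'M[C]_n) : H^t* = H ->
  (forall x : 'rV[C]_n, x != 0 -> (x *m H *m x^t*) 0 0 < 0) ->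
  exists W : 'M[C]_n, W *m H *m W^t* = - 1%:M.
Proof.
move=> Hh neg; have [P [d [PP HE]]] := herm_diag Hh.
have PHP : P *m H *m P^t* = ddiag d.
  by rewrite HE !mulmxA PP mul1mx -!mulmxA PP mulmx1.
have dneg k : d k < 0.
  have := neg _ (unitary_row_neq0 k PP).
  have -> : (row k P *m H *m (row k P)^t*) 0 0 = (P *m H *m P^t*) k k.
    rewrite -row_mul !mxE; apply: eq_bigr => j _; rewrite !mxE; congr (_ * _).
  by rewrite PHP /ddiag !mxE eqxx mulr1n ltcR.
pose e k : C := (Num.sqrt (- d k))^-1%:C%C.
pose D := diag_mx (\row_k e k).
have De : D^t* = D.
  by rewrite /D tr_diag_mx map_diag_mx; congr diag_mx; apply/rowP => k; rewrite !mxE; exact: conj_realC.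
exists (D *m P); rewrite trmxC_mul !mulmxA -(mulmxA D P H) -(mulmxA D (P *m H)) PHP De.
apply/matrixP => i j; rewrite /D /ddiag mulmx_diag mulmx_diag !mxE.
have [_|ij] := eqVneq i j; last by rewrite !mulr0n oppr0.
rewrite !mulr1n; transitivity ((-1 : R)%:C%C); last by rewrite rmorphN1.
rewrite /e -!rmorphM; congr (_%:C)%C.
have s0 : 0 < - d i by rewrite oppr_gt0.
rewrite mulrAC -invfM -expr2 sqr_sqrtr ?ltW // invrN mulNr mulVf //.
by rewrite lt_eqF.
Qed.

(** On the common kernel of the linear forms with negative coefficients, [H]
    is at most [-1]. *)
Lemma negdef_complement M p (L : 'M[C]_(M, p)) (d : 'I_p -> R) (H : 'M[C]_M) :
  (forall x : 'rV[C]_M, (x *m H *m x^t*) 0 0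
      + \sum_k (d k)%:C%C * `|(x *m L) 0 k| ^+ 2 = - (x *m x^t*) 0 0) ->
  exists q (W : 'M[C]_(q, M)), (M - #|[set k | (d k < 0)%R]%SET| <= q)%N /\
    forall x : 'rV[C]_q, x != 0 -> (x *m (W *m H *m W^t*) *m x^t*) 0 0 < 0.
Proof.
move=> HL; set S := [set k | _]%SET.
pose Ln := \matrix_(i < M, k < #|S|) L i (enum_val k).
exists (\rank (kermx Ln)), (row_base (kermx Ln)); split.
  by rewrite mxrank_ker leq_sub2l // rank_leq_col.
move=> x x0; set y := x *m row_base (kermx Ln).
have y0 : y != 0.
  by apply: contraNneq x0 => /eqP; rewrite mulmx_free_eq0 ?row_base_free.
have yL : y *m Ln = 0.
  by apply/sub_kermxP; rewrite (submx_trans (submxMl _ _)) // eq_row_base.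
have -> : x *m (row_base (kermx Ln) *m H *m (row_base (kermx Ln))^t*) *m x^t*
    = y *m H *m y^t* by rewrite /y trmxC_mul !mulmxA.
have /(canRL (addrK _)) -> := HL y.
have s0 := sq_form_gt0 y0.
rewrite -opprD oppr_lt0 ltr_wpDr // sumr_ge0 // => k _.
have [dk|dk] := ltP (d k) 0; last by rewrite mulr_ge0 ?exprn_ge0 // ler0c.
suff -> : (y *m L) 0 k = 0 by rewrite normr0 expr0n mulr0.
have kS : k \in S by rewrite inE.
have /rowP/(_ (enum_rank_in kS k)) := yL; rewrite !mxE => E.
by rewrite -[RHS]E; apply: eq_bigr => j _; rewrite [Ln _ _]mxE enum_rankK_in.
Qed.

(** The form of [H + 1] is bounded by the sum of its entries in modulus times the
    sum of squares. *)
Lemma negdef_approx n (H : 'M[C]_n) :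
  (forall r s, cabs (H r s + (r == s)%:R) < ((n * n).+1%:R)^-1) ->
  forall x : 'rV[C]_n, x != 0 -> H^t* = H -> (x *m H *m x^t*) 0 0 < 0.
Proof.
move=> Hap x x0 Hh; pose Q : R := \sum_k cabs (x 0 k) ^+ 2.
have Q0 : 0 < Q.
  have := sq_form_gt0 x0; rewrite sq_form.
  have -> : \sum_k `|x 0 k| ^+ 2 = Q%:C%C.
    by rewrite rmorph_sum; apply: eq_bigr => k _; rewrite normcabs -rmorphXn.
  by rewrite ltcR.
have QE : (x *m x^t*) 0 0 = Q%:C%C.
  rewrite sq_form rmorph_sum; apply: eq_bigr => k _.
  by rewrite normcabs -rmorphXn.
have real : (x *m H *m x^t*) 0 0 \is Num.real.
  by rewrite CrealE -trmxCE !trmxC_mul trmxCK Hh mulmxA.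
set E := x *m (H + 1%:M) *m x^t*.
have XE : (x *m H *m x^t*) 0 0 = E 0 0 - Q%:C%C.
  by rewrite -QE /E mulmxDr mulmxDl mulmx1 [in RHS]mxE addrK.
have EQ : cabs (E 0 0) < Q.
  have n0 : (0 < n)%N.
    rewrite lt0n; apply: contraNneq x0 => n0; apply/eqP/rowP => k.
    by have := ltn_ord k; rewrite {2}n0.
  have -> : E 0 0 = \sum_s \sum_r x 0 r * (H r s + (r == s)%:R) * Num.conj (x 0 s).
    rewrite mxE; apply: eq_bigr => s _; rewrite mxE mulr_suml.
    by apply: eq_bigr => r _; rewrite !mxE.
  pose eps : R := ((n * n).+1%:R)^-1.
  have eps0 : 0 < eps by rewrite invr_gt0.
  have B r s : cabs (x 0 r * (H r s + (r == s)%:R) * Num.conj (x 0 s)) <= Q * eps.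
    rewrite !cabsM cabs_conj mulrAC ler_pM ?mulr_ge0 ?cabs_ge0 //; last exact/ltW/Hap.
    have k1 k : cabs (x 0 k) ^+ 2 <= Q.
      by rewrite /Q (bigD1 k) //= lerDl sumr_ge0 // => j _; rewrite sqr_ge0.
    have := k1 r; have := k1 s; have := sqr_ge0 (cabs (x 0 r) - cabs (x 0 s)); nra.
  apply: le_lt_trans (cabs_sum _ _ _) _.
  apply: le_lt_trans (ler_sum _ (fun s _ => cabs_sum _ _ _)) _.
  apply: (@le_lt_trans _ _ (\sum_(s < n) \sum_(r < n) Q * eps)).
    by apply: ler_sum => s _; apply: ler_sum => r _; exact: B.
  rewrite !sumr_const !card_ord -mulrnA -mulr_natr -mulrA gtr_pMr // mulrC.
  by rewrite ltr_pdivrMr // mul1r ltr_nat.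
rewrite -(RRe_real real) XE ltcR raddfB /= subr_lt0.
exact: le_lt_trans (le_trans (ler_norm _) (Re_le_cabs _)) EQ.
Qed.

End Hermitian.

(** * The negative index of a Nevanlinna kernel *)

Section NegativeIndex.
Variable R : realType.
Local Notation C := R[i].
Local Open Scope sesquilinear_scope.
Implicit Types (F G h : C -> C) (z w : C) (E : set C).

Definition pick F z w : C := (F z - Num.conj (F w)) / (z - Num.conj w).

Lemma pick_conj F z w : Num.conj (pick F w z) = pick F z w.
Proof.
rewrite /pick rmorphM rmorphB fmorphV rmorphB /= !conjCK.
by rewrite -[F z - _]opprB -[z - _]opprB invrN mulrNN.
Qed.

Definition pickmx F m n (z : 'cV[C]_m) (w : 'cV[C]_n) : 'M[C]_(m, n) :=
  \matrix_(i, j) pick F (z i 0) (w j 0).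

Lemma pickmx_herm F n (z : 'cV[C]_n) : (pickmx F z z)^t* = pickmx F z z.
Proof. by apply/matrixP => i j; rewrite !mxE pick_conj. Qed.

Lemma gram_herm F m n (z : 'cV[C]_n) (U : 'M[C]_(m, n)) :
  (U *m pickmx F z z *m U^t*)^t* = U *m pickmx F z z *m U^t*.
Proof. by rewrite !trmxC_mul trmxCK pickmx_herm mulmxA. Qed.

Definition upper_in E n (z : 'cV[C]_n) :=
  forall i, 0 < complex.Im (z i 0) /\ E (z i 0).

Definition negE F E m := exists n (z : 'cV[C]_n) (U : 'M[C]_(m, n)),
  upper_in E z /\ U *m pickmx F z z *m U^t* = - 1%:M.

(** The Nevanlinna form of [F] has at least [m] negative squares at suitable
    points, which may be taken outside any prescribed discrete set. *)
Definition negG F m := forall E, generic E -> negE F E m.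

Lemma negG_negdef F E m n (z : 'cV[C]_n) (U : 'M[C]_(m, n)) :
  upper_in E z ->
  (forall x : 'rV[C]_m, x != 0 ->
     (x *m (U *m pickmx F z z *m U^t*) *m x^t*) 0 0 < 0) ->
  negE F E m.
Proof.
move=> zE neg; have [W HW] := negdef_normalize (gram_herm F z U) neg.
exists n, z, (W *m U); split=> //.
by rewrite trmxC_mul !mulmxA -HW !mulmxA.
Qed.

(** Families of points need only give a matrix close to [-1], which leaves
    room for limits. *)
Lemma negG_approx F E m :
  (forall e : R, 0 < e -> exists n (z : 'cV[C]_n) (U : 'M[C]_(m, n)),
     upper_in E z /\ forall r s,
       cabs ((U *m pickmx F z z *m U^t*) r s + (r == s)%:R) < e) ->
  negE F E m.
Proof.
move=> H; have [|n [z [U [zE HU]]]] := H ((m * m).+1%:R)^-1.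
  by rewrite invr_gt0.
apply: (negG_negdef zE (U := U)) => x x0.
by apply: negdef_approx => //; exact: gram_herm.
Qed.

Lemma negE_le F E a b : (b <= a)%N -> negE F E a -> negE F E b.
Proof.
move=> ba [n [z [U [zE HU]]]].
exists n, z, ((pid_mx b : 'M[C]_(b, a)) *m U); split=> //.
rewrite trmxC_mul !mulmxA -(mulmxA _ U) -(mulmxA _ (U *m _)) HU mulmxN mulmx1.
rewrite mulNmx; congr (- _); rewrite tr_pid_mx map_pid_mx mul_pid_mx.
by rewrite minnn (minn_idPr ba) pid_mx_1.
Qed.

Lemma negG_le F a b : (b <= a)%N -> negG F a -> negG F b.
Proof. by move=> ba H E gE; exact: negE_le (H E gE). Qed.

Lemma negG_leF F a b : negG F a -> ~ negG F b.+1 -> (a <= b)%N.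
Proof. by move=> Fa Fb; rewrite leqNgt; apply/negP => ab; apply: Fb; exact: negG_le Fa. Qed.

Lemma negG0 F : negG F 0.
Proof.
move=> E gE; exists 0%N, 0, 0; split; first by case.
by apply/matrixP => -[].
Qed.

Lemma negG_ext F G m : generic [set z | F z = G z] -> negG F m -> negG G m.
Proof.
move=> FG H E gE; have [n [z [U [zE HU]]]] := H _ (generic_and gE FG).
exists n, z, U; split; first by move=> i; have [h1 [h2 _]] := zE i.
rewrite -HU; congr (_ *m _ *m _); apply/matrixP => i j; rewrite !mxE /pick.
by have [_ [_ /= <-]] := zE i; have [_ [_ /= <-]] := zE j.
Qed.

Lemma upper_conj_neq z w : 0 < complex.Im z -> 0 < complex.Im w ->
  z - Num.conj w != 0.
Proof.
move=> hz hw; apply: contraTneq hz => /(congr1 (@complex.Im R)).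
rewrite raddfB /= Im_conj opprK => h; rewrite -leNgt.
by rewrite -[leRHS]h lerDl ltW.
Qed.

(** The kernels of [F] and [- 1 / F] differ by the factors [F z] and its
    conjugate at the two points. *)
Lemma negG_opp_inv F m : generic [set z | F z != 0] ->
  negG F m -> negG (fun z => - (F z)^-1) m.
Proof.
move=> F0 H E gE; have [n [z [U [zE HU]]]] := H _ (generic_and gE F0).
pose D := diag_mx (\row_i F (z i 0)).
exists n, z, (U *m D); split; first by move=> i; have [h1 [h2 _]] := zE i.
rewrite -HU trmxC_mul !mulmxA -(mulmxA U) -(mulmxA U); congr (_ *m _ *m _).
apply/matrixP => i j; rewrite /D tr_diag_mx map_diag_mx mul_mx_diag mul_diag_mx !mxE.
have [hi [_ /= Fi]] := zE i; have [hj [_ /= Fj]] := zE j.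
have zij := upper_conj_neq hi hj; rewrite /pick rmorphN fmorphV /=.
by field; rewrite zij Fi conjC_eq0 Fj.
Qed.

Lemma pickD F G z w : pick (fun z => F z + G z) z w = pick F z w + pick G z w.
Proof. by rewrite /pick rmorphD -mulrDl; congr (_ / _); ring. Qed.

Lemma pickmxD F G m n (z : 'cV[C]_m) (w : 'cV[C]_n) :
  pickmx (fun z => F z + G z) z w = pickmx F z w + pickmx G z w.
Proof. by apply/matrixP => i j; rewrite !mxE pickD. Qed.

Lemma pickmx_col F m n (z : 'cV[C]_m) (w : 'cV[C]_n) :
  pickmx F (col_mx z w) (col_mx z w) =
  block_mx (pickmx F z z) (pickmx F z w) (pickmx F w z) (pickmx F w w).
Proof.
apply/matrixP => i j; rewrite !mxE.
by case: (fintype.split i) => i'; rewrite mxE; case: (fintype.split j) => j';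
  rewrite mxE.
Qed.

Lemma upper_in_col E m n (z : 'cV[C]_m) (w : 'cV[C]_n) :
  upper_in E z -> upper_in E w -> upper_in E (col_mx z w).
Proof. by move=> hz hw i; rewrite mxE; case: split_ordP => j _. Qed.

End NegativeIndex.

(** * The classes of the statement in terms of the index *)

Section Interface.
Variable R : realType.
Local Notation C := R[i].
Local Open Scope sesquilinear_scope.
Implicit Types (F G h f : C -> C) (z w : C) (E : set C).

Lemma conj_cvg {T : Type} (FF : set_system T) {FFF : Filter FF} (u : T -> C) (l : C) :
  u t @[t --> FF] --> (l : C^o) ->
  Num.conj (u t) @[t --> FF] --> (Num.conj l : C^o).
Proof.
move=> /cvgC H; apply/cvgC => e e0; apply: filterS (H e e0) => t.
by rewrite -rmorphB /= cabs_conj.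
Qed.

Lemma sum_cvg {T : Type} (FF : set_system T) {FFF : Filter FF} (I : Type)
    (s : seq I) (u : I -> T -> C) (l : I -> C) :
  (forall i, u i t @[t --> FF] --> (l i : C^o)) ->
  \sum_(i <- s) u i t @[t --> FF] --> (\sum_(i <- s) l i : C^o).
Proof.
move=> H; elim: s => [|i s IH].
  by rewrite big_nil; under eq_fun do rewrite big_nil; exact: (@cvg_cst C^o).
rewrite big_cons; under eq_fun do rewrite big_cons.
by apply: (@cvgD C C^o); [exact: H|exact: IH].
Qed.

Lemma mulmx_cvg {T : Type} (FF : set_system T) {FFF : Filter FF} m n p
    (A : T -> 'M[C]_(m, n)) (B : T -> 'M[C]_(n, p)) (A0 : 'M[C]_(m, n)) (B0 : 'M[C]_(n, p)) :
  (forall i j, A t i j @[t --> FF] --> (A0 i j : C^o)) ->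
  (forall i j, B t i j @[t --> FF] --> (B0 i j : C^o)) ->
  forall i j, (A t *m B t) i j @[t --> FF] --> ((A0 *m B0) i j : C^o).
Proof.
move=> HA HB i j; rewrite mxE; under eq_fun do rewrite mxE.
by apply: sum_cvg => k; apply: cvgM; [exact: HA|exact: HB].
Qed.

Lemma gram_cvg {T : Type} (FF : set_system T) {FFF : Filter FF} m n
    (U : T -> 'M[C]_(m, n)) (K : T -> 'M[C]_n)
    (U0 : 'M[C]_(m, n)) (K0 : 'M[C]_n) :
  (forall i j, U t i j @[t --> FF] --> (U0 i j : C^o)) ->
  (forall i j, K t i j @[t --> FF] --> (K0 i j : C^o)) ->
  forall i j, (U t *m K t *m (U t)^t*) i j @[t --> FF]
     --> ((U0 *m K0 *m U0^t*) i j : C^o).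
Proof.
move=> HU HK; apply: mulmx_cvg; first exact: mulmx_cvg.
by move=> i j; rewrite trmxCE; under eq_fun do rewrite trmxCE; exact: conj_cvg.
Qed.

Lemma cst_cvg {T : Type} (FF : set_system T) {FFF : Filter FF} (k : C) :
  (fun=> k) t @[t --> FF] --> (k : C^o).
Proof. exact: (@cvg_cst C^o). Qed.

(** By continuity of the kernel, families of points of holomorphy can be moved
    off a discrete set without losing negative squares. *)
Lemma perturb F E m n (z : 'cV[C]_n) (U : 'M[C]_(m, n)) : generic E ->
  upper_in (hol_dom F) z -> U *m pickmx F z z *m U^t* = - 1%:M -> negE F E m.
Proof.
move=> gE zh HU.
have ex i (k : nat) : exists w : C, [/\ 0 < complex.Im w /\ E w,
    cabs (w - z i 0) < k.+1%:R^-1 & cabs (F w - F (z i 0)) < k.+1%:R^-1].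
  have [hi [_ hF]] := zh i; have k0 : 0 < k.+1%:R^-1 :> R by rewrite invr_gt0.
  have /cvgC/(_ _ k0) H := hol_cvg hF.
  have := dnbhs_ex (filterI (gE _ (lt0r_neq0 hi))
    (filterI (near_dnbhs (near_Im_gt0 hi)) (near_dnbhs H))) k0.
  by move=> [w [[h1 [h2 h3]] _ h4]]; exists w; split.
pose zs k : 'cV[C]_n := \col_i projT1 (cid (ex i k)).
have zsP k i : [/\ 0 < complex.Im (zs k i 0) /\ E (zs k i 0),
    cabs (zs k i 0 - z i 0) < k.+1%:R^-1 &
    cabs (F (zs k i 0) - F (z i 0)) < k.+1%:R^-1].
  by rewrite mxE; exact: (projT2 (cid (ex i k))).
have cv (u : nat -> C) (l : C) : (forall k, cabs (u k - l) < k.+1%:R^-1) ->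
    u k @[k --> \oo] --> (l : C^o).
  move=> H; apply/cvgC => e e0; near=> k; apply: lt_trans (H k) _.
  near: k; exact: near_infty_natSinv_lt (PosNum e0).
have zcv i : zs k i 0 @[k --> \oo] --> (z i 0 : C^o).
  by apply: cv => k; case: (zsP k i).
have Fcv i : F (zs k i 0) @[k --> \oo] --> (F (z i 0) : C^o).
  by apply: cv => k; case: (zsP k i).
have Kcv i j : pickmx F (zs k) (zs k) i j @[k --> \oo] --> (pickmx F z z i j : C^o).
  rewrite mxE; under eq_fun do rewrite mxE.
  apply: cvgM.
    by apply: (@cvgB C C^o); [exact: Fcv|apply: conj_cvg; exact: Fcv].
  apply: cvgV; first by apply: upper_conj_neq; [case: (zh i)|case: (zh j)].
  by apply: (@cvgB C C^o); [exact: zcv|apply: conj_cvg; exact: zcv].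
apply: negG_approx => e e0.
have Ucv (i : 'I_m) (j : 'I_n) : (fun _ : nat => U i j) k @[k --> \oo] --> (U i j : C^o).
  exact: cst_cvg.
have G r s : (U *m pickmx F (zs k) (zs k) *m U^t*) r s @[k --> \oo] -->
    ((U *m pickmx F z z *m U^t*) r s : C^o).
  exact: (gram_cvg (U := fun=> U) Ucv Kcv).
have [k Hk] : exists k, forall r s, cabs ((U *m pickmx F (zs k) (zs k) *m U^t*) r s
    + (r == s)%:R) < e.
  have /filter_ex : \forall k \near \oo, forall rs : 'I_m * 'I_m,
     cabs ((U *m pickmx F (zs k) (zs k) *m U^t*) rs.1 rs.2 + (rs.1 == rs.2)%:R) < e.
    apply: filter_forall => -[r s]; have /cvgC/(_ e e0) := G r s.
    by apply: filterS => k; rewrite HU !mxE opprK.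
  by move=> [k Hk]; exists k => r s; exact: (Hk (r, s)).
exists n, (zs k), U; split=> // i; by case: (zsP k i).
Unshelve. all: end_near. Qed.

Lemma nevanlinna_formE f n (z : 'I_n -> C) (xi : 'cV[C]_n) :
  nevanlinna_form f z xi =
  (xi^T *m pickmx f (\col_i z i) (\col_i z i) *m (xi^T)^t*) 0 0.
Proof.
rewrite /nevanlinna_form [RHS]mxE exchange_big; apply: eq_bigr => j _.
rewrite mxE mulr_suml; apply: eq_bigr => i _.
by rewrite !mxE /pick [xi i 0 * _]mulrC.
Qed.

Lemma negsq_exists f n (z : 'I_n -> C) :
  exists m, negative_squares (nevanlinna_form f z) m.
Proof.
set Z := \col_i z i; have [P [d [PP HE]]] := herm_diag (pickmx_herm f Z).
exists #|[set i | (d i < 0)%R]%SET|, (map_mx Num.conj P), d; split=> //.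
  have E : map_mx Num.conj P *m P^T = 1%:M.
    by rewrite -[P^T](map_mx_id (@conjCK _)) map_mx_comp -map_mxM PP map_mx1.
  by have [h _] := mulmx1_unit E; exact: h.
move=> xi; rewrite nevanlinna_formE -/Z HE.
have -> : xi^T *m (P^t* *m ddiag d *m P) *m (xi^T)^t* =
    (xi^T *m P^t*) *m ddiag d *m (xi^T *m P^t*)^t*.
  by rewrite trmxC_mul trmxCK !mulmxA.
rewrite ddiag_form; apply: eq_bigr => k _; congr (_ * `| _ | ^+ 2).
by rewrite !mxE; apply: eq_bigr => j _; rewrite !mxE mulrC.
Qed.

Lemma neg_sum n (d : 'I_n -> R) (x : 'rV[C]_n) : (forall k, d k < 0) ->
  x != 0 -> \sum_k (d k)%:C%C * `|x 0 k| ^+ 2 < 0.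
Proof.
move=> dn x0; have T k : 0 <= - ((d k)%:C%C * `|x 0 k| ^+ 2).
  by rewrite -mulNr mulr_ge0 ?exprn_ge0 // -rmorphN /= ler0c oppr_ge0 ltW.
rewrite -oppr_gt0 -sumrN lt_def sumr_ge0 ?andbT //.
apply: contraNneq x0 => s0; apply/eqP/rowP => k; rewrite mxE.
have := psumr_eq0P (fun k _ => T k) s0 => /(_ k isT)/eqP.
rewrite oppr_eq0 mulf_eq0 expf_eq0 /= normr_eq0 => /orP[|/eqP//].
by rewrite realC_eq0 lt_eqF.
Qed.

Lemma negsq_negE f E n (z : 'I_n -> C) m : generic E ->
  (forall i, 0 < complex.Im (z i) /\ hol_dom f (z i)) ->
  negative_squares (nevanlinna_form f z) m -> negE f E m.
Proof.
move=> gE zh [L [d [Lu form <-]]]; set S := [set i | _]%SET.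
set Z := \col_i z i; have Zh : upper_in (hol_dom f) Z by move=> i; rewrite mxE.
pose Sel : 'M[C]_(n, #|S|) := \matrix_(i, k) (i == enum_val k)%:R.
pose U : 'M[C]_(#|S|, n) := (invmx L *m Sel)^T.
have [n' [z' [U' [zE' HU']]]] : negE f (hol_dom f) #|S|.
  apply: (negG_negdef Zh (U := U)) => x x0.
  have -> : x *m (U *m pickmx f Z Z *m U^t*) *m x^t* =
     ((x *m U)^T^T) *m pickmx f Z Z *m ((x *m U)^T^T)^t*.
    by rewrite trmxK trmxC_mul !mulmxA.
  rewrite -nevanlinna_formE form.
  have -> : L *m (x *m U)^T = Sel *m x^T.
    by rewrite trmx_mul /U trmxK mulmxA mulmxA mulmxV // mul1mx.
  have LE k : (Sel *m x^T) (enum_val k) 0 = x 0 k.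
    rewrite mxE (bigD1 k) //= big1 ?addr0; first by rewrite !mxE eqxx mul1r.
    by move=> j jk; rewrite !mxE (inj_eq enum_val_inj) eq_sym (negPf jk) mul0r.
  have L0 i : i \notin S -> (Sel *m x^T) i 0 = 0.
    move=> iS; rewrite mxE big1 // => j _; rewrite !mxE.
    have [ij|] := eqVneq i (enum_val j); last by rewrite mul0r.
    by move: iS; rewrite ij enum_valP.
  rewrite (bigID (mem S)) /= [X in _ + X]big1 ?addr0; last first.
    by move=> i /L0 ->; rewrite normr0 expr0n mulr0.
  rewrite big_enum_val /=; under eq_bigr do rewrite LE.
  apply: neg_sum => // k; have := enum_valP k; by rewrite inE.
exact: (perturb gE zE' HU').
Qed.

(** Were [p] larger than the number of negative coefficients, some vector of
    the negative subspace would be annihilated by all forms with negative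
    coefficients. *)
Lemma negsq_ge f n (z : 'I_n -> C) m p (U : 'M[C]_(p, n)) :
  negative_squares (nevanlinna_form f z) m ->
  U *m pickmx f (\col_i z i) (\col_i z i) *m U^t* = - 1%:M -> (p <= m)%N.
Proof.
move=> [L [d [_ form dm]]] HU.
have [x|q [W [hq HW]]] := @negdef_complement _ p n (U *m L^T) d 0.
  rewrite mulmx0 mul0mx [X in X + _]mxE add0r.
  have := form (x *m U)^T; rewrite nevanlinna_formE !trmxK.
  have -> : x *m U *m pickmx f (\col_i z i) (\col_i z i) *m (x *m U)^t* = - (x *m x^t*).
    rewrite trmxC_mul !mulmxA -(mulmxA x) -(mulmxA x) HU.
    by rewrite mulmxN mulmx1 mulNmx.
  rewrite [X in X = _]mxE => ->; apply: eq_bigr => k _; congr (_ * `|_| ^+ 2).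
  have -> : L *m (x *m U)^T = (x *m (U *m L^T))^T.
    by rewrite mulmxA [in RHS]trmx_mul trmxK.
  by rewrite [RHS]mxE.
rewrite dm in hq; rewrite -subn_eq0 -leqn0; apply: leq_trans hq _.
rewrite leqNgt; apply/negP => q0.
have := HW (const_mx 1); rewrite mulmx0 !mul0mx mulmx0 mul0mx mxE ltxx => H.
suff : false by []; apply: H; apply/eqP => /rowP/(_ (Ordinal q0)).
by rewrite !mxE => /eqP; rewrite oner_eq0.
Qed.

(** Columns belonging to equal points are added up. *)
Lemma merge_points f E p n (z : 'cV[C]_n) (U : 'M[C]_(p, n)) : upper_in E z ->
  exists n' (z' : 'I_n' -> C) (U' : 'M[C]_(p, n')),
    [/\ injective z', upper_in E (\col_i z' i) &
      U' *m pickmx f (\col_i z' i) (\col_i z' i) *m U'^t* =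
      U *m pickmx f z z *m U^t*].
Proof.
move=> zE; pose s := undup [seq z i 0 | i : 'I_n].
have ki i : (index (z i 0%R) s < size s)%N.
  by rewrite index_mem mem_undup; apply: map_f; rewrite mem_enum.
pose k i := Ordinal (ki i).
pose z' (j : 'I_(size s)) := nth 0 s j.
have zk i : z' (k i) = z i 0.
  by rewrite /z' nth_index // mem_undup; apply: map_f; rewrite mem_enum.
pose Sg : 'M[C]_(n, size s) := \matrix_(i, j) (j == k i)%:R.
have SgE q (A : 'M[C]_(size s, q)) i j : (Sg *m A) i j = A (k i) j.
  rewrite mxE (bigD1 (k i)) //= big1 ?addr0 ?mxE ?eqxx ?mul1r // => t tk.
  by rewrite mxE (negPf tk) mul0r.
exists (size s), z', (U *m Sg); split.
- move=> i j /eqP; rewrite /z' nth_uniq ?undup_uniq // => /eqP; exact: val_inj.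
- move=> j; rewrite mxE; have : nth 0 s j \in s by rewrite mem_nth.
  rewrite mem_undup => /mapP[i _ zi]; have -> : z' j = z i 0 := zi.
  exact: zE.
- rewrite trmxC_mul !mulmxA -(mulmxA U Sg) -(mulmxA U); congr (_ *m _ *m _).
  apply/matrixP => i j.
  have -> : (Sg *m pickmx f (\col_i0 z' i0) (\col_i0 z' i0) *m Sg^t*) i j =
     Num.conj ((Sg *m (Sg *m pickmx f (\col_i0 z' i0) (\col_i0 z' i0))^t*) j i).
    rewrite -trmxCE; move: (pickmx f _ _) => A.
    by rewrite (trmxC_mul Sg ((Sg *m A)^t*)) trmxCK.
  by rewrite SgE trmxCE conjCK SgE !mxE !zk.
Qed.

(** Exceptional values are harmless: points of holomorphy can be moved into
    any generic set, and coinciding points can be merged, so that generic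
    points count all negative squares. *)
Lemma nevanlinnaP (kappa : int) f : nevanlinna kappa f <->
  [/\ meromorphic f, gsym f &
    exists a : nat, [/\ kappa = a%:Z, negG f a & ~ negG f a.+1]].
Proof.
split=> [[mf sf H1 [n [z [[zi zh] [m nm mk]]]]]|[mf sf [a [-> na na']]]].
  split=> //; first exact: hol_dom_gsym.
  exists m; split; [by []|by move=> E gE; exact: negsq_negE nm|move=> nm1].
  have [n' [z' [U' [zE' HU']]]] := nm1 _ (quasi_hol_dom (meromorphic_quasi mf)).
  have [n2 [z2 [U2 [z2i z2E E2]]]] := merge_points f U' zE'.
  rewrite HU' in E2.
  have [|m2 h2] := H1 n2 z2.
    split; first exact: z2i.
    by move=> i; have := z2E i; rewrite mxE.
  have := negsq_ge h2 E2; rewrite -mk lez_nat => l1 l2.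
  by move: (leq_trans l1 l2); rewrite ltnn.
have bound n (z : 'I_n -> C) m : (forall i, 0 < complex.Im (z i) /\ hol_dom f (z i)) ->
    negative_squares (nevanlinna_form f z) m -> (m <= a)%N.
  move=> zh nm; apply: (@negG_leF _ f) na' => E gE; exact: negsq_negE nm.
split=> //; first by move=> z; exact: gsym_hol_dom.
- move=> n z [zi zh]; have [m nm] := negsq_exists f z.
  by exists m => //; rewrite lez_nat; exact: bound nm.
- have [n' [z' [U' [zE' HU']]]] := na _ (quasi_hol_dom (meromorphic_quasi mf)).
  have [n2 [z2 [U2 [z2i z2E E2]]]] := merge_points f U' zE'.
  rewrite HU' in E2; have z2h i : 0 < complex.Im (z2 i) /\ hol_dom f (z2 i).
    by have := z2E i; rewrite mxE.
  exists n2, z2; split=> //; have [m nm] := negsq_exists f z2; exists m => //.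
  by apply/eqP; rewrite eqz_nat eqn_leq (bound _ _ _ z2h nm) (negsq_ge nm E2).
Qed.

End Interface.

(** * Limits along the imaginary axis and the index of a polynomial *)

Section GenericInfinity.
Variable R : realType.
Local Notation C := R[i].
Implicit Types (y t : R) (B : set R).

(** Large values of [y], with a discrete set left out near each of them.
    Unlike the neighbourhoods of infinity, this filter contains the trace on
    the imaginary axis of every generic set. *)
Definition gen_infty : set_system R :=
  [set B | exists Y : R, forall y, Y <= y -> \forall t \near (y : R^o)^', B t].

Global Instance gen_infty_filter : ProperFilter gen_infty.
Proof.
split=> [[Y H]|].
  have /filter_ex[t //] : \forall t \near (Y : R^o)^', set0 t by exact: H.
split.
- by exists 0 => y _; exact: filterT.
- move=> A B [Y H] [Y' H']; exists (Num.max Y Y') => y; rewrite ge_max => /andP[h h'].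
  exact: filterI (H y h) (H' y h').
- by move=> A B AB [Y H]; exists Y => y /H; exact: filterS.
Qed.

Lemma dnbhsR y B : (\forall t \near (y : R^o)^', B t) <->
  exists2 r : R, 0 < r & forall t, t != y -> `|t - y| < r -> B t.
Proof.
split=> [/nbhs_ballP[r /= r0 H]|[r r0 H]].
  by exists r => // t ty tr; apply: H => //; rewrite /ball /= distrC.
apply/nbhs_ballP; exists r => // t; rewrite /ball /= distrC => tr ty; exact: H.
Qed.

Lemma gen_infty_pinfty B : (\forall y \near +oo, B y) -> gen_infty B.
Proof.
move=> [M [_ H]]; exists (M + 1) => y My; apply/dnbhsR; exists 1 => // t _.
rewrite ltr_norml => /andP[h _]; apply: H; lra.
Qed.

Lemma gen_infty_gt (M : R) : gen_infty [set y | M < y].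
Proof. by apply: gen_infty_pinfty; exists M; split; [exact: num_real|]. Qed.

Lemma gen_infty_scale (c : R) B : 0 < c -> gen_infty B ->
  gen_infty [set y | B (c * y)].
Proof.
move=> c0 [Y H]; exists (Y / c) => y; rewrite ler_pdivrMr // mulrC => Yy.
have [r r0 K] := (dnbhsR _ _).1 (H _ Yy); apply/dnbhsR.
exists (r / c); first by rewrite divr_gt0.
move=> t ty tr; apply: K; first by rewrite (inj_eq (mulfI (lt0r_neq0 c0))).
rewrite -mulrBr normrM gtr0_norm // mulrC.
by rewrite ltr_pdivlMr // in tr.
Qed.

Lemma iyE y : (0 +i* y)%C = 'i%C * y%:C%C :> C.
Proof.
apply/eqP; rewrite eq_complex /=; apply/andP; split; apply/eqP; ring.
Qed.

Lemma iy_neq0 y : 0 < y -> (0 +i* y)%C != 0 :> C.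
Proof. by move=> y0; rewrite eq_complex /= eqxx gt_eqF. Qed.

Lemma conj_iy y : Num.conj (0 +i* y)%C = - (0 +i* y)%C :> C.
Proof. by apply/eqP; rewrite eq_complex /= oppr0 !eqxx. Qed.

Lemma cabs_iy y : cabs (0 +i* y)%C = `|y|.
Proof. by rewrite iyE cabsM cabsi mul1r cabs_real. Qed.

Lemma iyB y t : (0 +i* y)%C - (0 +i* t)%C = (0 +i* (y - t))%C :> C.
Proof. by apply/eqP; rewrite eq_complex /= subrr !eqxx. Qed.

Lemma iyZ (c : R) y : c%:C%C * (0 +i* y)%C = (0 +i* (c * y))%C :> C.
Proof.
apply/eqP; rewrite eq_complex /=; apply/andP; split; apply/eqP; ring.
Qed.

Lemma near_axis (B : set C) y : (\forall z \near ((0 +i* y)%C : C^o)^', B z) ->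
  \forall t \near (y : R^o)^', B (0 +i* t)%C.
Proof.
move=> /dnbhs_cabs[r r0 H]; apply/dnbhsR; exists r => // t ty tr.
by apply: H; [rewrite eq_complex /= eqxx|rewrite iyB cabs_iy].
Qed.

Lemma gen_infty_generic (E : set C) : generic E -> gen_infty [set y | E (0 +i* y)%C].
Proof.
move=> gE; exists 1 => y y1; apply/near_axis/gE.
by rewrite /= gt_eqF // (lt_le_trans _ y1).
Qed.

(** Points tending to infinity on the axis at fixed ratios. *)
Lemma axis_points n (E : set C) : generic E -> gen_infty [set y |
  upper_in E (\col_(i < n) ((i.+1%:R)%:C%C * (0 +i* y)%C))].
Proof.
move=> gE; have h : \forall y \near gen_infty, forall i : 'I_n,
    E ((i.+1%:R)%:C%C * (0 +i* y)%C).
  apply: filter_forall => i.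
  have := gen_infty_scale (ltr0Sn R i) (gen_infty_generic gE).
  by apply: filterS => y /=; rewrite iyZ.
apply: filterS2 h (gen_infty_gt 0) => y hE y0 i; rewrite mxE; split; last exact: hE.
by rewrite iyZ /= mulr_gt0 // ltr0Sn.
Qed.

(** Wrapped in a type of its own, which keeps tactics from unfolding the
    limit. *)
Variant axis_cvg (F : C -> C) (l : C) : Prop :=
  AxisCvg of F (0 +i* y)%C @[y --> gen_infty] --> (l : C^o).

Lemma axisE F l : axis_cvg F l <->
  F (0 +i* y)%C @[y --> gen_infty] --> (l : C^o).
Proof. by split=> [[]|]. Qed.

Lemma axis_cvgP F l : axis_cvg F l <->
  forall e : R, 0 < e -> gen_infty [set y | cabs (F (0 +i* y)%C - l) < e].
Proof. by rewrite axisE cvgC. Qed.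

Lemma axis_cst (k : C) : axis_cvg (fun=> k) k.
Proof. by split; exact: (@cvg_cst C^o). Qed.

Lemma axisD F G a b : axis_cvg F a -> axis_cvg G b ->
  axis_cvg (fun z => F z + G z) (a + b).
Proof. by move=> [h] [h']; split; apply: (@cvgD C C^o); [exact: h|exact: h']. Qed.

Lemma axisN F a : axis_cvg F a -> axis_cvg (fun z => - F z) (- a).
Proof. by move=> [h]; split; apply: (@cvgN C C^o); exact: h. Qed.

Lemma axisB F G a b : axis_cvg F a -> axis_cvg G b ->
  axis_cvg (fun z => F z - G z) (a - b).
Proof. by move=> h h'; apply: axisD h (axisN h'). Qed.

Lemma axisM F G a b : axis_cvg F a -> axis_cvg G b ->
  axis_cvg (fun z => F z * G z) (a * b).
Proof. by move=> [h] [h']; split; apply: cvgM; [exact: h|exact: h']. Qed.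

Lemma axisV F a : a != 0 -> axis_cvg F a -> axis_cvg (fun z => (F z)^-1) a^-1.
Proof. by move=> a0 [h]; split; apply: cvgV; [exact: a0|exact: h]. Qed.

Lemma axis_conj F a : axis_cvg F a ->
  axis_cvg (fun z => Num.conj (F z)) (Num.conj a).
Proof. by move=> [h]; split; exact: conj_cvg. Qed.

Lemma axisX F a n : axis_cvg F a -> axis_cvg (fun z => F z ^+ n) (a ^+ n).
Proof.
move=> h; elim: n => [|n IH].
  by rewrite expr0; under eq_fun do rewrite expr0; exact: axis_cst.
rewrite exprS; under eq_fun do rewrite exprS; exact: axisM h IH.
Qed.

Lemma axis_sum (I : Type) (s : seq I) (F : I -> C -> C) (l : I -> C) :
  (forall i, axis_cvg (F i) (l i)) ->
  axis_cvg (fun z => \sum_(i <- s) F i z) (\sum_(i <- s) l i).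
Proof. by move=> h; split; apply: sum_cvg => i; exact/axisE/h. Qed.

Lemma axis_near F G l : gen_infty [set y | F (0 +i* y)%C = G (0 +i* y)%C] ->
  axis_cvg F l -> axis_cvg G l.
Proof.
move=> FG /axis_cvgP H; apply/axis_cvgP => e e0.
by apply: filterS2 FG (H e e0) => y /= ->.
Qed.

Lemma axis_generic F G l : generic [set z | F z = G z] ->
  axis_cvg F l -> axis_cvg G l.
Proof. by move=> /gen_infty_generic; exact: axis_near. Qed.

Lemma axis_eq F G l : (forall z, z != 0 -> F z = G z) ->
  axis_cvg F l -> axis_cvg G l.
Proof.
move=> FG; apply: axis_near; apply: filterS (gen_infty_gt 0) => y y0.
exact/FG/iy_neq0.
Qed.

Lemma axis_unique F a b : axis_cvg F a -> axis_cvg F b -> a = b.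
Proof. by move=> [h] [h']; exact: (cvg_unique (norm_hausdorff (V := C^o)) h h'). Qed.

Lemma axis_neq0 F a : a != 0 -> axis_cvg F a ->
  gen_infty [set y | F (0 +i* y)%C != 0].
Proof.
move=> a0 /axis_cvgP; move: (a0); rewrite -cabs_gt0 => /[swap] H /H.
apply: filterS => y /=; apply: contraTneq => ->.
by rewrite sub0r cabsN ltxx.
Qed.

Lemma axis_inv : axis_cvg (fun z => z^-1) 0.
Proof.
apply/axis_cvgP => e e0; apply: filterS (gen_infty_gt e^-1) => y /= ye.
have y0 : 0 < y by rewrite (lt_trans _ ye) // invr_gt0.
rewrite subr0 cabsV iyE cabsM cabsi mul1r cabs_real gtr0_norm //.
by rewrite -[e]invrK ltf_pV2 ?posrE ?invr_gt0.
Qed.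

Lemma axis_scale (c : R) F l : 0 < c -> axis_cvg F l ->
  axis_cvg (fun z => F (c%:C%C * z)) l.
Proof.
move=> c0 /axis_cvgP H; apply/axis_cvgP => e e0.
apply: filterS (gen_infty_scale c0 (H e e0)) => y /=.
by rewrite iyZ.
Qed.

End GenericInfinity.

Lemma block_mx_cvg (R : realType) {T : Type} (FF : set_system T) {FFF : Filter FF}
    m1 m2 n1 n2 (A : T -> 'M[R[i]]_(m1, n1)) (B : T -> 'M[R[i]]_(m1, n2))
    (C : T -> 'M[R[i]]_(m2, n1)) (D : T -> 'M[R[i]]_(m2, n2))
    (A0 : 'M[R[i]]_(m1, n1)) (B0 : 'M[R[i]]_(m1, n2))
    (C0 : 'M[R[i]]_(m2, n1)) (D0 : 'M[R[i]]_(m2, n2)) :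
  (forall i j, A t i j @[t --> FF] --> (A0 i j : R[i]^o)) ->
  (forall i j, B t i j @[t --> FF] --> (B0 i j : R[i]^o)) ->
  (forall i j, C t i j @[t --> FF] --> (C0 i j : R[i]^o)) ->
  (forall i j, D t i j @[t --> FF] --> (D0 i j : R[i]^o)) ->
  forall i j, block_mx (A t) (B t) (C t) (D t) i j @[t --> FF] -->
    (block_mx A0 B0 C0 D0 i j : R[i]^o).
Proof.
move=> hA hB hC hD i j.
case: (split_ordP i) => i' ->; case: (split_ordP j) => j' ->.
- by rewrite block_mxEul; under eq_fun do rewrite block_mxEul; exact: hA.
- by rewrite block_mxEur; under eq_fun do rewrite block_mxEur; exact: hB.
- by rewrite block_mxEdl; under eq_fun do rewrite block_mxEdl; exact: hC.
- by rewrite block_mxEdr; under eq_fun do rewrite block_mxEdr; exact: hD.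
Qed.

Section PolynomialIndex.
Variable R : realType.
Local Notation C := R[i].
Local Open Scope sesquilinear_scope.

(** The kernel of a polynomial is a Hankel form in the powers of the points. *)
Lemma divided_difference (d : nat) (c : nat -> C) (z w : C) :
  (forall k, (d < k)%N -> c k = 0) ->
  (z - w) * (\sum_(i < d) \sum_(j < d) c (i + j).+1 * z ^+ i * w ^+ j) =
  \sum_(k < d.+1) c k * z ^+ k - \sum_(k < d.+1) c k * w ^+ k.
Proof.
move=> c0; pose a i j := c (i + j)%N * z ^+ i * w ^+ j.
have aE : (z - w) * (\sum_(i < d) \sum_(j < d) c (i + j).+1 * z ^+ i * w ^+ j) =
   (\sum_(j < d) \sum_(i < d) a i.+1 j) - (\sum_(i < d) \sum_(j < d) a i j.+1).
  rewrite exchange_big [X in _ = _ - X]exchange_big mulr_sumr -sumrB /=.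
  apply: eq_bigr => j _; rewrite mulr_sumr -sumrB; apply: eq_bigr => i _.
  by rewrite /a addSn addnS !exprS; ring.
have b1 : \sum_(j < d) \sum_(i < d) a i.+1 j =
   (\sum_(j < d) \sum_(i < d) a i j) + a d 0%N * (0 < d)%N%:R
   - \sum_(j < d) a 0%N j.
  have -> : a d 0%N * (0 < d)%N%:R = \sum_(j < d) a d j.
    case: (d) c0 => [|d'] c0; first by rewrite big_ord0 mulr0.
    rewrite mulr1 big_ord_recl big1 ?addr0 // => j _.
    by rewrite /a c0 ?mul0r // addnS ltnS leq_addr.
  rewrite -big_split -sumrB; apply: eq_bigr => j _ /=.
  by rewrite -(big_ord_recr d (fun i => a i j)) big_ord_recl /= addrAC subrr add0r.
have b2 : \sum_(i < d) \sum_(j < d) a i j.+1 =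
   (\sum_(i < d) \sum_(j < d) a i j) + a 0%N d * (0 < d)%N%:R
   - \sum_(i < d) a i 0%N.
  have -> : a 0%N d * (0 < d)%N%:R = \sum_(i < d) a i d.
    case: (d) c0 => [|d'] c0; first by rewrite big_ord0 mulr0.
    rewrite mulr1 big_ord_recl big1 ?addr0 // => j _.
    by rewrite /a c0 ?mul0r // addnC addnS ltnS leq_addr.
  rewrite -big_split -sumrB; apply: eq_bigr => i _ /=.
  by rewrite -(big_ord_recr d (fun j => a i j)) big_ord_recl /= addrAC subrr add0r.
rewrite aE b1 b2 exchange_big /=.
have e1 : \sum_(k < d.+1) c k * z ^+ k = \sum_(i < d) a i 0%N + a d 0%N.
  rewrite big_ord_recr /=; congr (_ + _); last by rewrite /a addn0 expr0 mulr1.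
  by apply: eq_bigr => i _; rewrite /a addn0 expr0 mulr1.
have e2 : \sum_(k < d.+1) c k * w ^+ k = \sum_(j < d) a 0%N j + a 0%N d.
  rewrite big_ord_recr /=; congr (_ + _); last by rewrite /a add0n expr0 mulr1.
  by apply: eq_bigr => i _; rewrite /a add0n expr0 mulr1.
rewrite e1 e2; case: (d) => [|d']; last by rewrite !mulr1; ring.
by rewrite !mulr0 !big_ord0 /a; ring.
Qed.

Lemma negative_directions n (d : 'I_n -> R) :
  exists Sel : 'M[C]_(#|[set k | (d k < 0)%R]%SET|, n),
    Sel *m ddiag d *m Sel^t* = - 1%:M.
Proof.
set S := [set k | _]%SET.
pose e k : C := ((Num.sqrt (- d k))^-1)%:C%C.
have ec k : Num.conj (e k) = e k by exact: conj_realC.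
exists (\matrix_(r, k) (e k * (k == enum_val r)%:R)).
apply/matrixP => r r'; rewrite mxE (bigD1 (enum_val r)) //= big1 ?addr0; last first.
  by move=> k kr; rewrite mul_mx_diag !mxE (negPf kr) mulr0 !mul0r.
rewrite mul_mx_diag !mxE eqxx mulr1 (inj_eq enum_val_inj) rmorphM /= ec rmorph_nat.
rewrite mulrA -mulNrn; have [_|] := eqVneq r r'; last by rewrite mulr0 mulr0n.
rewrite mulr1 mulr1n; have dk : d (enum_val r) < 0.
  by have := enum_valP r; rewrite inE.
transitivity ((-1 : R)%:C%C); last by rewrite rmorphN1.
rewrite /e -!rmorphM; congr (_%:C)%C.
have s0 : 0 < - d (enum_val r) by rewrite oppr_gt0.
rewrite mulrAC -invfM -expr2 sqr_sqrtr ?ltW // invrN mulNr mulVf //.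
by rewrite lt_eqF.
Qed.

(** The Bezoutian matrix of [p], a Hankel matrix of its coefficients. *)
Definition bez D (p : {poly R}) : 'M[C]_D :=
  \matrix_(i, j) (p`_(i + j).+1)%:C%C.

Definition powmx n d (z : 'cV[C]_n) : 'M[C]_(n, d) := \matrix_(i, k) z i 0 ^+ k.

Lemma cpolyE D (p : {poly R}) z : (size p <= D.+1)%N ->
  cpoly p z = \sum_(k < D.+1) (p`_k)%:C%C * z ^+ k.
Proof.
move=> hp; rewrite /cpoly (@horner_coef_wide _ D.+1) ?size_map_poly //.
by apply: eq_bigr => k _; rewrite coef_map.
Qed.

Lemma cpoly_conj (p : {poly R}) z : cpoly p (Num.conj z) = Num.conj (cpoly p z).
Proof.
have hp := leqSpred (size p); rewrite !(cpolyE _ hp) rmorph_sum; apply: eq_bigr => k _.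
by rewrite rmorphM rmorphXn /= conj_realC.
Qed.

Lemma pickmx_cpoly D (p : {poly R}) n (z : 'cV[C]_n) (E : set C) :
  (size p <= D.+1)%N -> upper_in E z -> pickmx (cpoly p) z z =
  powmx D z *m bez D p *m (powmx D z)^t*.
Proof.
move=> hp zE; apply/matrixP => i j.
have zij := upper_conj_neq (zE i).1 (zE j).1.
have e : (powmx D z *m bez D p *m (powmx D z)^t*) i j =
  \sum_(k < D) \sum_(l < D)
     (p`_(k + l).+1)%:C%C * z i 0 ^+ k * Num.conj (z j 0) ^+ l.
  rewrite mxE [in RHS]exchange_big; apply: eq_bigr => l _; rewrite mxE mulr_suml.
  by apply: eq_bigr => k _; rewrite !mxE rmorphXn [_ ^+ k * _]mulrC.
rewrite e mxE /pick -cpoly_conj !(cpolyE _ hp) -(divided_difference (c := fun k => (p`_k)%:C%C)).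
  by rewrite mulrC mulKf.
by move=> k pk; rewrite nth_default // (leq_trans hp).
Qed.

Lemma bez_herm D (p : {poly R}) : (bez D p)^t* = bez D p.
Proof. by apply/matrixP => i j; rewrite !mxE conj_realC addnC. Qed.

(** The index of a polynomial plus a function that is small at infinity: points
    sent to infinity along the imaginary axis see the polynomial only, while
    points kept fixed can be corrected so as to see the other function only. *)
Lemma polynomial_index D (p : {poly R}) (L : 'M[C]_D) (d : 'I_D -> R) :
  (size p <= D.+1)%N -> L *m L^t* = 1%:M -> bez D p = L^t* *m ddiag d *m L ->
  forall h b, axis_cvg (fun z => h z / z) 0 ->
  negG (fun z => cpoly p z + h z) (b + #|[set k | (d k < 0)%R]%SET|) <-> negG h b.
Proof.
move=> hp LL bL h b h0; set S := [set k | _]%SET.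
split=> H E gE.
  have [n [z [U [zE HU]]]] := H E gE.
  have [x|q [W [hq HW]]] := @negdef_complement _ _ D (U *m powmx D z *m L^t*) d
      (U *m pickmx h z z *m U^t*).
    rewrite -ddiag_form.
    have -> : x *m (U *m powmx D z *m L^t*) *m ddiag d *m
        (x *m (U *m powmx D z *m L^t*))^t* =
        x *m (U *m pickmx (cpoly p) z z *m U^t*) *m x^t*.
      by rewrite (pickmx_cpoly hp zE) bL !trmxC_mul trmxCK !mulmxA.
    transitivity ((x *m (U *m pickmx h z z *m U^t*) *m x^t*
      + x *m (U *m pickmx (cpoly p) z z *m U^t*) *m x^t*) 0 0).
      by rewrite [RHS]mxE.
    rewrite addrC -mulmxDl -mulmxDr -mulmxDl -mulmxDr -pickmxD HU.
    by rewrite mulmxN mulmx1 mulNmx mxE.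
  rewrite addnK in hq; apply: (negE_le hq).
  apply: (negG_negdef zE (U := W *m U)) => x x0.
  have -> : W *m U *m pickmx h z z *m (W *m U)^t* =
     W *m (U *m pickmx h z z *m U^t*) *m W^t* by rewrite trmxC_mul !mulmxA.
  exact: HW.
have [n [z [U [zE HU]]]] := H E gE.
pose c (i : 'I_D) : R := i.+1%:R.
have c0 i : 0 < c i by rewrite ltr0n.
pose V0 : 'M[C]_D := \matrix_(i, k) (c i)%:C%C ^+ k.
have V0u : V0 \in unitmx.
  rewrite unitmxE unitfE.
  have -> : V0 = (Vandermonde D (\row_i (c i)%:C%C))^T.
    by apply/matrixP => i k; rewrite !mxE.
  rewrite det_tr det_Vandermonde; apply/prodf_neq0 => i _; apply/prodf_neq0 => j ij.
  rewrite !mxE subr_eq0 (inj_eq (@complexI R)) eqr_nat eqSS.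
  by rewrite neq_ltn ij orbT.
(* the points [i c_k y] and the weights [X y] for which [X y] inverts the
   matrix of powers, so that the polynomial part does not depend on [y] *)
pose w y : 'cV[C]_D := \col_i ((c i)%:C%C * (0 +i* y)%C).
pose T y : 'M[C]_D := diag_mx (\row_k (0 +i* y)%C^-1 ^+ k).
pose T0 : 'M[C]_D := diag_mx (\row_k (0 : C) ^+ k).
pose X y := T y *m invmx V0.
have XV y : 0 < y -> X y *m powmx D (w y) = 1%:M.
  move=> y0; have iy0 := iy_neq0 y0.
  have -> : powmx D (w y) = V0 *m diag_mx (\row_k (0 +i* y)%C ^+ k).
    by apply/matrixP => i k; rewrite mul_mx_diag !mxE exprMn.
  rewrite /X !mulmxA mulmxKV // mulmx_diag -diag_const_mx; congr diag_mx.
  by apply/rowP => k; rewrite !mxE -exprMn mulVf // expr1n.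
(* [Q] spans the negative directions of the form of [p] *)
have [Sel HSel] := negative_directions d; rewrite -/S in Sel HSel.
pose Q := Sel *m L.
have QbQ : Q *m bez D p *m Q^t* = - 1%:M.
  have -> : Q *m bez D p *m Q^t* = Sel *m (L *m bez D p *m L^t*) *m Sel^t*.
    by rewrite /Q trmxC_mul !mulmxA.
  have -> : L *m bez D p *m L^t* = ddiag d.
    by rewrite bL !mulmxA LL mul1mx -!mulmxA LL mulmx1.
  exact: HSel.
pose V y : 'M[C]_(b + #|S|, n + D) :=
  block_mx U (- (U *m powmx D z *m X y)) 0 (Q *m X y).
pose Vi : 'M[C]_(b + #|S|, n + D) :=
  block_mx U (- (U *m powmx D z *m (T0 *m invmx V0))) 0 (Q *m (T0 *m invmx V0)).
pose zw y := col_mx z (w y).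
have Xcv i j : X y i j @[y --> @gen_infty R] --> ((T0 *m invmx V0) i j : C^o).
  apply: mulmx_cvg => {}i {}j; last exact: cst_cvg.
  rewrite !mxE; under eq_fun do rewrite !mxE.
  case: eqVneq => _; last exact: cst_cvg.
  have /axisE H' := axisX i (@axis_inv R).
  by rewrite mulr1n; under eq_fun do rewrite mulr1n.
have mc k (Y : 'M[C]_(k, D)) i j : (Y *m X y) i j @[y --> @gen_infty R] -->
    ((Y *m (T0 *m invmx V0)) i j : C^o).
  by apply: mulmx_cvg => {}i {}j; [exact: cst_cvg|exact: Xcv].
have Vcv i j : V y i j @[y --> @gen_infty R] --> (Vi i j : C^o).
  apply: block_mx_cvg => {}i {}j.
  - exact: cst_cvg.
  - have -> : (fun y => (- (U *m powmx D z *m X y)) i j) =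
        (fun y => - ((U *m powmx D z *m X y) i j)) by apply/funext => y; rewrite mxE.
    have -> : (- (U *m powmx D z *m (T0 *m invmx V0))) i j =
      - ((U *m powmx D z *m (T0 *m invmx V0)) i j) by rewrite mxE.
    by apply: (@cvgN C C^o); exact: mc.
  - exact: cst_cvg.
  - exact: mc.
have hc (k : R) : 0 < k -> axis_cvg (fun z => h (k%:C%C * z) / z) 0.
  move=> k0; have kn : k%:C%C != 0 :> C by rewrite realC_eq0 gt_eqF.
  have := axisM (axis_cst k%:C%C) (axis_scale k0 h0); rewrite mulr0.
  by apply: axis_eq => t t0; field; rewrite kn t0.
have hcc (k : R) : 0 < k -> axis_cvg (fun z => Num.conj (h (k%:C%C * z)) / z) 0.
  move=> k0; have := axisN (axis_conj (hc k k0)); rewrite rmorph0 oppr0.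
  apply: axis_near; apply: filterE => y /=.
  by rewrite rmorphM fmorphV /= conj_iy invrN mulrN opprK.
have small (u v : C -> C) (k : C) : k != 0 -> axis_cvg (fun z => u z / z) 0 ->
    axis_cvg (fun z => v z / z) k -> axis_cvg (fun z => u z / v z) 0.
  move=> k0 hu hv; have := axisM hu (axisV k0 hv); rewrite mul0r.
  by apply: axis_eq => t t0; rewrite invfM invrK mulrACA mulVf // mulr1.
have inv0 (k : C) : axis_cvg (fun z => k / z) 0.
  by have := axisM (axis_cst k) (@axis_inv R); rewrite mulr0.
have cn (k : R) : 0 < k -> k%:C%C != 0 :> C.
  by move=> k0; rewrite realC_eq0 gt_eqF.
have wE y j : w y j 0 = (c j)%:C%C * (0 +i* y)%C by rewrite mxE.
have wcE y j : Num.conj (w y j 0) = - ((c j)%:C%C * (0 +i* y)%C).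
  by rewrite wE rmorphM /= conj_iy conj_realC mulrN.
have cz (k : C) : axis_cvg (fun z => k * z / z) k.
  by apply: axis_eq (axis_cst k) => t t0; rewrite mulfK.
have K12 (a : C) j : pick h a (w y j 0) @[y --> @gen_infty R] --> (0 : C^o).
  have Hl : axis_cvg (fun z => (h a - Num.conj (h ((c j)%:C%C * z))) /
      (a + (c j)%:C%C * z)) 0.
    apply: (small _ _ _ (cn _ (c0 j))).
      have := axisB (inv0 (h a)) (hcc _ (c0 j)); rewrite subr0.
      by apply: axis_eq => t t0; rewrite mulrBl.
    have := axisD (inv0 a) (cz (c j)%:C%C); rewrite add0r.
    by apply: axis_eq => t t0; rewrite mulrDl.
  have -> : (fun y => pick h a (w y j 0)) = (fun y => (h a -
      Num.conj (h ((c j)%:C%C * (0 +i* y)%C))) / (a + (c j)%:C%C * (0 +i* y)%C)).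
    by apply/funext => y; rewrite /pick wcE wE opprK.
  by case: Hl.
have K21 (a : C) j : pick h (w y j 0) a @[y --> @gen_infty R] --> (0 : C^o).
  have -> : (fun y => pick h (w y j 0) a) = (fun y => Num.conj (pick h a (w y j 0))).
    by apply/funext => y; rewrite pick_conj.
  rewrite -(rmorph0 (@Num.conj C)); apply: conj_cvg; exact: K12.
have K22 i j : pick h (w y i 0) (w y j 0) @[y --> @gen_infty R] --> (0 : C^o).
  have Hl : axis_cvg (fun z => (h ((c i)%:C%C * z) - Num.conj (h ((c j)%:C%C * z))) /
      ((c i)%:C%C * z + (c j)%:C%C * z)) 0.
    apply: (small _ _ ((c i + c j)%:C%C)); first by apply: cn; rewrite addr_gt0.
      have := axisB (hc _ (c0 i)) (hcc _ (c0 j)); rewrite subr0.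
      by apply: axis_eq => t t0; rewrite mulrBl.
    have := cz (c i + c j)%:C%C.
    by apply: axis_eq => t t0; rewrite rmorphD /= mulrDl.
  have -> : (fun y => pick h (w y i 0) (w y j 0)) =
      (fun y => (h ((c i)%:C%C * (0 +i* y)%C) - Num.conj (h ((c j)%:C%C * (0 +i* y)%C)))
       / ((c i)%:C%C * (0 +i* y)%C + (c j)%:C%C * (0 +i* y)%C)).
    by apply/funext => y; rewrite /pick wcE !wE opprK.
  by case: Hl.
have Kcv i j : pickmx h (zw y) (zw y) i j @[y --> @gen_infty R] -->
    ((block_mx (pickmx h z z) 0 0 0 : 'M[C]_(n + D)) i j : C^o).
  rewrite /zw; under eq_fun do rewrite pickmx_col.
  apply: block_mx_cvg => {}i {}j.
  - exact: cst_cvg.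
  - rewrite (_ : (fun y => _) = (fun y => pick h (z i 0) (w y j 0))); last first.
      by apply/funext => y; rewrite mxE.
    by have -> : (0 : 'M[C]_(n, D)) i j = 0 by [rewrite mxE]; exact: K12.
  - rewrite (_ : (fun y => _) = (fun y => pick h (w y i 0) (z j 0))); last first.
      by apply/funext => y; rewrite mxE.
    by have -> : (0 : 'M[C]_(D, n)) i j = 0 by [rewrite mxE]; exact: K21.
  - rewrite (_ : (fun y => _) = (fun y => pick h (w y i 0) (w y j 0))); last first.
      by apply/funext => y; rewrite mxE.
    by have -> : (0 : 'M[C]_(D, D)) i j = 0 by [rewrite mxE]; exact: K22.
have G r s : (V y *m pickmx h (zw y) (zw y) *m (V y)^t*) r s @[y --> @gen_infty R] -->
    ((Vi *m (block_mx (pickmx h z z) 0 0 0 : 'M[C]_(n + D)) *m Vi^t*) r s : C^o).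
  exact: (gram_cvg Vcv Kcv).
have lim : Vi *m block_mx (pickmx h z z) 0 0 0 *m Vi^t* =
    block_mx (- 1%:M) 0 0 0 :> 'M[C]_(b + #|S|).
  rewrite /Vi tr_block_mx map_block_mx !mulmx_block.
  by rewrite !(mulmx0, mul0mx, addr0, trmx0, map_mx0) HU.
have poly y : 0 < y -> upper_in E (zw y) ->
   V y *m pickmx (cpoly p) (zw y) (zw y) *m (V y)^t* =
   block_mx 0 0 0 (- 1%:M) :> 'M[C]_(b + #|S|).
  move=> y0 zwE; rewrite (pickmx_cpoly hp zwE).
  have VP : V y *m powmx D (zw y) = col_mx 0 Q.
    have -> : powmx D (zw y) = col_mx (powmx D z) (powmx D (w y)).
      apply/matrixP => i k; rewrite !mxE.
      by case: (fintype.split i) => i'; rewrite !mxE.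
    by rewrite /V mul_block_col mul0mx add0r mulNmx -!(mulmxA _ (X y)) XV // !mulmx1 subrr.
  have -> : V y *m (powmx D (zw y) *m bez D p *m (powmx D (zw y))^t*) *m (V y)^t* =
     (V y *m powmx D (zw y)) *m bez D p *m (V y *m powmx D (zw y))^t*.
    by rewrite trmxC_mul !mulmxA.
  rewrite VP tr_col_mx map_row_mx mul_col_mx mul_col_row trmx0 map_mx0.
  by rewrite !mul0mx !mulmx0 QbQ.
apply: negG_approx => eps eps0.
have zwE : gen_infty [set y | upper_in E (zw y)].
  by apply: filterS (axis_points D gE) => y; exact: upper_in_col.
have near1 : \forall y \near @gen_infty R, forall rs : 'I_(b + #|S|) * 'I_(b + #|S|),
   cabs ((V y *m pickmx h (zw y) (zw y) *m (V y)^t*) rs.1 rs.2 -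
     (block_mx (- 1%:M) 0 0 0 : 'M[C]_(b + #|S|)) rs.1 rs.2) < eps.
  apply: filter_forall => -[r s]; have /cvgC/(_ eps eps0) := G r s.
  by rewrite lim.
have [y [[h1 h2] y0]] := filter_ex (filterI (filterI zwE near1) (gen_infty_gt 0)).
exists (n + D)%N, (zw y), (V y); split=> // r s.
have := h2 (r, s); rewrite /= pickmxD mulmxDr mulmxDl (poly y y0 h1).
set A := V y *m pickmx h (zw y) (zw y) *m (V y)^t*.
have -> : (block_mx 0 0 0 (- 1%:M) + A) r s + (r == s)%:R =
    A r s - (block_mx (- 1%:M) 0 0 0 : 'M[C]_(b + #|S|)) r s; last by [].
have -> : (r == s)%:R = (1%:M : 'M[C]_(b + #|S|)) r s by rewrite mxE.
have -> : (1%:M : 'M[C]_(b + #|S|)) = - block_mx (- 1%:M) 0 0 0 - block_mx 0 0 0 (- 1%:M).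
  by rewrite -opprD add_block_mx !(addr0, add0r) scalar_mx_block opp_block_mx !(oppr0, opprK).
rewrite [LHS]addrC; move: (block_mx _ _ _ _) (block_mx _ _ _ _) => B1 B2.
by rewrite !mxE; ring.
Qed.

(** The two indices are the numbers of negative and of positive eigenvalues of
    the Bezoutian. *)
Lemma polynomial_indices D (p : {poly R}) : (size p <= D.+1)%N ->
  exists a a' : nat, [/\ (a + a' <= D)%N,
    forall h b, axis_cvg (fun z => h z / z) 0 ->
      negG (fun z => cpoly p z + h z) (b + a) <-> negG h b &
    forall h b, axis_cvg (fun z => h z / z) 0 ->
      negG (fun z => cpoly (- p) z + h z) (b + a') <-> negG h b].
Proof.
move=> hp; have [L [d [LL bL]]] := herm_diag (bez_herm D p).
exists #|[set k | (d k < 0)%R]%SET|, #|[set k | (- d k < 0)%R]%SET|; split.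
- rewrite -cardsUI [X in (_ + X)%N](_ : _ = 0%N) ?addn0.
    by rewrite -[X in (_ <= X)%N]card_ord max_card.
  apply/eqP; rewrite cards_eq0; apply/eqP/setP => k; rewrite !inE oppr_lt0.
  by case: ltgtP.
- by move=> h b h0; exact: (polynomial_index hp LL bL).
- have hp' : (size (- p) <= D.+1)%N by rewrite size_polyN.
  have bL' : bez D (- p) = L^t* *m ddiag (fun k => - d k) *m L.
    have -> : bez D (- p) = - bez D p.
      by apply/matrixP => i j; rewrite !mxE coefN rmorphN.
    have -> : ddiag (fun k => - d k) = - ddiag d.
      apply/matrixP => i j; rewrite !mxE rmorphN /=.
      by case: eqVneq => _; rewrite ?mulr0n ?oppr0.
    by rewrite bL mulmxN mulNmx.
  by move=> h b h0; exact: (polynomial_index hp' LL bL').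
Qed.

End PolynomialIndex.

(** * Asymptotic expansions and one Schur step *)

Section Expansions.
Variable R : realType.
Local Notation C := R[i].
Implicit Types (F G f : C -> C) (p q : {poly R}) (z : C).

Lemma cpolyD p q z : cpoly (p + q) z = cpoly p z + cpoly q z.
Proof. by rewrite /cpoly rmorphD hornerD. Qed.

Lemma cpolyN p z : cpoly (- p) z = - cpoly p z.
Proof. by rewrite /cpoly rmorphN hornerN. Qed.

Lemma cpolyB p q z : cpoly (p - q) z = cpoly p z - cpoly q z.
Proof. by rewrite cpolyD cpolyN. Qed.

Lemma cpolyM p q z : cpoly (p * q) z = cpoly p z * cpoly q z.
Proof. by rewrite /cpoly rmorphM hornerM. Qed.

Lemma cpolyC (c : R) z : cpoly c%:P z = c%:C%C.
Proof. by rewrite /cpoly map_polyC hornerC. Qed.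

Lemma cpolyX z : cpoly 'X z = z.
Proof. by rewrite /cpoly map_polyX hornerX. Qed.

Lemma cpolyXn n z : cpoly 'X^n z = z ^+ n.
Proof. by rewrite /cpoly map_polyXn hornerXn. Qed.

Lemma cpoly1 z : cpoly 1 z = 1.
Proof. by rewrite -[1]polyC1 cpolyC. Qed.

Lemma cpolyZ (c : R) p z : cpoly (c *: p) z = c%:C%C * cpoly p z.
Proof. by rewrite -mul_polyC cpolyM cpolyC. Qed.

Lemma cpoly0 z : cpoly 0 z = 0.
Proof. by rewrite -[0]polyC0 cpolyC. Qed.

Lemma axis_cpoly p : axis_cvg (fun z => cpoly p z^-1) (p`_0)%:C%C.
Proof.
elim/poly_ind: p => [|p c IH].
  rewrite coef0; apply: axis_eq (axis_cst _) => z _; by rewrite cpoly0.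
rewrite coefD coefMX coefC /= add0r.
have := axisD (axisM IH (@axis_inv R)) (axis_cst c%:C%C); rewrite mulr0 add0r.
by apply: axis_eq => z _; rewrite cpolyD cpolyM cpolyX cpolyC.
Qed.

(** The expansion [F = p(1/z) + o(1/z^k)] on the imaginary axis. *)
Definition happrox k F p := axis_cvg (fun z => z ^+ k * (F z - cpoly p z^-1)) 0.

Lemma happrox_lim k F p : happrox k F p -> axis_cvg F (p`_0)%:C%C.
Proof.
move=> h; have := axisD (axisM (axisX k (@axis_inv R)) h) (axis_cpoly p).
rewrite mulr0 add0r; apply: axis_eq => z z0.
by rewrite mulrA -exprMn mulVf // expr1n mul1r subrK.
Qed.

Lemma happroxW k k' F p : (k' <= k)%N -> happrox k F p -> happrox k' F p.
Proof.
move=> kk h; have := axisM (axisX (k - k') (@axis_inv R)) h.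
rewrite mulr0; apply: axis_eq => z z0.
by rewrite mulrA -{2}(subnKC kk) exprD mulrCA -exprMn mulVf // expr1n mulr1.
Qed.

Lemma happrox_eq k F G p : (forall z, z != 0 -> F z = G z) -> happrox k F p ->
  happrox k G p.
Proof. by move=> FG; apply: axis_eq => z z0; rewrite FG. Qed.

Lemma happrox_generic k F G p : generic [set z | F z = G z] -> happrox k F p ->
  happrox k G p.
Proof. by move=> FG; apply: axis_generic; apply: genericS FG => z /= ->. Qed.

Lemma happrox_cpoly k p : happrox k (fun z => cpoly p z^-1) p.
Proof. by apply: axis_eq (axis_cst 0) => z _; rewrite subrr mulr0. Qed.

Lemma happroxD k F G p q : happrox k F p -> happrox k G q ->
  happrox k (fun z => F z + G z) (p + q).
Proof.
move=> hF hG; have := axisD hF hG; rewrite addr0; apply: axis_eq => z _.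
by rewrite -mulrDr cpolyD; congr (_ * _); ring.
Qed.

Lemma happroxN k F p : happrox k F p -> happrox k (fun z => - F z) (- p).
Proof.
move=> hF; have := axisN hF; rewrite oppr0; apply: axis_eq => z _.
by rewrite -mulrN cpolyN; congr (_ * _); ring.
Qed.

Lemma happroxB k F G p q : happrox k F p -> happrox k G q ->
  happrox k (fun z => F z - G z) (p - q).
Proof. by move=> hF hG; exact: happroxD hF (happroxN hG). Qed.

Lemma happrox_shift k v F p : happrox (k + v) F ('X^v * p) <->
  happrox k (fun z => z ^+ v * F z) p.
Proof.
have E z : z != 0 -> z ^+ (k + v) * (F z - cpoly ('X^v * p) z^-1) =
    z ^+ k * (z ^+ v * F z - cpoly p z^-1).
  move=> z0; rewrite cpolyM cpolyXn exprD -mulrA mulrBr; congr (_ * (_ - _)).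
  by rewrite mulrA -exprMn divff // expr1n mul1r.
by split; apply: axis_eq => z z0; rewrite E.
Qed.

(** If [p q - 1] is a multiple of [X^(k+1)], then [1/F - q(1/z)] is, up to
    terms that are small enough, the error of the expansion of [F] times a
    bounded function. *)
Lemma happrox_inv k F p q r : happrox k F p -> p`_0 != 0 ->
  p * q = 1 + 'X^(k.+1) * r -> happrox k (fun z => (F z)^-1) q.
Proof.
move=> hF p0 pq; have p0c : (p`_0)%:C%C != 0 :> C.
  by rewrite realC_eq0.
have Fl := happrox_lim hF.
have H : axis_cvg (fun z => (- (z^-1 * cpoly r z^-1)
    - cpoly q z^-1 * (z ^+ k * (F z - cpoly p z^-1))) * (F z)^-1) 0.
  have := axisM (axisB (axisN (axisM (@axis_inv R) (axis_cpoly r)))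
    (axisM (axis_cpoly q) hF)) (axisV p0c Fl).
  by rewrite mul0r oppr0 mulr0 subr0 mul0r.
apply: (axis_near _ H); apply: filterS2 (axis_neq0 p0c Fl) (gen_infty_gt 0) => y /=.
set z := (0 +i* y)%C => Fz y0.
have z0 : z != 0 by exact: iy_neq0.
have E : cpoly p z^-1 * cpoly q z^-1 = 1 + z^-1 ^+ k.+1 * cpoly r z^-1.
  by rewrite -cpolyM pq cpolyD cpoly1 cpolyM cpolyXn.
have -> : z^-1 * cpoly r z^-1 = z ^+ k * (cpoly p z^-1 * cpoly q z^-1 - 1).
  rewrite E addrC addKr mulrA exprS mulrCA -exprMn divff // expr1n mulr1 //.
move: (cpoly p z^-1) (cpoly q z^-1) (z ^+ k) => P Q Z.
by field.
Qed.

(** The data of one step of the recursion, as truncated power series in [1/z]: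
    [M] and [Fs] give the two parts of the expansion of [-1/f]. *)
Definition step_data v d (m : {poly R}) (l : R) (U M Fs S' : {poly R}) :=
  [/\ forall z : C, z != 0 -> z * cpoly m z = z ^+ v * cpoly M z^-1,
      exists r : {poly R}, (M - 'X^v * Fs) * U = 1 + 'X^((d + v).+1) * r,
      exists r : {poly R}, (l%:P - 'X * S') * Fs = 1 + 'X^(d.+1) * r & (0 < v)%N].

Lemma step_data_neq0 v d m l U M Fs S' : step_data v d m l U M Fs S' ->
  [/\ U`_0 != 0, Fs`_0 != 0, l != 0 & M`_0 != 0].
Proof.
move=> [_ [r E1] [r' E2] v0].
have /(congr1 (fun p : {poly R} => p`_0)) := E1.
have /(congr1 (fun p : {poly R} => p`_0)) := E2.
rewrite !coefD !coef0M !coefB !coef0M !coefXn coefX coefC coef1 !mul0r subr0 addr0 /=.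
have -> : (0 == v)%N = false by case: v v0 {E1}.
rewrite !mul0r subr0 => e2 e1.
have [? ?] : l != 0 /\ Fs`_0 != 0.
  by apply/andP; rewrite -negb_or -mulf_eq0 e2 oner_eq0.
have [? ?] : M`_0 != 0 /\ U`_0 != 0.
  by apply/andP; rewrite -negb_or -mulf_eq0 e1 oner_eq0.
by split.
Qed.

(** The Schur step [f |-> F], where [1/f = 1/(l + F) - z m]. *)
Definition step_up m l f : C -> C :=
  fun z => ((f z)^-1 + z * cpoly m z)^-1 - l%:C%C.

Definition step_down m l g : C -> C :=
  fun z => ((l%:C%C + g z)^-1 - z * cpoly m z)^-1.

Section Step.
Variables (v d : nat) (m : {poly R}) (l : R) (U M Fs S' : {poly R}).
Hypothesis sd : step_data v d m l U M Fs S'.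

Lemma step_up_aux f : happrox (d + v + v) f ('X^v * (- U)) ->
  happrox d (fun z => (f z)^-1 + z * cpoly m z) Fs.
Proof.
have [U0 Fs0 l0 M0] := step_data_neq0 sd; case: sd => mM [r E1] [r' E2] v0.
move=> /happrox_shift/happroxN; rewrite opprK => hV.
have hVi := happrox_inv hV U0 (etrans (mulrC _ _) E1).
have := happroxB (happrox_cpoly (d + v) M) hVi.
rewrite opprB addrCA subrr addr0 => /happrox_shift.
apply: happrox_eq => z z0; rewrite mM // invrN invfM mulrBr mulrN opprK addrC.
by rewrite mulrA divff ?expf_neq0 // mul1r.
Qed.

Lemma step_up_approx f : happrox (d + v + v) f ('X^v * (- U)) ->
  happrox d (step_up m l f) ('X * (- S')).
Proof.
have [U0 Fs0 l0 M0] := step_data_neq0 sd.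
move=> /step_up_aux hk; case: sd => mM [r E1] [r' E2] v0.
have hki := happrox_inv hk Fs0 (etrans (mulrC _ _) E2).
have := happroxB hki (happrox_cpoly d l%:P).
rewrite addrAC subrr add0r -mulrN; apply: happrox_eq => z _.
by rewrite /step_up cpolyC.
Qed.

Lemma step_down_aux g : happrox d g ('X * (- S')) ->
  happrox (d + v) (fun z => cpoly M z^-1 - (z^-1) ^+ v * (l%:C%C + g z)^-1)
    (M - 'X^v * Fs).
Proof.
have [U0 Fs0 l0 M0] := step_data_neq0 sd; case: sd => mM [r E1] [r' E2] v0.
move=> hg; have := happroxD (happrox_cpoly d l%:P) hg; rewrite mulrN => hlg.
have l00 : (l%:P - 'X * S')`_0 != 0.
  by rewrite coefB coefC /= coef0M coefX mul0r subr0.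
have hi := happrox_inv hlg l00 E2.
apply: happroxB; first exact: happrox_cpoly.
apply/happrox_shift; apply: happrox_eq hi => z z0.
by rewrite cpolyC mulrA -exprMn divff // expr1n mul1r.
Qed.

Lemma step_down_approx g : happrox d g ('X * (- S')) ->
  happrox (d + v + v) (step_down m l g) ('X^v * (- U)).
Proof.
have [U0 Fs0 l0 M0] := step_data_neq0 sd.
move=> /step_down_aux hK; case: sd => mM [r E1] [r' E2] v0.
have K0 : (M - 'X^v * Fs)`_0 != 0.
  rewrite coefB coef0M coefXn; have -> : (0 == v)%N = false by case: (v) v0.
  by rewrite mul0r subr0.
have := happroxN (happrox_inv hK K0 E1).
move=> h; apply/happrox_shift; apply: happrox_eq h => z z0.
have zv : z ^+ v != 0 by rewrite expf_neq0.
rewrite /step_down mM //.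
have -> : (l%:C%C + g z)^-1 - z ^+ v * cpoly M z^-1 =
    - (z ^+ v * (cpoly M z^-1 - z^-1 ^+ v * (l%:C%C + g z)^-1)).
  by rewrite exprVn mulrBr mulrA divff // mul1r opprB.
by rewrite invrN invfM mulrN mulrA divff // mul1r.
Qed.

Lemma step_up_neq0 f : happrox (d + v + v) f ('X^v * (- U)) ->
  gen_infty [set y | f (0 +i* y)%C != 0] /\
  gen_infty [set y | (f (0 +i* y)%C)^-1 + (0 +i* y)%C * cpoly m (0 +i* y)%C != 0].
Proof.
have [U0 Fs0 l0 M0] := step_data_neq0 sd.
have ne (c : R) : c != 0 -> c%:C%C != 0 :> C by rewrite realC_eq0.
move=> hf; split.
  move: hf => /happrox_shift/happrox_lim; rewrite coefN.
  have /ne n0 : - U`_0 != 0 by rewrite oppr_eq0.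
  move=> /(axis_neq0 n0); apply: filterS => y /=.
  by apply: contraNneq => ->; rewrite mulr0.
by have /happrox_lim/(axis_neq0 (ne _ Fs0)) := step_up_aux hf.
Qed.

Lemma step_down_neq0 g : happrox d g ('X * (- S')) ->
  gen_infty [set y | l%:C%C + g (0 +i* y)%C != 0] /\
  gen_infty [set y | (l%:C%C + g (0 +i* y)%C)^-1
                     - (0 +i* y)%C * cpoly m (0 +i* y)%C != 0].
Proof.
have [U0 Fs0 l0 M0] := step_data_neq0 sd.
have ne (c : R) : c != 0 -> c%:C%C != 0 :> C by rewrite realC_eq0.
move=> hg; split.
  have /happrox_lim := hg; rewrite coef0M coefX mul0r => h.
  by have := axisD (axis_cst l%:C%C) h; rewrite addr0 => /(axis_neq0 (ne _ l0)).
have [mM _ _ v0] := sd.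
have /happrox_lim := step_down_aux hg.
rewrite coefB coef0M coefXn; have -> : (0 == v)%N = false by case: (v) v0.
rewrite mul0r subr0 => /(axis_neq0 (ne _ M0)) H.
apply: filterS2 H (gen_infty_gt 0) => y /=; set z := (0 +i* y)%C => + y0.
have z0 : z != 0 by exact: iy_neq0.
rewrite mM //; apply: contraNneq => H.
have zv : z ^+ v != 0 by rewrite expf_neq0.
apply/eqP/(mulfI zv); rewrite mulr0 mulrBr exprVn mulrA divff // mul1r.
by rewrite -opprB H oppr0.
Qed.

End Step.

End Expansions.

(** * The change of indices in one step *)

Section IndexStep.
Variable R : realType.
Local Notation C := R[i].
Local Open Scope sesquilinear_scope.
Implicit Types (F G f h : C -> C) (p q m : {poly R}) (z : C).

Lemma negG_opp_invE F b : generic [set z | F z != 0] ->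
  negG (fun z => - (F z)^-1) b <-> negG F b.
Proof.
move=> F0; split; last exact: negG_opp_inv.
have F0' : generic [set z | - (F z)^-1 != 0].
  by apply: genericS F0 => z /= ?; rewrite oppr_eq0 invr_eq0.
move=> /(negG_opp_inv F0'); apply: negG_ext; apply: genericT => z /=.
by rewrite invrN invrK opprK.
Qed.

Lemma negG_eq F G b : generic [set z | F z = G z] -> negG F b <-> negG G b.
Proof.
move=> FG; split; apply: negG_ext => //.
by apply: genericS FG => z /= ->.
Qed.

Lemma negG_addreal F (l : R) b : negG (fun z => l%:C%C + F z) b <-> negG F b.
Proof.
have E z w : pick (fun z => l%:C%C + F z) z w = pick F z w.
  by rewrite /pick rmorphD /= conj_realC; congr (_ / _); ring.
have EM n (z : 'cV_n) : pickmx (fun z => l%:C%C + F z) z z = pickmx F z z.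
  by apply/matrixP => i j; rewrite !mxE E.
split=> H S gS; have [n [z [U [zE HU]]]] := H S gS; exists n, z, U.
  by rewrite -EM.
by rewrite EM.
Qed.

(** [- 1/F] is the sum of a real polynomial and of the small function [- 1/G]. *)
Lemma negG_mobius F G p (a : nat) : generic [set z | F z != 0] ->
  generic [set z | G z != 0] ->
  generic [set z | - (F z)^-1 = cpoly p z - (G z)^-1] ->
  axis_cvg (fun z => (G z)^-1 / z) 0 ->
  (forall h b, axis_cvg (fun z => h z / z) 0 ->
     negG (fun z => cpoly p z + h z) (b + a) <-> negG h b) ->
  forall b, negG F (b + a) <-> negG G b.
Proof.
move=> F0 G0 FG Gz Hp b.
rewrite -(negG_opp_invE _ F0) (negG_eq _ FG) -(negG_opp_invE _ G0).
by apply: Hp; have := axisN Gz; rewrite oppr0; apply: axis_eq => z _; rewrite mulNr.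
Qed.

(** The relation between two consecutive functions of a chain, up to a
    discrete set. *)
Definition link m (l : R) F G := generic [set z | [/\ F z != 0,
  l%:C%C + G z != 0 & (F z)^-1 + z * cpoly m z = (l%:C%C + G z)^-1]].

Lemma generic_neq0 : generic [set z : C | z != 0].
Proof.
move=> z0 hz; apply: near_dnbhs; apply: filterS (near_Im_neq0 hz) => z /=.
by apply: contraNneq => ->.
Qed.

(** The increments of the index for [F], [- F], [z F] and [- z F].  For [F]
    the polynomial is [z m], of degree [v]; for [z F] there are two, [m] and
    [l z], of degrees [v - 1] and [1]. *)
Lemma link_indices v m (l : R) : (size m <= v)%N -> (0 < v)%N -> l != 0 ->
  exists a a' c c' : nat, [/\ (a + a' <= v)%N, (c + c' <= v)%N &
   forall F G, link m l F G -> axis_cvg G 0 -> forall b,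
     [/\ negG F (b + a) <-> negG G b,
         negG (fun z => - F z) (b + a') <-> negG (fun z => - G z) b,
         negG (fun z => z * F z) (b + c) <-> negG (fun z => z * G z) b &
         negG (fun z => - (z * F z)) (b + c') <-> negG (fun z => - (z * G z)) b]].
Proof.
move=> mv v0 l0.
have hX : (size ('X * m)%R <= v.+1)%N.
  by rewrite (leq_trans (size_polyMleq _ _)) // size_polyX.
have hm : (size m <= v.-1.+1)%N by rewrite prednK.
have hl : (size (l *: 'X)%R <= 2)%N by rewrite (leq_trans (size_scale_leq _ _)) // size_polyX.
have [a [a' [aa Ha Ha']]] := polynomial_indices hX.
have [c [c' [cc Hc Hc']]] := polynomial_indices hm.
have [e [e' [ee He He']]] := polynomial_indices hl.
exists a, a', (e + c)%N, (e' + c')%N; split=> //.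
  rewrite addnACA -(prednK v0) -add1n; exact: leq_add.
move=> F G lk G0 b.
have lc0 : l%:C%C != 0 :> C by rewrite realC_eq0.
have Gl : axis_cvg (fun z => l%:C%C + G z) l%:C%C.
  by have := axisD (axis_cst l%:C%C) G0; rewrite addr0.
have Gi : axis_cvg (fun z => (l%:C%C + G z)^-1 / z) 0.
  by have := axisM (axisV lc0 Gl) (@axis_inv R); rewrite mulr0.
have Gi2 : axis_cvg (fun z => (z * (l%:C%C + G z))^-1 / z) 0.
  have := axisM (@axis_inv R) Gi; rewrite mul0r; apply: axis_eq => z z0.
  by rewrite invfM mulrA.
have gF : generic [set z | F z != 0] by apply: genericS lk => z [].
have gG : generic [set z | l%:C%C + G z != 0] by apply: genericS lk => z [].
have gz := generic_neq0.
have gE : generic [set z | - (F z)^-1 = cpoly ('X * m) z - (l%:C%C + G z)^-1].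
  apply: genericS lk => z /= [_ _ <-]; rewrite cpolyM cpolyX; ring.
have zF : generic [set z | z * F z != 0].
  by apply: genericS (generic_and gz gF) => z /= [z0 Fz]; rewrite mulf_neq0.
have zG : generic [set z | z * (l%:C%C + G z) != 0].
  by apply: genericS (generic_and gz gG) => z /= [z0 Fz]; rewrite mulf_neq0.
have gE2 : generic [set z | - (z * F z)^-1 = cpoly m z - (z * (l%:C%C + G z))^-1].
  apply: genericS (generic_and gz lk) => z /= [z0 [Fz Gz E]].
  have {}E : cpoly m z = ((l%:C%C + G z)^-1 - (F z)^-1) / z.
    by rewrite -E addrC addKr mulrC mulKf.
  by rewrite E !invfM; ring.
have oppN (H : C -> C) : generic [set z | H z != 0] -> generic [set z | - H z != 0].
  by move=> gH; apply: genericS gH => z /=; rewrite oppr_eq0.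
have oppE (A B : C -> C) p : generic [set z | - (A z)^-1 = cpoly p z - (B z)^-1] ->
   generic [set z | - (- A z)^-1 = cpoly (- p) z - (- B z)^-1].
  move=> g; apply: genericS g => z /= E.
  by rewrite !invrN cpolyN !opprK -[LHS]opprK E opprB addrC.
have oppI (B : C -> C) : axis_cvg (fun z => (B z)^-1 / z) 0 ->
   axis_cvg (fun z => (- B z)^-1 / z) 0.
  move=> /axisN; rewrite oppr0; apply: axis_eq => z _; by rewrite invrN mulNr.
have lin : generic [set z | z * (l%:C%C + G z) = cpoly (l *: 'X) z + z * G z].
  by apply: genericT => z /=; rewrite cpolyZ cpolyX mulrDr [z * _]mulrC.
have zGz : axis_cvg (fun z => z * G z / z) 0.
  by apply: axis_eq G0 => z z0; rewrite mulrC mulKf.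
split.
- by rewrite (negG_mobius gF gG gE Gi Ha) negG_addreal.
- rewrite (negG_mobius (oppN _ gF) (oppN _ gG) (oppE _ _ _ gE) (oppI _ Gi) Ha').
  rewrite -(negG_addreal (fun z => - G z) (- l)); apply: negG_eq.
  by apply: genericT => z /=; rewrite opprD rmorphN.
- rewrite addnA (negG_mobius zF zG gE2 Gi2 Hc) (negG_eq _ lin).
  exact: He.
- rewrite addnA (negG_mobius (oppN _ zF) (oppN _ zG) (oppE _ _ _ gE2) (oppI _ Gi2) Hc').
  rewrite -(He' (fun z => - (z * G z))); last first.
    by have := axisN zGz; rewrite oppr0; apply: axis_eq => z _; rewrite mulNr.
  apply: negG_eq; apply: genericS lin => z /= ->; by rewrite cpolyN opprD.
Qed.

Lemma chain_indices N (v : nat -> nat) (m : nat -> {poly R}) (l : nat -> R) :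
  (forall j, (1 <= j <= N)%N -> [/\ (size (m j) <= v j)%N, (0 < v j)%N & l j != 0]) ->
  exists a a' c c' : nat, [/\ (a + a' <= \sum_(1 <= j < N.+1) v j)%N,
   (c + c' <= \sum_(1 <= j < N.+1) v j)%N &
   forall F : nat -> C -> C, (forall j, (1 <= j <= N)%N ->
       link (m j) (l j) (F j.-1) (F j) /\ axis_cvg (F j) 0) ->
   forall b, [/\ negG (F 0%N) (b + a) <-> negG (F N) b,
     negG (fun z => - F 0%N z) (b + a') <-> negG (fun z => - F N z) b,
     negG (fun z => z * F 0%N z) (b + c) <-> negG (fun z => z * F N z) b &
     negG (fun z => - (z * F 0%N z)) (b + c') <-> negG (fun z => - (z * F N z)) b]].
Proof.
elim: N => [|N IH] H.
  by exists 0%N, 0%N, 0%N, 0%N; rewrite big_geq //; split=> // F _ b; rewrite addn0.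
have [|a [a' [c [c' [aa cc HN]]]]] := IH.
  by move=> j /andP[j1 jN]; apply: H; rewrite j1 ltnW.
have [|s1 s2 s3] := H N.+1; first by rewrite !leqnn.
have [a1 [a1' [c1 [c1' [aa1 cc1 H1]]]]] := link_indices s1 s2 s3.
exists (a1 + a)%N, (a1' + a')%N, (c1 + c)%N, (c1' + c')%N.
rewrite big_nat_recr //=; split.
- by rewrite addnACA addnC leq_add.
- by rewrite addnACA addnC leq_add.
move=> F HF b; have [|lk F0] := HF N.+1; first by rewrite !leqnn.
have [|h1 h2 h3 h4] := HN F _ (b + a1)%N.
  by move=> j /andP[j1 jN]; apply: HF; rewrite j1 ltnW.
have [|k1 k2 k3 k4] := HN F _ (b + a1')%N.
  by move=> j /andP[j1 jN]; apply: HF; rewrite j1 ltnW.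
have [|e1 e2 e3 e4] := HN F _ (b + c1)%N.
  by move=> j /andP[j1 jN]; apply: HF; rewrite j1 ltnW.
have [|d1 d2 d3 d4] := HN F _ (b + c1')%N.
  by move=> j /andP[j1 jN]; apply: HF; rewrite j1 ltnW.
have [f1 f2 f3 f4] := H1 _ _ lk F0 b; rewrite /= in f1 f2 f3 f4.
rewrite !addnA; split.
- exact: iff_trans h1 f1.
- exact: iff_trans k2 f2.
- exact: iff_trans e3 f3.
- exact: iff_trans d4 f4.
Qed.

Lemma negG_zero b : negG (fun=> 0 : C) b -> b = 0%N.
Proof.
move=> H; have [n [z [U [_ HU]]]] := H setT (genericT (fun=> I)).
have K0 : pickmx (fun=> 0 : C) z z = 0.
  by apply/matrixP => i j; rewrite !mxE /pick rmorph0 subrr mul0r.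
move: HU; rewrite K0 mulmx0 mul0mx; case: b U {H} => // b U /matrixP/(_ 0 0).
by rewrite !mxE eqxx => /eqP; rewrite eq_sym oppr_eq0 oner_eq0.
Qed.

End IndexStep.

(** * Hankel matrices bound the index from below *)

Section NuMinus.
Variable R : realType.
Local Notation C := R[i].
Local Open Scope sesquilinear_scope.

Lemma char_poly_unitary n (A : 'M[C]_n) (L : 'M[C]_n) (d : 'I_n -> R) :
  L *m L^t* = 1%:M -> A = L^t* *m ddiag d *m L ->
  char_poly A = \prod_(i < n) ('X - ((d i)%:C%C)%:P).
Proof.
move=> LL ->; have LL' : L^t* *m L = 1%:M by apply: mulmx1C.
have -> : char_poly (L^t* *m ddiag d *m L) = char_poly (ddiag d).
  rewrite /char_poly.
  have -> : char_poly_mx (L^t* *m ddiag d *m L) =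
     map_mx polyC (L^t*) *m char_poly_mx (ddiag d) *m map_mx polyC L.
    rewrite /char_poly_mx !map_mxM mulmxBr mulmxBl; congr (_ - _).
    by rewrite scalar_mxC -mulmxA -map_mxM LL' map_mx1 mulmx1.
  by rewrite !det_mulmx mulrAC -det_mulmx -map_mxM LL' map_mx1 det1 mul1r.
rewrite char_poly_trig; last by apply: diag_mx_is_trig.
by apply: eq_bigr => i _; rewrite !mxE eqxx mulr1n.
Qed.

(** The spectral theorem turns roots of the characteristic polynomial into
    diagonal entries. *)
Lemma nu_minus_diag n (S : 'M[R]_n) (L : 'M[C]_n) (d : 'I_n -> R) :
  L *m L^t* = 1%:M -> map_mx (real_complex R) S = L^t* *m ddiag d *m L ->
  nu_minus S = #|[set i | (d i < 0)%R]%SET|.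
Proof.
move=> LL SE.
have cE : char_poly S = \prod_(x <- [seq d i | i <- enum 'I_n]) ('X - x%:P).
  apply: (map_poly_inj (real_complex R)); rewrite map_char_poly.
  rewrite (char_poly_unitary LL SE) big_map big_enum /= rmorph_prod.
  by apply: eq_bigr => i _; rewrite rmorphB /= map_polyX map_polyC.
have c0 : char_poly S != 0 by rewrite -size_poly_eq0 size_char_poly.
rewrite /nu_minus cE; set s := [seq d i | i <- _]; rewrite cE in c0.
set p := \prod_(x <- _) _ in c0 *.
have rE : rootsR p =i s.
  move=> x; have := roots_on_rootsR c0 x; rewrite inE /= => <-.
  by rewrite root_prod_XsubC.
rewrite (eq_bigr (fun a => count_mem a s)) => [|a _]; last by rewrite mu_prod_XsubC.
have ur : uniq (rootsR p) by exact: uniq_roots.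
have -> : #|[set i | (d i < 0)%R]%SET| = count (fun x => x < 0) s.
  rewrite -sum1_card -sum1_count big_map big_enum_cond /=.
  by apply: eq_bigl => i; rewrite inE.
rewrite (eq_bigr (fun a => \sum_(x <- s) if x == a then 1 else 0)%N) => [|a _].
  rewrite exchange_big /= -sum1_count [RHS]big_mkcond [LHS]big_seq [RHS]big_seq.
  apply: eq_bigr => x xs; rewrite -big_mkcondr /= -big_filter_cond.
  rewrite (eq_bigl (pred1 x)) => [|a]; last by rewrite /= eq_sym.
  rewrite sum1_count count_uniq_mem ?filter_uniq // mem_filter rE xs andbT.
  by case: (x < 0).
by rewrite -big_mkcond sum1_count.
Qed.

Lemma symmetric_diag n (S : 'M[R]_n) : S^T = S ->
  exists (L : 'M[C]_n) (d : 'I_n -> R), L *m L^t* = 1%:M /\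
    map_mx (real_complex R) S = L^t* *m ddiag d *m L.
Proof.
move=> ST; apply: herm_diag; apply/matrixP => i j.
by rewrite !mxE conj_realC -{1}ST mxE.
Qed.

Lemma nonsingular_signs n (S : 'M[R]_n) (L : 'M[C]_n) (d : 'I_n -> R) :
  map_mx (real_complex R) S = L^t* *m ddiag d *m L -> \det S != 0 ->
  (#|[set i | (d i < 0)%R]%SET| + #|[set i | (- d i < 0)%R]%SET| = n)%N.
Proof.
move=> SE S0; have d0 i : d i != 0.
  apply: contraNneq S0 => di; rewrite -(inj_eq (@complexI R)) rmorph0.
  rewrite -det_map_mx SE !det_mulmx det_diag (bigD1 i) //= mxE di.
  by rewrite rmorph0 mul0r mulr0 mul0r.
rewrite -[RHS]card_ord -(cardsC [set i | (d i < 0)%R]%SET); congr addn.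
by apply: eq_card => i; rewrite !inE oppr_lt0 -leNgt le_eqVlt eq_sym (negPf (d0 i)).
Qed.

(** The form of a polynomial in [1/z]: the change of variable [z -> -1/z]
    reduces it to the form of a polynomial. *)
Definition ipow n D (z : 'cV[C]_n) : 'M[C]_(n, D) :=
  \matrix_(i, k) (z i 0)^-1 ^+ k.+1.

Lemma pickmx_cpolyV D (p : {poly R}) n (z : 'cV[C]_n) (E : set C) :
  (size p <= D.+1)%N -> upper_in E z ->
  pickmx (fun w => cpoly p w^-1) z z = ipow D z *m (- bez D p) *m (ipow D z)^t*.
Proof.
move=> hp zE; apply/matrixP => i j.
have zij := upper_conj_neq (zE i).1 (zE j).1.
have nz k : z k 0 != 0.
  by have := (zE k).1; apply: contraTneq => ->; rewrite ltxx.
have nzc k : Num.conj (z k 0) != 0 by rewrite fmorph_eq0.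
have -> : (ipow D z *m - bez D p *m (ipow D z)^t*) i j =
  - ((z i 0)^-1 * (Num.conj (z j 0))^-1 * (\sum_(k < D) \sum_(l < D)
     (p`_(k + l).+1)%:C%C * (z i 0)^-1 ^+ k * (Num.conj (z j 0))^-1 ^+ l)).
  rewrite mxE [in RHS]exchange_big mulr_sumr -sumrN.
  apply: eq_bigr => l _; rewrite mxE mulr_suml mulr_sumr -sumrN.
  apply: eq_bigr => k _; rewrite !mxE rmorphXn fmorphV !exprS /=; ring.
rewrite mxE /pick -cpoly_conj !(cpolyE _ hp) fmorphV.
rewrite -(divided_difference (c := fun k => (p`_k)%:C%C)); last first.
  by move=> k pk; rewrite nth_default // (leq_trans hp).
set T := \sum_(_ < D) _; field.
by rewrite zij nz nzc.
Qed.

(** Points sent to infinity on the imaginary axis detect the Hankel matrix of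
    the coefficients of an expansion: row operations make the matrix of their
    negative powers tend to the identity, and the error of the expansion is
    too small to be seen after them. *)
Lemma negG_hankel n (S : 'M[R]_n) (L : 'M[C]_n) (d : 'I_n -> R) k g P :
  happrox k g P -> (2 * n <= k.+1)%N ->
  (forall i j : 'I_n, S i j = - P`_(i + j).+1) ->
  L *m L^t* = 1%:M -> map_mx (real_complex R) S = L^t* *m ddiag d *m L ->
  negG g #|[set i | (d i < 0)%R]%SET|.
Proof.
move=> hg nk SP LL SE E gE.
pose D := (n + size P)%N; have hp : (size P <= D.+1)%N by rewrite leqW // leq_addl.
pose c (i : 'I_n) : R := i.+1%:R.
have c0 i : 0 < c i by rewrite ltr0n.
have cn i : (c i)%:C%C != 0 :> C by rewrite realC_eq0 gt_eqF.
pose pw m : 'M[C]_(n, m) := \matrix_(p, i) (c p)%:C%C^-1 ^+ i.+1.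
have V0u : pw n \in unitmx.
  rewrite unitmxE unitfE.
  have -> : pw n = diag_mx (\row_i (c i)%:C%C^-1) *m
      (Vandermonde n (\row_i (c i)%:C%C^-1))^T.
    by apply/matrixP => i j; rewrite mul_diag_mx !mxE exprS.
  rewrite det_mulmx det_diag det_tr det_Vandermonde mulf_neq0 //.
    by apply/prodf_neq0 => i _; rewrite mxE invr_eq0.
  apply/prodf_neq0 => i _; apply/prodf_neq0 => j ij.
  rewrite !mxE subr_eq0 (inj_eq invr_inj) (inj_eq (@complexI R)) eqr_nat eqSS.
  by rewrite neq_ltn ij orbT.
pose B := invmx (pw n) *m pw D.
have BE (q : 'I_n) (i : 'I_D) : (i < n)%N -> B q i = ((q : nat) == i)%:R.
  move=> iin; have /matrixP/(_ q (Ordinal iin)) := mulVmx V0u.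
  by rewrite mxE [RHS]mxE => <-; rewrite mxE; apply: eq_bigr => p _; rewrite !mxE.
pose w y : 'cV[C]_n := \col_i ((c i)%:C%C * (0 +i* y)%C).
pose X y : 'M[C]_n := diag_mx (\row_q (0 +i* y)%C ^+ q.+1) *m invmx (pw n).
have XE y (q p : 'I_n) : X y q p = (0 +i* y)%C ^+ q.+1 * invmx (pw n) q p.
  by rewrite /X mul_diag_mx !mxE.
have XwE y (q : 'I_n) (i : 'I_D) : (X y *m ipow D (w y)) q i =
    B q i * ((0 +i* y)%C ^+ q.+1 * (0 +i* y)%C^-1 ^+ i.+1).
  rewrite mxE [B _ _]mxE mulr_suml; apply: eq_bigr => p _.
  by rewrite XE !mxE invfM exprMn; ring.
pose Id : 'M[C]_(n, D) := \matrix_(q, i) ((q : nat) == i)%:R.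
have Xcv (q : 'I_n) (i : 'I_D) : (X y *m ipow D (w y)) q i @[y --> @gen_infty R] -->
    (Id q i : C^o).
  have H : axis_cvg (fun z => B q i * (z ^+ q.+1 * z^-1 ^+ i.+1)) (Id q i).
    have [iin|ni] := ltnP i n.
      rewrite BE // mxE; case: eqVneq => [qi|_]; last first.
        by apply: axis_eq (axis_cst 0) => z _; rewrite mul0r.
      apply: axis_eq (axis_cst 1) => z z0.
      by rewrite qi -exprMn divff // expr1n mulr1.
    have qi : (q < i)%N by rewrite (leq_trans _ ni).
    have -> : Id q i = B q i * 0 ^+ (i - q) :> C.
      by rewrite mxE ltn_eqF // expr0n subn_eq0 leqNgt qi /= mulr0.
    have := axisM (axis_cst (B q i)) (axisX (i - q) (@axis_inv R)).
    apply: axis_eq => z z0; congr (_ * _).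
    rewrite -(subnKC (ltnW qi)) -addSn [in RHS]exprD mulrA -exprMn divff // expr1n mul1r.
    by rewrite addKn.
  by under eq_fun do rewrite XwE; case: H.
pose rho z := g z - cpoly P z^-1.
have rhoc p e : (e <= k)%N -> axis_cvg (fun z => z ^+ e * rho ((c p)%:C%C * z)) 0.
  move=> ek; have h := axis_scale (c0 p) (happroxW ek hg).
  have := axisM (axis_cst ((c p)%:C%C^-1 ^+ e)) h; rewrite mulr0.
  apply: axis_eq => z z0; rewrite exprMn !mulrA -exprMn mulVf // expr1n mul1r //.
have rhocc p e : (e <= k)%N ->
    axis_cvg (fun z => z ^+ e * Num.conj (rho ((c p)%:C%C * z))) 0.
  move=> ek; have := axisM (axis_cst ((-1) ^+ e)) (axis_conj (rhoc p e ek)).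
  rewrite rmorph0 mulr0; apply: axis_near; apply: filterE => y /=.
  by rewrite rmorphM rmorphXn /= conj_iy mulrA -exprMn mulN1r opprK.
have rcv (q q' : 'I_n) : (X y *m pickmx rho (w y) (w y) *m (X y)^t*) q q'
    @[y --> @gen_infty R] --> (0 : C^o).
  have ee : (q + q'.+1 <= k)%N.
    by rewrite -ltnS (leq_trans _ nk) // mul2n -addnn -addSn leq_add.
  pose T p p' z : C := invmx (pw n) q p * Num.conj (invmx (pw n) q' p') *
     (-1) ^+ q'.+1 * ((c p + c p')%:C%C^-1 *
      (z ^+ (q + q'.+1) * rho ((c p)%:C%C * z) -
        z ^+ (q + q'.+1) * Num.conj (rho ((c p')%:C%C * z)))).
  have H : axis_cvg (fun z => \sum_p' \sum_p T p p' z) 0.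
    have E0 : (0 : C) = \sum_(p' < n) \sum_(p < n) (invmx (pw n) q p *
        Num.conj (invmx (pw n) q' p') * (-1) ^+ q'.+1 * ((c p + c p')%:C%C^-1 * (0 - 0))).
      by rewrite big1 // => p' _; rewrite big1 // => p _; rewrite subr0 !mulr0.
    rewrite [X in axis_cvg _ X]E0; apply: axis_sum => p'; apply: axis_sum => p.
    apply: axisM (axis_cst _) _; apply: axisM (axis_cst _) _.
    by apply: axisB; [exact: rhoc|exact: rhocc].
  case: H => H; apply: cvg_trans H; apply: near_eq_cvg.
  apply: filterS (gen_infty_gt 0) => y y0; rewrite mxE.
  set z := (0 +i* y)%C; have z0 : z != 0 by exact: iy_neq0.
  apply: eq_bigr => p' _; rewrite mxE mulr_suml; apply: eq_bigr => p _.
  rewrite trmxCE !XE !mxE rmorphM rmorphXn /= conj_iy -/z /T /pick rmorphM /= conj_iy conj_realC.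
  rewrite rmorphD /= -/z [(- z) ^+ q'.+1]exprNn addnS !exprS exprD.
  have cc : (c p)%:C%C + (c p')%:C%C != 0 :> C.
    by rewrite -rmorphD /= realC_eq0 gt_eqF // addr_gt0.
  have -> : (c p)%:C%C * z - (c p')%:C%C * - z = ((c p)%:C%C + (c p')%:C%C) * z by ring.
  field.
  by rewrite z0 /= !nat1r -natrD pnatr_eq0.
have IdE : Id *m (- bez D P) *m Id^t* = map_mx (real_complex R) S.
  have nD : (n <= D)%N by exact: leq_addr.
  have IdM m (A : 'M[C]_(D, m)) q j : (Id *m A) q j = A (widen_ord nD q) j.
    rewrite mxE (bigD1 (widen_ord nD q)) //= mxE eqxx mul1r big1 ?addr0 // => i iq.
    rewrite mxE (_ : ((q : nat) == i) = false) ?mul0r //.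
    by apply/negbTE; apply: contraNneq iq => qi; apply/eqP/val_inj.
  apply/matrixP => i j; rewrite -mulmxA IdM mxE (bigD1 (widen_ord nD j)) //=.
  rewrite trmxCE !mxE eqxx rmorph1 mulr1 big1 ?addr0 ?SP ?rmorphN // => l lj.
  rewrite trmxCE !mxE (_ : ((j : nat) == l) = false) ?rmorph0 ?mulr0 //.
  by apply/negbTE; apply: contraNneq lj => jl; apply/eqP/val_inj.
have [Sel HSel] := negative_directions d.
set m := #|_| in Sel HSel *.
pose Q := Sel *m L.
have QbQ : Q *m map_mx (real_complex R) S *m Q^t* = - 1%:M.
  rewrite SE /Q trmxC_mul -!mulmxA (mulmxA L) LL mul1mx.
  by rewrite (mulmxA L) LL mul1mx mulmxA.
have Kcv i j : (X y *m ipow D (w y) *m (- bez D P) *m (X y *m ipow D (w y))^t*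
    + X y *m pickmx rho (w y) (w y) *m (X y)^t*) i j @[y --> @gen_infty R]
    --> ((Id *m (- bez D P) *m Id^t*) i j : C^o).
  under eq_fun do rewrite mxE.
  have -> : (Id *m (- bez D P) *m Id^t*) i j = (Id *m (- bez D P) *m Id^t*) i j + 0.
    by rewrite addr0.
  apply: (@cvgD C C^o); last exact: rcv.
  by apply: gram_cvg => i' j'; [exact: Xcv|exact: cst_cvg].
have Gcv r s : (Q *m (X y *m ipow D (w y) *m (- bez D P) *m (X y *m ipow D (w y))^t*
    + X y *m pickmx rho (w y) (w y) *m (X y)^t*) *m Q^t*) r s @[y --> @gen_infty R]
    --> ((- 1%:M : 'M[C]_m) r s : C^o).
  rewrite -QbQ -IdE.
  apply: (@gram_cvg R R (@gen_infty R) _ m n (fun=> Q)); last exact: Kcv.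
  by move=> i j; exact: cst_cvg.
apply: negG_approx => eps eps0.
have zwE : gen_infty [set y | upper_in E (w y)] by exact: axis_points.
have near1 : \forall y \near @gen_infty R, forall rs : 'I_m * 'I_m,
   cabs ((Q *m (X y *m ipow D (w y) *m (- bez D P) *m (X y *m ipow D (w y))^t*
    + X y *m pickmx rho (w y) (w y) *m (X y)^t*) *m Q^t*) rs.1 rs.2 -
     (- 1%:M : 'M[C]_m) rs.1 rs.2) < eps.
  by apply: filter_forall => -[r s]; have /cvgC/(_ eps eps0) := Gcv r s.
have [y [h1 h2]] := filter_ex (filterI zwE near1).
exists n, (w y), (Q *m X y); split=> // r s.
have := h2 (r, s) => /=.
have -> : Q *m X y *m pickmx g (w y) (w y) *m (Q *m X y)^t* =
  Q *m (X y *m ipow D (w y) *m (- bez D P) *m (X y *m ipow D (w y))^t*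
    + X y *m pickmx rho (w y) (w y) *m (X y)^t*) *m Q^t*.
  have -> : pickmx g (w y) (w y) = pickmx (fun z => cpoly P z^-1 + rho z) (w y) (w y).
    by apply/matrixP => i j; rewrite !mxE /pick /rho ![cpoly P _ + _]addrC !subrK.
  rewrite pickmxD (pickmx_cpolyV hp h1) !trmxC_mul !mulmxDr !mulmxDl.
  by rewrite !mulmxA.
have -> : (r == s)%:R = - (- 1%:M : 'M[C]_m) r s by rewrite !mxE opprK.
by [].
Qed.

End NuMinus.

(** * Pade approximants and Hankel determinants *)

Section Pade.
Variable R : realType.
Local Notation C := R[i].
Implicit Types (F G f g : C -> C) (p q r : {poly R}) (z : C).

Lemma axis_cpoly_lead p k : (size p <= k.+1)%N ->
  axis_cvg (fun z => cpoly p z / z ^+ k) (p`_k)%:C%C.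
Proof.
move=> hp; have H (i : 'I_k.+1) : axis_cvg (fun z => (p`_i)%:C%C * z ^+ i / z ^+ k)
    ((p`_i)%:C%C * ((i : nat) == k)%:R).
  have ik : (i <= k)%N by rewrite -ltnS.
  have := axisM (axis_cst (p`_i)%:C%C) (axisX (k - i) (@axis_inv R)).
  have -> : (0 : C) ^+ (k - i) = ((i : nat) == k)%:R.
    by rewrite expr0n subn_eq0 eqn_leq ik.
  apply: axis_eq => z z0; rewrite -mulrA; congr (_ * _).
  have -> : z ^+ k = z ^+ i * z ^+ (k - i) by rewrite -exprD subnKC.
  by rewrite invfM mulrA divff ?expf_neq0 // mul1r exprVn.
have := axis_sum (index_enum 'I_k.+1) H.
rewrite big_ord_recr /= big1 => [|i _]; last by rewrite ltn_eqF // mulr0.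
rewrite add0r eqxx mulr1; apply: axis_eq => z _.
by rewrite (cpolyE _ hp) mulr_suml.
Qed.

Lemma size_axis p k (c : C) : axis_cvg (fun z => cpoly p z / z ^+ k) c ->
  (size p <= k.+1)%N.
Proof.
move=> H; rewrite leqNgt; apply/negP => kp.
have sp : (size p <= (size p).-1.+1)%N by exact: leqSpred.
have := axis_cpoly_lead sp; set n := (size p).-1 => H1.
have kn : (k < n)%N by rewrite /n; case: (size p) kp.
have := axisM H (axisX (n - k) (@axis_inv R)).
rewrite expr0n subn_eq0 leqNgt kn mulr0 => H2.
have /(axis_unique H1)/eqP : axis_cvg (fun z => cpoly p z / z ^+ n) 0.
  apply: axis_eq H2 => z z0; rewrite -mulrA; congr (_ * _).
  by rewrite -{2}(subnKC (ltnW kn)) exprD invfM exprVn.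
rewrite realC_eq0 -/(lead_coef p) lead_coef_eq0 => /eqP p0.
by move: kp; rewrite p0 size_poly0.
Qed.

Lemma poly_axis0 p : axis_cvg (cpoly p) 0 -> p = 0.
Proof.
move=> H; have H1 : axis_cvg (fun z => cpoly p z / z ^+ 0) 0.
  by apply: axis_eq H => z _; rewrite expr0 divr1.
have sp := size_axis H1; have /(axis_unique H1)/esym/eqP := axis_cpoly_lead sp.
rewrite realC_eq0 => /eqP p0.
by rewrite (size1_polyC sp) p0.
Qed.

Lemma axis_div F k k' c : (k <= k')%N -> axis_cvg (fun z => z ^+ k' * F z) c ->
  axis_cvg (fun z => z ^+ k * F z) (c * 0 ^+ (k' - k)).
Proof.
move=> kk H; have := axisM H (axisX (k' - k) (@axis_inv R)).
apply: axis_eq => z z0.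
by rewrite -{1}(subnKC kk) exprD mulrAC -(mulrA (z ^+ k)) -exprMn divff // expr1n mulr1.
Qed.

Lemma axis_div0 F k k' : (k <= k')%N -> axis_cvg (fun z => z ^+ k' * F z) 0 ->
  axis_cvg (fun z => z ^+ k * F z) 0.
Proof. by move=> kk /(axis_div kk); rewrite mul0r. Qed.

(** [q F - r] is smaller than the degree of [q] lets expect. *)
Definition pade F n := exists q r, [/\ q != 0, (size q <= n)%N &
  axis_cvg (fun z => z ^+ n * (cpoly q z * F z - cpoly r z)) 0].

(** The part of negative degree of [q(z) p(1/z)] has Hankel sums as
    coefficients. *)
Lemma laurent_split n (a : nat -> R) p : exists r V,
  (forall z, z != 0 -> (\sum_(i < n) (a i)%:C%C * z ^+ i) * cpoly p z^-1 =
     cpoly r z + z^-1 * cpoly V z^-1) /\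
  forall j, V`_j = \sum_(i < n) a i * p`_(i + j).+1.
Proof.
elim: n => [|n [r [V [H HV]]]].
  exists 0, 0; split=> [z _|j]; first by rewrite big_ord0 !cpoly0 mul0r mulr0 addr0.
  by rewrite big_ord0 coef0.
have [r' [V' [H' HV']]] : exists r V,
    (forall z, z != 0 -> z ^+ n * cpoly p z^-1 = cpoly r z + z^-1 * cpoly V z^-1) /\
    forall j, V`_j = p`_(n + j).+1.
  elim: {r V H HV} n => [|n [r [V [H HV]]]].
    exists (p`_0)%:P, (drop_poly 1 p); split=> [z z0|j]; last first.
      by rewrite coef_drop_poly addn1.
    rewrite -{1}(poly_take_drop 1 p) cpolyD cpolyM cpolyXn expr0 mul1r mulrC.
    rewrite expr1; congr (_ + _).
    rewrite (_ : take_poly 1 p = (p`_0)%:P) ?cpolyC //.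
    by apply/polyP => i; rewrite coef_take_poly coefC; case: i.
  exists ('X * r + (V`_0)%:P), (drop_poly 1 V); split=> [z z0|j]; last first.
    by rewrite coef_drop_poly addn1 HV addnS.
  rewrite exprS -mulrA H // mulrDr mulrA divff // mul1r.
  rewrite -{1}(poly_take_drop 1 V) !cpolyD !cpolyM cpolyXn cpolyX cpolyC -addrA.
  rewrite expr1; congr (_ + (_ + _)); last by rewrite mulrC.
  rewrite (_ : take_poly 1 V = (V`_0)%:P) ?cpolyC //.
  by apply/polyP => i; rewrite coef_take_poly coefC; case: i.
exists (r + a n *: r'), (V + a n *: V'); split=> [z z0|j]; last first.
  by rewrite big_ord_recr coefD coefZ HV HV'.
rewrite big_ord_recr /= mulrDl H // -mulrA H' // !cpolyD !cpolyZ; ring.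
Qed.

Lemma cpolyV_axis0 p k : axis_cvg (fun z => z ^+ k * cpoly p z^-1) 0 ->
  forall j, (j <= k)%N -> p`_j = 0.
Proof.
elim: k p => [|k IH] p H.
  have {}H : axis_cvg (fun z => cpoly p z^-1) 0.
    by apply: axis_eq H => z _; rewrite expr0 mul1r.
  case=> // _; have /(axis_unique H)/esym/eqP := axis_cpoly p.
  by rewrite realC_eq0 => /eqP.
have p0 : p`_0 = 0.
  have /(axis_unique (axis_cpoly p))/eqP : axis_cvg (fun z => cpoly p z^-1) 0.
    have := axis_div0 (leq0n k.+1) H; apply: axis_eq => z _.
    by rewrite expr0 mul1r.
  by rewrite realC_eq0 => /eqP.
case=> // j; rewrite ltnS => jk.
rewrite -[j.+1]addn1 -coef_drop_poly; apply: IH jk; apply: axis_eq H => z z0.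
rewrite -{1}(poly_take_drop 1 p) cpolyD cpolyM cpolyXn.
rewrite (_ : take_poly 1 p = 0); last first.
  by apply/polyP => i; rewrite coef_take_poly coef0; case: i.
by rewrite cpoly0 add0r expr1 exprSr -mulrA [z * _]mulrC mulfVK.
Qed.

(** The condition on [q F - r] says that the coefficients of [q] form a kernel
    vector of the Hankel matrix. *)
Lemma pade_hankel k f (s : seq R) n : happrox k f ('X * - Poly s) -> (0 < n)%N ->
  (2 * n <= k.+1)%N -> \det (hankel s n) = 0 <-> pade f n.
Proof.
move=> hf n0 nk; set P := 'X * - Poly s.
have Pc i : P`_i.+1 = - s`_i by rewrite coefXM coefN coef_Poly.
have split_q q r V : (size q <= n)%N ->
   (forall z, z != 0 -> (\sum_(i < n) (q`_i)%:C%C * z ^+ i) * cpoly P z^-1 =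
     cpoly r z + z^-1 * cpoly V z^-1) ->
   axis_cvg (fun z => z ^+ n * (cpoly q z * f z - (cpoly r z + z^-1 * cpoly V z^-1))) 0.
  move=> sq E; have sq' : (size q <= n.-1.+1)%N by rewrite prednK.
  have nk' : (n.-1 + n <= k)%N by rewrite -ltnS -addSn prednK // addnn -mul2n.
  have := axisM (axis_cpoly_lead sq') (happroxW nk' hf); rewrite mulr0.
  apply: axis_eq => z z0; rewrite -E //.
  have -> : \sum_(i < n) (q`_i)%:C%C * z ^+ i = cpoly q z.
    by rewrite (cpolyE _ sq') prednK.
  by rewrite -mulrBr exprD; have zn : z ^+ n.-1 != 0 by [rewrite expf_neq0]; field.
split=> [d0|[q [r [q0 sq H]]]].
  have /det0P[v v0 vH] : \det (hankel s n) == 0 by apply/eqP.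
  pose a i := if insub i is Some j then v 0 j else 0.
  have aE (i : 'I_n) : a i = v 0 i by rewrite /a insubT // => lt; congr (v 0 _); apply/val_inj.
  pose q := \poly_(i < n) a i.
  have [r [V [E HV]]] := laurent_split n (fun i => q`_i) P.
  exists q, r; split; first last.
  - have HV0 j : (j < n)%N -> V`_j = 0.
      move=> jn; rewrite HV; have /rowP/(_ (Ordinal jn)) := vH.
      rewrite !mxE => h; rewrite (eq_bigr (fun i => - (v 0 i * hankel s n i (Ordinal jn)))).
        by rewrite sumrN h oppr0.
      move=> i _; rewrite Pc coef_poly ltn_ord aE !mxE mulrN //.
    have := split_q q r V (size_poly _ _) E.
    have V2 : axis_cvg (fun z => z^-1 * cpoly (drop_poly n V) z^-1) 0.
      by have := axisM (@axis_inv R) (axis_cpoly (drop_poly n V)); rewrite mul0r.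
    move=> /axisD/(_ V2); rewrite addr0; apply: axis_eq => z z0.
    have -> : cpoly V z^-1 = cpoly (drop_poly n V) z^-1 * z^-1 ^+ n.
      rewrite -{1}(poly_take_drop n V) cpolyD cpolyM cpolyXn.
      rewrite (_ : take_poly n V = 0) ?cpoly0 ?add0r //.
      by apply/polyP => i; rewrite coef_take_poly coef0; case: ifP => // /HV0.
    rewrite exprVn; have zn : z ^+ n != 0 by rewrite expf_neq0.
    by field; rewrite z0 zn.
  - exact: size_poly.
  apply: contraNneq v0 => q0; apply/eqP/rowP => i; rewrite mxE -aE.
  by have := congr1 (fun p : {poly R} => p`_i) q0; rewrite coef0 coef_poly ltn_ord.
have [r' [V [E HV]]] := laurent_split n (fun i => q`_i) P.
have := axisB H (split_q q r' V sq E); rewrite subr0 => {}H.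
have {}H : axis_cvg (fun z => z ^+ n * (cpoly (r' - r) z + z^-1 * cpoly V z^-1)) 0.
  by apply: axis_eq H => z _; rewrite cpolyB; ring.
have rr : r' - r = 0.
  apply: poly_axis0; have := axisB (axis_div0 (leq0n n) H)
    (axisM (@axis_inv R) (axis_cpoly V)).
  by rewrite mul0r subr0; apply: axis_eq => z _; rewrite expr0 mul1r addrK.
have {}H : axis_cvg (fun z => z ^+ n.-1 * cpoly V z^-1) 0.
  apply: axis_eq H => z z0; rewrite rr cpoly0 add0r -{1}(prednK n0) exprSr.
  by rewrite mulrA mulfK.
have V0 := cpolyV_axis0 H.
apply/eqP/det0P; exists (\row_(i < n) q`_i).
  apply: contraNneq q0 => /rowP h; apply/eqP/polyP => i; rewrite coef0.
  have [im|mi] := ltnP i n; first by have := h (Ordinal im); rewrite !mxE.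
  by rewrite nth_default // (leq_trans sq).
apply/rowP => j; rewrite !mxE; have := V0 j; rewrite HV -ltnS prednK // => /(_ (ltn_ord j)) h.
apply: oppr_inj; rewrite oppr0 -[RHS]h -sumrN.
by apply: eq_bigr => i _; rewrite Pc !mxE mulrN.
Qed.

(** Here [F = (B + G) / (1 - A (B + G))], and the approximant [r / q] of [F]
    corresponds to [r' / q'] with [q' = q + A r] and [r' = r - B q'], since
    [q' G - r' = (q F - r) (1 - A (B + G))].  The exponent [e] is the degree
    of [B], which is [0] for [F] itself and [1] for [z F]. *)
Lemma pade_transfer (A B : {poly R}) F G v e n (a b : C) :
  (e <= v)%N -> (0 < v)%N -> (0 < n)%N -> a != 0 -> b != 0 ->
  gen_infty [set y | let z := (0 +i* y)%C in
    F z * (1 - cpoly A z * (cpoly B z + G z)) = cpoly B z + G z] ->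
  (size A <= (v - e).+1)%N -> axis_cvg (fun z => cpoly A z / z ^+ (v - e)) a ->
  axis_cvg (fun z => (cpoly B z + G z) / z ^+ e) b ->
  pade F (v + n) <-> pade G n.
Proof.
move=> ev v0 n0 a0 b0 FG sA hA hB.
pose W z := cpoly B z + G z; pose D z := 1 - cpoly A z * W z.
have hD : axis_cvg (fun z => D z / z ^+ v) (- (a * b)).
  have := axisB (axisX v (@axis_inv R)) (axisM hA hB).
  rewrite expr0n gtn_eqF // sub0r; apply: axis_eq => z z0.
  rewrite mulf_div -exprD subnK // exprVn /D /W; field.
  by rewrite expf_neq0.
have ab0 : - (a * b) != 0 by rewrite oppr_eq0 mulf_neq0.
have Dn := axis_neq0 ab0 hD; have Wn := axis_neq0 b0 hB.
have nz : gen_infty [set y | (0 +i* y)%C != 0 :> C].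
  by apply: filterS (gen_infty_gt 0) => y; exact: iy_neq0.
have good : gen_infty [set y | let z := (0 +i* y)%C in
    [/\ z != 0, D z != 0, W z != 0 & F z = W z / D z]].
  apply: filterS2 (filterI FG nz) (filterI Dn Wn) => y /= [E z0] [d0 w0].
  have {}d0 : D (0 +i* y)%C != 0 by apply: contraNneq d0 => ->; rewrite mul0r.
  have {}w0 : W (0 +i* y)%C != 0.
    by apply: contraNneq w0; rewrite /W => ->; rewrite mul0r.
  by split=> //; rewrite -[W _]/(cpoly B _ + G _) -E mulfK.
have near_good (f g : C -> C) c : (forall z, z != 0 -> D z != 0 -> W z != 0 ->
    F z = W z / D z -> f z = g z) -> axis_cvg f c -> axis_cvg g c.
  by move=> fg; apply: axis_near; apply: filterS good => y /= [? ? ? ?]; exact: fg.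
(* [F ~ - 1 / (a z^(v - e))] *)
have hF : axis_cvg (fun z => F z * z ^+ (v - e)) (b / - (a * b)).
  have := axisM hB (axisV ab0 hD); apply: near_good => z z0 d0 w0 ->.
  rewrite -{1}(subnKC ev) exprD; have := expf_neq0 e z0; have := expf_neq0 (v - e) z0.
  by move=> h1 h2; rewrite -/(W z); field; rewrite d0 h1 h2.
have hFn : b / - (a * b) != 0 by rewrite mulf_neq0 // invr_eq0.
split=> -[q [r [q0 sq H]]].
- have sq' : (size q <= (v + n).-1.+1)%N by rewrite prednK // addn_gt0 v0.
  have hr : axis_cvg (fun z => cpoly r z / z ^+ (n.-1 + e))
     ((q`_(v + n).-1)%:C%C * (b / - (a * b))).
    have h1 := axisM (axis_cpoly_lead sq') hF.
    have := axisB h1 (axisM H (axisX (v + n + (n.-1 + e)) (@axis_inv R))).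
    rewrite mul0r subr0; apply: axis_eq => z z0.
    have -> : z ^+ (v + n).-1 = z ^+ (n.-1 + e) * z ^+ (v - e).
      by rewrite -exprD; congr (_ ^+ _); lia.
    rewrite exprVn (exprD _ (v + n)).
    have := expf_neq0 (v + n) z0; have := expf_neq0 (n.-1 + e) z0.
    have := expf_neq0 (v - e) z0 => h2 h3 h4; field.
    by rewrite h2 h3 h4.
  have sr := size_axis hr.
  exists (q + A * r), (r - B * (q + A * r)); split.
  + apply: contraNneq q0 => q0; have /eqP := q0; rewrite addr_eq0 => /eqP Eq.
    suff r0 : r = 0 by rewrite Eq r0 mulr0 oppr0.
    apply: poly_axis0; have h1 := axisM H hD; rewrite mul0r in h1.
    have h2 : axis_cvg (fun z => z ^+ n * - cpoly r z) 0.
      apply: near_good h1 => z z0 d0 w0 FE; rewrite FE Eq cpolyN cpolyM exprD.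
      have h := expf_neq0 v z0; rewrite [D z]/D /W in d0 *; field.
      by rewrite h d0.
    have := axisN (axis_div0 (leq0n n) h2); rewrite oppr0.
    by apply: axis_eq => z _; rewrite expr0 mul1r opprK.
  + have hq : axis_cvg (fun z => cpoly (q + A * r) z / z ^+ n.-1)
       (((q`_(v + n).-1)%:C%C * (b / - (a * b))) / b).
      have h1 := axisM hr (axisV b0 hB).
      have := axisD h1 (axisM (axisM H (axisV hFn hF))
         (axisX (n + n.-1 + e) (@axis_inv R))).
      rewrite !mul0r addr0; apply: near_good => z z0 d0 w0 FE.
      rewrite cpolyD cpolyM -/(W z) FE exprVn.
      rewrite (exprD _ (n + n.-1)) (exprD _ n n.-1) (exprD _ v n) (exprD _ n.-1 e).
      have -> : z ^+ v = z ^+ (v - e) * z ^+ e by rewrite -exprD subnK.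
      have := expf_neq0 n z0; have := expf_neq0 n.-1 z0.
      have := expf_neq0 (v - e) z0; have := expf_neq0 e z0 => h2 h3 h4 h5.
      rewrite [D z]/D in d0 *; field.
      by rewrite h2 h3 h4 h5 w0 d0.
    by have := size_axis hq; rewrite prednK.
  + have := axisM H hD; rewrite mul0r; apply: near_good => z z0 d0 w0 FE.
    rewrite FE cpolyB !cpolyM cpolyD cpolyM exprD; have := expf_neq0 v z0 => h.
    rewrite [D z]/D /W in d0 *; field.
    by rewrite h d0.
- have sq' : (size q <= n.-1.+1)%N by rewrite prednK.
  pose r1 := r + B * q.
  have hr : axis_cvg (fun z => cpoly r1 z / z ^+ (n.-1 + e)) ((q`_n.-1)%:C%C * b).
    have := axisB (axisM (axis_cpoly_lead sq') hB)
      (axisM H (axisX (n + (n.-1 + e)) (@axis_inv R))).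
    rewrite mul0r subr0; apply: axis_eq => z z0.
    rewrite cpolyD cpolyM exprVn (exprD _ n) (exprD _ n.-1).
    have := expf_neq0 n z0; have := expf_neq0 n.-1 z0; have := expf_neq0 e z0.
    by move=> h2 h3 h4; field; rewrite h2 h3 h4.
  have sr := size_axis hr.
  have E z : z != 0 -> D z != 0 -> W z != 0 -> F z = W z / D z ->
     z ^+ (v + n) * (cpoly (q - A * r1) z * F z - cpoly r1 z) =
     z ^+ n * (cpoly q z * G z - cpoly r z) * (D z / z ^+ v)^-1.
    move=> z0 d0 w0 ->; rewrite cpolyB cpolyM /r1 cpolyD cpolyM exprD.
    have := expf_neq0 v z0 => h; rewrite [D z]/D /W in d0 *; field.
    by rewrite h d0.
  have H' : axis_cvg (fun z => z ^+ (v + n) * (cpoly (q - A * r1) z * F z - cpoly r1 z)) 0.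
    have := axisM H (axisV ab0 hD); rewrite mul0r; apply: near_good => z z0 d0 w0 FE.
    by rewrite -E.
  exists (q - A * r1), r1; split=> //.
  + apply: contraNneq q0 => q1; have /eqP := q1; rewrite subr_eq0 => /eqP ->.
    suff -> : r1 = 0 by rewrite mulr0.
    apply: poly_axis0; have := axisN (axis_div0 (leq0n (v + n)) H').
    rewrite oppr0; apply: axis_eq => z _.
    by rewrite q1 cpoly0 mul0r sub0r expr0 mul1r opprK.
  + rewrite (leq_trans (size_polyD _ _)) // size_polyN geq_max.
    rewrite (leq_trans sq) ?leq_addl //= (leq_trans (size_polyMleq _ _)) //.
    rewrite -ltnS; move: sA sr; case: (size A) => [|x]; case: (size r1) => [|y]; lia.
Qed.

End Pade.

(** * The determinants of the Schur recursion *)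

Section SchurStep.
Variable R : realType.
Local Notation C := R[i].
Implicit Types s c : seq R.

(** The matrix of [schur_Delta] with a window of the sequence as last row: the
    sum of [m_p s_(k + p)] is a multiple of its determinant. *)
Definition windows v s k : 'M[R]_v :=
  \matrix_(i, p) if (i < v.-1)%N then s`_(i + p).+1 else s`_(k + p).

Lemma schur_DeltaE v s k :
  schur_Delta v.+1 s = \poly_(p < v.+1) cofactor (windows v.+1 s k) ord_max (inord p).
Proof.
rewrite /schur_Delta (expand_det_row _ ord_max) poly_def; apply: eq_bigr => p _.
rewrite mxE /= ltnn inord_val mulrC -mul_polyC; congr (_ * _).
rewrite /cofactor rmorphM rmorph_sign -det_map_mx; congr (_ * \det _).
apply/matrixP => i j; rewrite !mxE; have -> : (lift ord_max i < v)%N.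
  by rewrite lift_max.
by [].
Qed.

Lemma size_schur_m v s : (0 < v)%N -> (size (schur_m v s) <= v)%N.
Proof.
case: v => // v _; rewrite (leq_trans (size_scale_leq _ _)) // (schur_DeltaE v s 0).
exact: size_poly.
Qed.

Lemma schur_m_window v s k :
  \sum_(p < v.+1) (schur_m v.+1 s)`_p * s`_(k + p) =
  (-1) ^+ v.+2 / \det (hankel s v.+1) * \det (windows v.+1 s k).
Proof.
rewrite (expand_det_row (windows _ _ _) ord_max) mulr_sumr; apply: eq_bigr => p _.
rewrite coefZ (schur_DeltaE v s k) coef_poly ltn_ord inord_val mxE /= ltnn; ring.
Qed.

Lemma det_windows_full v s : windows v.+1 s v.+1 = hankel_plus s v.+1.
Proof.
apply/matrixP => i p; rewrite !mxE /=; case: ltnP => // vi.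
have -> : (i : nat) = v by apply/eqP; rewrite eqn_leq vi andbT -ltnS.
by rewrite addSn.
Qed.

Lemma det_windows_mid v s k : (0 < k <= v)%N -> \det (windows v.+1 s k) = 0.
Proof.
move=> /andP[k0 kv]; have kv' : (k.-1 < v.+1)%N by rewrite prednK // ltnW.
apply: (@determinant_alternate _ _ _ (Ordinal kv') ord_max) => [|p].
  by rewrite -val_eqE /= ltn_eqF // prednK.
by rewrite !mxE /= ltnn prednK // kv -addSn prednK.
Qed.

Lemma det_windows_first v s :
  \det (windows v.+1 s 0) = (-1) ^+ v * \det (hankel s v.+1).
Proof.
rewrite (expand_det_row _ ord_max) (expand_det_row (hankel _ _) ord0) mulr_sumr.
apply: eq_bigr => p _; rewrite !mxE /= ltnn !add0n [RHS]mulrCA; congr (_ * _).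
rewrite /cofactor exprD -mulrA; congr (_ * (_ * \det _)).
apply/matrixP => i j; rewrite !mxE.
by rewrite lift_max lift0 ltn_ord addSn.
Qed.

(** Reversing the columns makes the matrix triangular. *)
Lemma hankel_anti_trig s v : (forall i, (i < v)%N -> s`_i = 0) ->
  (\det (hankel s v.+1) == 0) = (s`_v == 0).
Proof.
move=> s0; pose A : 'M[R]_v.+1 := \matrix_(i, j) s`_(i + (v - j)).
have AE : A = col_perm (perm.perm (@rev_ord_inj v.+1)) (hankel s v.+1).
  by apply/matrixP => i j; rewrite !mxE perm.permE /= subSS.
have At : is_trig_mx A.
  apply/is_trig_mxP => i j ij; rewrite mxE s0 //.
  by have := ltn_ord j; lia.
have : \det A = s`_v ^+ v.+1.
  rewrite det_trig // (eq_bigr (fun=> s`_v)) => [|i _].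
    by rewrite prodr_const card_ord.
  by rewrite mxE subnKC // -ltnS.
rewrite AE col_permE det_mulmx det_perm => E.
have := congr1 (fun x => x == 0) E.
by rewrite mulf_eq0 signr_eq0 orbF expf_eq0.
Qed.

Lemma leading_zeros s v : (0 < v)%N ->
  (forall p, (0 < p < v)%N -> \det (hankel s p) = 0) -> \det (hankel s v) != 0 ->
  (forall i, (i < v.-1)%N -> s`_i = 0) /\ s`_v.-1 != 0.
Proof.
case: v => // v _ Hp Hv /=.
have z i : (i < v)%N -> s`_i = 0.
  elim/ltn_ind: i => i IH iv; apply/eqP; rewrite -hankel_anti_trig.
    by apply/eqP; apply: Hp.
  by move=> j ji; apply: IH => //; exact: ltn_trans iv.
by split=> //; rewrite -hankel_anti_trig.
Qed.

Lemma cpoly_rev v (m : {poly R}) : (size m <= v)%N ->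
  forall z : C, z != 0 ->
  z * cpoly m z = z ^+ v * cpoly (Poly (rev [seq m`_i | i <- iota 0 v])) z^-1.
Proof.
move=> sm z z0; case: v sm => [|v] sm.
  by move: sm; rewrite leqn0 size_poly_eq0 => /eqP ->; rewrite cpoly0 mulr0 /= cpoly0 mulr0.
have -> : Poly (rev [seq m`_i | i <- iota 0 v.+1]) = \sum_(i < v.+1) m`_i *: 'X^(v - i).
  apply/polyP => k; rewrite coef_Poly coef_sum.
  have [kv|vk] := leqP k v; last first.
    rewrite nth_default ?size_rev ?size_map ?size_iota // big1 // => i _.
    by rewrite coefZ coefXn gtn_eqF ?mulr0 // (leq_ltn_trans (leq_subr _ _)).
  rewrite nth_rev ?size_map ?size_iota // (nth_map 0%N) ?size_iota; last first.
    by rewrite subSS ltnS leq_subr.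
  rewrite nth_iota ?add0n ?subSS ?ltnS ?leq_subr //.
  have kv' : (v - k < v.+1)%N by rewrite ltnS leq_subr.
  rewrite (bigD1 (Ordinal kv')) //= coefZ coefXn subKn // eqxx mulr1 big1 ?addr0 //.
  move=> i ik; rewrite coefZ coefXn (_ : (k == v - i)%N = false) ?mulr0 //.
  apply: contraNF ik => /eqP kE; apply/eqP/val_inj; rewrite /= kE subKn //.
  by rewrite -ltnS.
have -> : cpoly (\sum_(i < v.+1) m`_i *: 'X^(v - i)) z^-1 =
    \sum_(i < v.+1) (m`_i)%:C%C * z^-1 ^+ (v - i).
  rewrite /cpoly rmorph_sum horner_sum; apply: eq_bigr => i _.
  by rewrite -/(cpoly _ _) cpolyZ cpolyXn.
rewrite (cpolyE _ sm) !mulr_sumr; apply: eq_bigr => i _.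
rewrite mulrCA [RHS]mulrCA; congr (_ * _).
have -> : z ^+ v.+1 = z * z ^+ i * z ^+ (v - i).
  by rewrite exprS -mulrA -exprD subnKC // -ltnS.
by rewrite -[RHS]mulrA -exprMn divff // expr1n mulr1.
Qed.

(** Upper triangular Toeplitz matrices multiply like truncated power series;
    the first row carries the coefficients. *)
Lemma toeplitz_series d c c' : toeplitz d c *m toeplitz d c' = 1%:M ->
  exists r, Poly c * Poly c' = 1 + 'X^d * r.
Proof.
case: d => [|d] H.
  by exists (Poly c * Poly c' - 1); rewrite expr0 mul1r addrC subrK.
have E k : (k < d.+1)%N -> (Poly c * Poly c')`_k = (k == 0)%:R.
  move=> kd; have /matrixP/(_ ord0 (Ordinal kd)) := H.
  rewrite mxE [RHS]mxE -val_eqE /= eq_sym => <-.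
  rewrite coefM (big_ord_widen d.+1 (fun i => (Poly c)`_i * (Poly c')`_(k - i))) //.
  rewrite big_mkcond /=; apply: eq_bigr => i _; rewrite !mxE /= subn0 ltnS.
  by case: ifP => _; rewrite ?mulr0 // !coef_Poly.
exists (drop_poly d.+1 (Poly c * Poly c')).
rewrite -{1}(poly_take_drop d.+1 (Poly c * Poly c')) [drop_poly _ _ * _]mulrC; congr (_ + _).
  apply/polyP => k; rewrite coef_take_poly coef1; case: ltnP => [/E //|].
  by case: k.
Qed.

Lemma Poly_cat c c' : Poly (c ++ c') = Poly c + 'X^(size c) * Poly c'.
Proof.
apply/polyP => i; rewrite coef_Poly nth_cat coefD coefXnM !coef_Poly.
by case: ltnP => h; rewrite ?addr0 // [c`_i]nth_default ?add0r.
Qed.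

Lemma Poly_opp c : Poly [seq - x | x <- c] = - Poly c.
Proof.
apply/polyP => i; rewrite coefN !coef_Poly.
have [h|h] := ltnP i (size c); first by rewrite (nth_map 0).
by rewrite !nth_default ?oppr0 ?size_map.
Qed.

Lemma Poly_drop c k : (forall i, (i < k)%N -> c`_i = 0) ->
  Poly c = 'X^k * Poly (drop k c).
Proof.
move=> h; apply/polyP => i; rewrite coefXnM !coef_Poly.
by case: ltnP => [/h//|ki]; rewrite nth_drop subnKC.
Qed.

(** The two Toeplitz relations, read as identities between truncated power
    series. *)
Lemma step_data_toeplitz v d s sq fs (m := schur_m v s) (l := schur_l v s) :
  (0 < v)%N ->
  toeplitz (v + d.+1)
    (rev [seq m`_i | i <- iota 0 v] ++ [seq - x | x <- fs])
    *m toeplitz (v + d.+1) (drop v.-1 s) = 1%:M ->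
  toeplitz d.+1 (l :: [seq - x | x <- sq]) *m toeplitz d.+1 fs = 1%:M ->
  step_data v d m l (Poly (drop v.-1 s))
    (Poly (rev [seq m`_i | i <- iota 0 v])) (Poly fs) (Poly sq).
Proof.
move=> v0 /toeplitz_series[r E1] /toeplitz_series[r' E2]; split=> //.
- exact/cpoly_rev/size_schur_m.
- exists r; rewrite (_ : (d + v).+1 = v + d.+1)%N; last by rewrite addnC addnS.
  by rewrite -E1 Poly_cat Poly_opp size_rev size_map size_iota mulrN.
- exists r'; rewrite -E2 /= cons_poly_def Poly_opp mulNr addrC.
  by rewrite [_ * 'X]mulrC.
Qed.

(** Only the constant term of the expansion of [F] matters here, and there are
    no Toeplitz relations: the coefficients of [M U] are determinants of
    windows, which vanish because of equal rows or reduce to [D_v] and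
    [D_v^+]. *)
Lemma step_data_last v s (m := schur_m v s) (l := schur_l v s) :
  (0 < v)%N -> (forall i, (i < v.-1)%N -> s`_i = 0) -> s`_v.-1 != 0 ->
  \det (hankel s v) != 0 -> \det (hankel_plus s v) != 0 ->
  step_data v 0 m l (Poly (drop v.-1 s))
    (Poly (rev [seq m`_i | i <- iota 0 v])) (l^-1)%:P 0.
Proof.
case: v @m @l => // v m l _ z0 sv D0 Dp0.
have l0 : l != 0.
  have sg : (-1) ^+ v.+2 != 0 :> R by rewrite signr_eq0.
  rewrite /l /schur_l; apply: mulf_neq0; first exact: mulf_neq0.
  by apply: mulf_neq0; rewrite ?invr_eq0.
have lE : s`_v / l = (-1) ^+ v.+2 / \det (hankel s v.+1) * \det (hankel_plus s v.+1).
  rewrite /l /schur_l /=; rewrite /= in sv; set e := (-1) ^+ v.+2.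
  have e0 : e != 0 by rewrite signr_eq0.
  have ee : e * e = 1 by rewrite -expr2 sqrr_sign.
  have -> : e / \det (hankel s v.+1) = e^-1 / \det (hankel s v.+1).
    by congr (_ / _); apply: (mulfI e0); rewrite ee divff.
  by field; rewrite sv D0 e0 Dp0.
split=> //; first exact/cpoly_rev/size_schur_m.
  set M := Poly (rev _); set U := Poly (drop _ _).
  suff E k : (k < v.+2)%N -> ((M - 'X^(v.+1) * (l^-1)%:P) * U)`_k = (k == 0)%:R.
    exists (drop_poly v.+2 ((M - 'X^(v.+1) * (l^-1)%:P) * U)).
    rewrite add0n -{1}(poly_take_drop v.+2 (_ * U)) [drop_poly _ _ * _]mulrC; congr (_ + _).
    apply/polyP => k; rewrite coef_take_poly coef1; case: ltnP => [/E //|].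
    by case: k.
  move=> kv; rewrite mulrBl coefB -mulrA coefXnM coefCM.
  have W : (M * U)`_k = \sum_(p < v.+1) m`_p * s`_(k + p).
    have -> : (M * U)`_k = (M * Poly s)`_(k + v).
      rewrite (Poly_drop z0) mulrCA coefXnM ltnNge leq_addl /= addnK //.
    pose F i := M`_i * (Poly s)`_(k + v - i).
    transitivity (\sum_(i < v.+1) F i).
      have vk : (v.+1 <= (k + v).+1)%N by rewrite ltnS leq_addl.
      rewrite coefM (big_ord_widen _ F vk) [RHS]big_mkcond; apply: eq_bigr => i _ /=.
      case: ltnP => // vi; rewrite coef_Poly nth_default ?mul0r //.
      by rewrite size_rev size_map size_iota.
    rewrite (reindex_inj rev_ord_inj); apply: eq_bigr => i _; rewrite /F /= subSS.
    have iv : (i <= v)%N by rewrite -ltnS.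
    rewrite !coef_Poly nth_rev ?size_map ?size_iota ?ltnS ?leq_subr //.
    rewrite subSS subKn // (nth_map 0%N) ?size_iota // nth_iota // add0n.
    by rewrite -addnBA ?leq_subr // subKn.
  rewrite W (schur_m_window v s k).
  case: k kv {W} => [|k]; rewrite !ltnS => kv.
    rewrite det_windows_first leq0n subr0 eqxx !exprS !mulN1r opprK mulrA.
    by rewrite mulrAC mulfVK // -expr2 sqrr_sign.
  move: kv; rewrite leq_eqVlt => /orP[/eqP ->|kv].
    rewrite det_windows_full ltnn subnn coef_Poly nth_drop addn0 -lE.
    by rewrite mulrC subrr.
  by rewrite kv subr0 det_windows_mid // mulr0.
by exists 0; rewrite !mulr0 subr0 addr0 -polyCM mulfV.
Qed.

End SchurStep.

(** * Normal indices along the recursion *)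

Section Recursion.
Variable R : realType.
Local Notation C := R[i].

Lemma hankel_behead (s : seq R) n : hankel (behead s) n = hankel_plus s n.
Proof. by apply/matrixP => i j; rewrite !mxE nth_behead. Qed.

Lemma pade_addr (F : C -> C) (c : R) n : pade F n -> pade (fun z => F z + c%:C%C) n.
Proof.
move=> [q [r [q0 sq H]]]; exists q, (r + c *: q); split=> //.
by apply: axis_eq H => z _; rewrite cpolyD cpolyZ; congr (_ * _); ring.
Qed.

(** [S^+] is the Hankel matrix of the expansion of [z f], the constant term of
    which is a polynomial. *)
Lemma pade_hankel_plus k (f : C -> C) (s : seq R) n :
  happrox k f ('X * - Poly s) -> (0 < n)%N -> (2 * n <= k)%N ->
  \det (hankel_plus s n) = 0 <-> pade (fun z => z * f z) n.
Proof.
move=> hf n0 nk; have k0 : (0 < k)%N by rewrite (leq_trans _ nk) // muln_gt0.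
have h : happrox k.-1 (fun z => z * f z + (s`_0)%:C%C) ('X * - Poly (behead s)).
  have -> : 'X * - Poly (behead s) = - Poly s + (s`_0)%:P.
    apply/polyP => -[|i]; rewrite coefXM !coefD !coefN coefC !coef_Poly /=.
      by rewrite addNr.
    by rewrite nth_behead addr0.
  apply: happroxD; last first.
    by apply: happrox_eq (happrox_cpoly _ _) => z _; rewrite cpolyC.
  have := (@happrox_shift R k.-1 1 f (- Poly s)).1; rewrite addn1 prednK //.
  by move=> /(_ hf); apply: happrox_eq => z _.
rewrite -hankel_behead (pade_hankel h n0); last by rewrite prednK.
split=> [/(@pade_addr _ (- s`_0))|/(@pade_addr _ s`_0) //].
move=> [q [r [q0 sq H]]]; exists q, r; split=> //.
by apply: axis_eq H => z _; rewrite rmorphN addrK.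
Qed.

Lemma pade_step v d m l (U M Fs S' : {poly R}) (g : C -> C) n :
  step_data v d m l U M Fs S' -> (size m <= v)%N -> (0 < n)%N ->
  happrox d g ('X * - S') ->
  (pade (step_down m l g) (v + n) <-> pade g n) /\
  (pade (fun z => z * step_down m l g z) (v + n) <-> pade (fun z => z * g z) n).
Proof.
move=> sd sm n0 hg; have [U0 Fs0 l0 M0] := step_data_neq0 sd.
have ne (c : R) : c != 0 -> c%:C%C != 0 :> C by rewrite realC_eq0.
have [lg dn] := step_down_neq0 sd hg.
have [mM _ _ v0] := sd.
have g0 : axis_cvg g 0 by have := happrox_lim hg; rewrite coefXM.
have lgl : axis_cvg (fun z => l%:C%C + g z) l%:C%C.
  by have := axisD (axis_cst l%:C%C) g0; rewrite addr0.
have hA : axis_cvg (fun z => z * cpoly m z / z ^+ v) (M`_0)%:C%C.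
  apply: axis_eq (axis_cpoly M) => z z0; rewrite mM // mulrAC divff ?mul1r //.
  by rewrite expf_neq0.
have E : gen_infty [set y | let z := (0 +i* y)%C in
    step_down m l g z * (1 - z * cpoly m z * (l%:C%C + g z)) = l%:C%C + g z].
  apply: filterS2 lg dn => y /=; set z := (0 +i* y)%C; rewrite /step_down => h1 h2.
  rewrite -(mulVf h1) -mulrBl mulKf //.
split.
- apply: (@pade_transfer R ('X * m) l%:P _ _ v 0 n (M`_0)%:C%C l%:C%C) => //.
  + exact: ne.
  + exact: ne.
  + by apply: filterS E => y /=; rewrite cpolyM cpolyX cpolyC.
  + by rewrite subn0 (leq_trans (size_polyMleq _ _)) // size_polyX.
  + by rewrite subn0; apply: axis_eq hA => z _; rewrite cpolyM cpolyX.
  + by apply: axis_eq lgl => z _; rewrite expr0 divr1 cpolyC.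
- apply: (@pade_transfer R m (l *: 'X) _ _ v 1 n (M`_0)%:C%C l%:C%C) => //.
  + exact: ne.
  + exact: ne.
  + apply: filterS E => y /=; rewrite cpolyZ cpolyX; set z := (0 +i* y)%C => E.
    transitivity (z * (step_down m l g z * (1 - z * cpoly m z * (l%:C%C + g z)))).
      by ring.
    by rewrite E; ring.
  + by rewrite subn1 prednK.
  + apply: axis_eq hA => z z0; rewrite -{1}(prednK v0) exprS invfM mulrACA divff //.
    by rewrite mul1r subn1.
  + by apply: axis_eq lgl => z z0; rewrite cpolyZ cpolyX expr1; field.
Qed.

(** Normality and regularity of the rest of a sequence, as they are carried
    along the recursion. *)
Definition regular_indices K (s : seq R) (I : nat -> Prop) := forall p, (0 < p <= K)%N ->
  (\det (hankel s p) != 0 <-> I p) /\ (I p -> \det (hankel_plus s p) != 0).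

Lemma regular_leading v K s (I : nat -> Prop) : regular_indices K s I ->
  (0 < v <= K)%N -> I v -> (forall p, (0 < p < v)%N -> ~ I p) ->
  [/\ forall i, (i < v.-1)%N -> s`_i = 0, s`_v.-1 != 0, \det (hankel s v) != 0 &
      \det (hankel_plus s v) != 0].
Proof.
move=> reg /andP[v0 vK] Iv nI; have [|h1 h2] := reg v; first by rewrite v0.
have Dv : \det (hankel s v) != 0 by apply/h1.
have [|z0 sv] := @leading_zeros R s v v0 _ Dv; last by split=> //; exact: h2.
move=> p /andP[p0 pv]; have [|h _] := reg p; first by rewrite p0 ltnW // (leq_trans pv).
by apply/eqP/negPn/negP => /h; apply: nI; rewrite p0.
Qed.

Lemma Poly_leading v (s : seq R) : (0 < v)%N -> (forall i, (i < v.-1)%N -> s`_i = 0) ->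
  'X * Poly s = 'X^v * Poly (drop v.-1 s).
Proof. by move=> v0 /Poly_drop ->; rewrite mulrA -exprS prednK. Qed.

(** The next sequence inherits the remaining indices through Pade approximants
    of the functions that its coefficients define. *)
Lemma recursion_step v K s sq fs (I : nat -> Prop)
    (m := schur_m v s) (l := schur_l v s) (d := (2 * K)%N) :
  regular_indices (v + K) s I -> (0 < v)%N -> I v ->
  (forall p, (0 < p < v)%N -> ~ I p) ->
  toeplitz (v + d.+1)
    (rev [seq m`_i | i <- iota 0 v] ++ [seq - x | x <- fs])
    *m toeplitz (v + d.+1) (drop v.-1 s) = 1%:M ->
  toeplitz d.+1 (l :: [seq - x | x <- sq]) *m toeplitz d.+1 fs = 1%:M ->
  regular_indices K sq (fun p => I (v + p)%N) /\
  exists U M Fs, step_data v d m l U M Fs (Poly sq) /\ 'X * Poly s = 'X^v * U.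
Proof.
move=> reg v0 Iv nI T1 T2.
have [|z0 sv Dv Dpv] := regular_leading reg _ Iv nI; first by rewrite v0 leq_addr.
have sd := step_data_toeplitz v0 T1 T2; rewrite -/d -/m -/l in sd.
split; last by do 3!eexists; split; [exact: sd|exact: Poly_leading].
move=> p /andP[p0 pK].
pose g z : C := cpoly ('X * - Poly sq) z^-1.
have hg k : happrox k g ('X * - Poly sq) by exact: happrox_cpoly.
have hf : happrox (d + v + v) (step_down m l g) ('X * - Poly s).
  have -> : 'X * - Poly s = 'X^v * - Poly (drop v.-1 s).
    by rewrite !mulrN (Poly_leading v0 z0).
  exact: (step_down_approx sd (hg d)).
have sm : (size m <= v)%N by exact: size_schur_m.
have [P1 P2] := pade_step sd sm p0 (hg d).
have vp0 : (0 < v + p)%N by rewrite addn_gt0 v0.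
have vpK : (2 * (v + p) <= d + v + v)%N by rewrite /d; lia.
have [|r1 r2] := reg (v + p)%N; first by rewrite vp0 leq_add2l.
have e1 : \det (hankel sq p) = 0 <-> \det (hankel s (v + p)) = 0.
  rewrite (pade_hankel (hg (2 * p)%N) p0) // (pade_hankel hf vp0) //; last exact: leqW.
  by symmetry.
have e2 : \det (hankel_plus sq p) = 0 <-> \det (hankel_plus s (v + p)) = 0.
  rewrite (pade_hankel_plus (hg (2 * p)%N) p0) // (pade_hankel_plus hf vp0) //.
  by symmetry.
split; last first.
  by move=> /r2; apply: contra => /eqP/e2/eqP.
rewrite -r1; split; apply: contra => /eqP/e1/eqP //.
Qed.

Lemma recursion_last v s (I : nat -> Prop)
    (m := schur_m v s) (l := schur_l v s) :
  regular_indices v s I -> (0 < v)%N -> I v -> (forall p, (0 < p < v)%N -> ~ I p) ->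
  exists U M Fs, step_data v 0 m l U M Fs 0 /\ 'X * Poly s = 'X^v * U.
Proof.
move=> reg v0 Iv nI.
have [|z0 sv Dv Dpv] := regular_leading reg _ Iv nI; first by rewrite v0 leqnn.
by do 3!eexists; split; [exact: step_data_last|exact: Poly_leading].
Qed.

Section Steps.
Variables (N : nat) (n : nat -> nat) (s : seq R) (m : nat -> {poly R}) (l : nat -> R).
Hypothesis N_gt0 : (0 < N)%N.
Hypothesis n_0 : n 0%N = 0%N.
Hypothesis n_increasing : forall j, (j < N)%N -> (n j < n j.+1)%N.
Hypothesis size_s : size s = (2 * n N)%N.
Hypothesis normal_indices : forall p : nat,
  normal_index s p <-> exists2 j : nat, (1 <= j <= N)%N & p = n j.
Hypothesis regular_s : forall j : nat, (1 <= j <= N)%N ->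
  \det (hankel_plus s (n j)) != 0.
Hypothesis m_l_schur : schur_recursion N n s m l.

Lemma n_lt i j : (i < j <= N)%N -> (n i < n j)%N.
Proof.
elim: j => [|j IH] /andP[//]; rewrite ltnS leq_eqVlt => /orP[/eqP ->|ij] jN.
  exact: n_increasing.
by rewrite (ltn_trans (IH _)) ?n_increasing // ij ltnW.
Qed.

Lemma n_le i j : (i <= j <= N)%N -> (n i <= n j)%N.
Proof.
move=> /andP[]; rewrite leq_eqVlt => /orP[/eqP ->//|ij jN].
by rewrite ltnW // n_lt // ij.
Qed.

Definition next_index j p := exists2 i : nat, (1 <= i <= N)%N & (n j + p)%N = n i.

Lemma next_index_gap j p : (j < N)%N -> (0 < p < n j.+1 - n j)%N -> ~ next_index j p.
Proof.
move=> jN /andP[p0 pv] [i /andP[i1 iN] E].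
have [ij|ji] := leqP i j.
  have : (n i <= n j)%N by apply: n_le; rewrite ij ltnW.
  by rewrite -E -{2}[n j]addn0 leq_add2l leqNgt p0.
have : (n j.+1 <= n i)%N by apply: n_le; rewrite ji.
by rewrite -E -(subnKC (ltnW (n_increasing jN))) leq_add2l leqNgt pv.
Qed.

Lemma recursion_steps : exists Sg : nat -> {poly R},
  [/\ Sg 0%N = Poly s, Sg N = 0 & forall j, (1 <= j <= N)%N ->
    (size (m j) <= n j - n j.-1)%N /\ exists U M Fs,
     step_data (n j - n j.-1) (2 * n N - 2 * n j) (m j) (l j) U M Fs (Sg j) /\
     'X * Sg j.-1 = 'X^(n j - n j.-1) * U].
Proof.
have [sq [fs [sq0 ml Hrec]]] := m_l_schur.
have reg j : (j < N)%N -> regular_indices (n N - n j) (sq j) (next_index j).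
  elim: j => [|j IH] jN.
    move=> p /andP[p0 pN]; rewrite n_0 subn0 in pN; rewrite sq0; split; last first.
      by move=> [i iN]; rewrite n_0 add0n => ->; exact: regular_s.
    have E : normal_index s p = (\det (hankel s p) != 0).
      rewrite /normal_index p0 size_s (_ : (2 * p - 1 <= 2 * n N)%N) //.
      by rewrite (leq_trans (leq_subr _ _)) // leq_mul2l.
    rewrite -E normal_indices /next_index n_0 add0n.
    by split=> -[i h1 h2]; exists i.
  have jN' := ltnW jN.
  have [|hs hf T1 T2] := Hrec j.+1; first by rewrite /=; case: (N) jN.
  have [|Em El] := ml j.+1; first by rewrite /= jN'.
  set v := (n j.+1 - n j.+1.-1)%N in Em El T1 T2.
  have nj : (n j < n j.+1)%N by exact: n_increasing.
  have nN : (n j.+1 <= n N)%N by apply: n_le; rewrite jN' leqnn.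
  have vE : (n N - n j = v + (n N - n j.+1))%N by rewrite /v /=; lia.
  have dE : (2 * n N - 2 * n j.+1 = 2 * (n N - n j.+1))%N by rewrite mulnBr.
  rewrite dE Em El in T1 T2.
  have v0 : (0 < v)%N by rewrite subn_gt0.
  have [|||rg _] := @recursion_step v (n N - n j.+1) (sq j) (sq j.+1) (fs j.+1) (next_index j) _ v0 _ _ T1 T2.
  - by rewrite -vE; exact: IH.
  - by exists j.+1; rewrite //= subnKC // ltnW.
  - by move=> p; exact: next_index_gap.
  move=> p /rg; rewrite /next_index addnA /v /= subnKC // ltnW //.
exists (fun j => if (j < N)%N then Poly (sq j) else 0); split.
- by rewrite N_gt0 sq0.
- by rewrite ltnn.
case=> // j /andP[_ jN]; rewrite jN /=.
have [|Em El] := ml j.+1; first by rewrite /= jN.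
have nj : (n j < n j.+1)%N by exact: n_increasing.
have v0 : (0 < n j.+1 - n j)%N by rewrite subn_gt0.
have Ij : next_index j (n j.+1 - n j) by exists j.+1; rewrite //= subnKC // ltnW.
split; first by rewrite Em; exact: size_schur_m.
have gap p : (0 < p < n j.+1 - n j)%N -> ~ next_index j p by exact: next_index_gap.
move: jN; rewrite leq_eqVlt => /orP[/eqP jN|jN].
  rewrite (_ : (j.+1 < N)%N = false); last by rewrite jN ltnn.
  rewrite (_ : 2 * n N - 2 * n j.+1 = 0)%N; last by rewrite jN subnn.
  rewrite Em El /=.
  apply: recursion_last (v0) (Ij) (gap).
  by have := reg j; rewrite -jN; apply.
rewrite jN; have [|hs hf T1 T2] := Hrec j.+1; first by rewrite /=; case: (N) jN.
have nN : (n j.+1 <= n N)%N by apply: n_le; rewrite (ltnW jN) leqnn.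
have vE : (n N - n j = n j.+1 - n j + (n N - n j.+1))%N by lia.
have dE : (2 * n N - 2 * n j.+1 = 2 * (n N - n j.+1))%N by rewrite mulnBr.
rewrite dE Em El /= in T1 T2 *.
have rg : regular_indices (n j.+1 - n j + (n N - n j.+1)) (sq j) (next_index j).
  by rewrite -vE; exact/reg/ltnW.
by have [_ ?] := recursion_step rg v0 Ij gap T1 T2.
Qed.

End Steps.

End Recursion.

(** * Chains of fractional linear maps *)

Section Chain.
Variable R : realType.
Local Notation C := R[i].
Implicit Types (F G H f : C -> C).

(** A single point where [F] is nonzero suffices, by the identity theorem. *)
Lemma axis_generic_neq0 F : quasi F -> gsym F ->
  gen_infty [set y | F (0 +i* y)%C != 0] -> generic [set z | F z != 0].
Proof.
move=> qF sF [Y HY]; pose y := Num.max Y 1.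
have y0 : 0 < y by rewrite lt_max ltr01 orbT.
apply: (@quasi_generic_neq0 R F (0 +i* y)%C) => // /dnbhs_cabs[r r0 F0].
have [|r' r'0 F1] := (dnbhsR _ _).1 (HY y _); first by rewrite le_max lexx.
pose e := Num.min r r' / 2.
have m0 : 0 < Num.min r r' by rewrite lt_min r0.
have e0 : 0 < e by rewrite divr_gt0.
have em : e < Num.min r r' by rewrite /e ltr_pdivrMr // ltr_pMr // (ltr1n _ 2).
have ne : y + e != y by rewrite -subr_eq0 addrC addKr gt_eqF.
have [er er'] : e < r /\ e < r' by move: em; rewrite lt_min => /andP.
have /= := F1 (y + e) ne; rewrite addrC addKr gtr0_norm // => /(_ er')/eqP; apply.
apply: F0; first by rewrite eq_complex /= eqxx (negPf ne).
by rewrite iyB cabs_iy [y + e]addrC addrK gtr0_norm.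
Qed.

(** Symmetric and meromorphic, up to values at the points of a discrete set. *)
Definition nice F := quasi F /\ gsym F.

Lemma nice_step_up m l F : nice F -> nice (step_up m l F).
Proof.
move=> [qF sF]; split; last first.
  apply: genericS sF => z /= Fz; rewrite /step_up Fz.
  by rewrite rmorphB fmorphV rmorphD fmorphV rmorphM /= cpoly_conj conj_realC.
apply: quasiD; last exact: quasi_cst.
by apply/quasiV/quasiD; [exact: quasiV|apply: quasiM; [exact: quasi_id|exact: quasi_cpoly]].
Qed.

Lemma nice_step_down m l G : nice G -> nice (step_down m l G).
Proof.
move=> [qG sG]; split; last first.
  apply: genericS sG => z /= Gz; rewrite /step_down Gz.
  by rewrite fmorphV rmorphB fmorphV rmorphD rmorphM /= cpoly_conj conj_realC.
apply/quasiV/quasiD; first by apply/quasiV/quasiD => //; exact: quasi_cst.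
by apply: quasiN; apply: quasiM; [exact: quasi_id|exact: quasi_cpoly].
Qed.

Lemma link_up v d m l (U M Fs S' : {poly R}) f : step_data v d m l U M Fs S' ->
  nice f -> happrox (d + v + v) f ('X^v * - U) -> link m l f (step_up m l f).
Proof.
move=> sd nf hf; have [f0 g0] := step_up_neq0 sd hf.
have G1 := axis_generic_neq0 nf.1 nf.2 f0.
have [q2 s2] : nice (fun z => (f z)^-1 + z * cpoly m z).
  split; last first.
    apply: genericS nf.2 => z /= fz.
    by rewrite fz rmorphD fmorphV rmorphM /= cpoly_conj.
  by apply: quasiD; [exact/quasiV/nf.1|apply: quasiM; [exact: quasi_id|exact: quasi_cpoly]].
have G2 := axis_generic_neq0 q2 s2 g0.
apply: genericS (generic_and G1 G2) => z /= [h1 h2].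
by rewrite /step_up addrC subrK invr_eq0 invrK.
Qed.

Lemma link_down v d m l (U M Fs S' : {poly R}) g : step_data v d m l U M Fs S' ->
  nice g -> happrox d g ('X * - S') -> link m l (step_down m l g) g.
Proof.
move=> sd ng hg; have [g0 h0] := step_down_neq0 sd hg.
have [q1 s1] : nice (fun z => l%:C%C + g z).
  split; first by apply: quasiD ng.1; exact: quasi_cst.
  by apply: genericS ng.2 => z /= gz; rewrite gz rmorphD /= conj_realC.
have G1 := axis_generic_neq0 q1 s1 g0.
have [q2 s2] : nice (fun z => (l%:C%C + g z)^-1 - z * cpoly m z).
  split.
    apply: quasiD; first exact: quasiV.
    by apply: quasiN; apply: quasiM; [exact: quasi_id|exact: quasi_cpoly].
  apply: genericS s1 => z /= gz.
  by rewrite gz rmorphB fmorphV rmorphM /= cpoly_conj.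
have G2 := axis_generic_neq0 q2 s2 h0.
apply: genericS (generic_and G1 G2) => z /= [h1 h2].
by rewrite /step_down invr_eq0 invrK subrK.
Qed.

Section FixedData.
Variables (N : nat) (m : nat -> {poly R}) (l : nat -> R) (v D : nat -> nat)
  (Sg : nat -> {poly R}).
Hypothesis D_step : forall j, (1 <= j <= N)%N -> D j.-1 = (D j + v j + v j)%N.
Hypothesis steps : forall j, (1 <= j <= N)%N -> exists U M Fs,
     step_data (v j) (D j) (m j) (l j) U M Fs (Sg j) /\ 'X * Sg j.-1 = 'X^(v j) * U.

Definition linked (F : nat -> C -> C) := forall j, (1 <= j <= N)%N ->
  link (m j) (l j) (F j.-1) (F j) /\ axis_cvg (F j) 0.

Definition expands j f := happrox (D j) f ('X * - Sg j).

Lemma expands_cvg0 j f : expands j f -> axis_cvg f 0.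
Proof. by move=> /happrox_lim; rewrite coefXM. Qed.

Lemma chain_up f : nice f -> expands 0 f -> exists F : nat -> C -> C,
  [/\ F 0%N = f, linked F, nice (F N) & expands N (F N)].
Proof.
move=> nf ef; pose fix F j := if j is j'.+1 then step_up (m j) (l j) (F j') else f.
have H j : (j <= N)%N -> nice (F j) /\ expands j (F j).
  elim: j => [//|j IH] jN; have [nj ej] := IH (ltnW jN).
  split; first exact: nice_step_up.
  have [//|U [M [Fs [sd E]]]] := steps (j := j.+1).
  apply: (step_up_approx sd); have := D_step (j := j.+1) jN; rewrite /= => <-.
  by rewrite mulrN -E -mulrN.
have [h1 h2] := H N (leqnn N); exists F; split=> //.
move=> [//|j] jN; have [nj ej] := H j (ltnW jN); have [nj' ej'] := H j.+1 jN.
split; last exact: expands_cvg0 ej'.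
have [//|U [M [Fs [sd E]]]] := steps (j := j.+1).
apply: (link_up sd) => //; have := D_step (j := j.+1) jN; rewrite /= => <-.
by rewrite mulrN -E -mulrN.
Qed.

Lemma chain_down g : nice g -> expands N g -> exists F : nat -> C -> C,
  [/\ F N = g, linked F, nice (F 0%N) & expands 0 (F 0%N)].
Proof.
move=> ng eg.
pose fix G j := if j is j'.+1 then step_down (m (N - j')) (l (N - j')) (G j') else g.
have H j : (j <= N)%N -> nice (G j) /\ expands (N - j) (G j).
  elim: j => [|j IH] jN; first by rewrite subn0.
  have [nj ej] := IH (ltnW jN).
  split; first exact: nice_step_down.
  have jN' : (1 <= N - j <= N)%N by rewrite subn_gt0 jN leq_subr.
  have [U [M [Fs [sd E]]]] := steps jN'.
  rewrite /expands subnS D_step // mulrN E -mulrN.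
  exact: (step_down_approx sd).
exists (fun j => G (N - j)%N); split.
- by rewrite subnn.
- move=> j jN; have /andP[j1 jN'] := jN.
  have [nj ej] := H (N - j)%N (leq_subr _ _); rewrite subKn // in ej.
  split; last exact: expands_cvg0 ej.
  have [U [M [Fs [sd E]]]] := steps jN.
  have -> : (N - j.-1 = (N - j).+1)%N by lia.
  by rewrite /= subKn //; exact: (link_down sd).
- by rewrite subn0; exact: (H N (leqnn _)).1.
- by rewrite subn0; have := (H N (leqnn _)).2; rewrite subnn.
Qed.

(** One step multiplies numerator and denominator by [(l + F_(j+1)) / F_j]. *)
Lemma linked_quotient (F : nat -> C -> C) j : linked F -> (j <= N)%N -> generic [set z |
  cpoly (P_plus m l j).2 z + cpoly (P_plus m l j).1 z * F j z != 0 /\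
  F 0%N z = (cpoly (Q_plus m l j).2 z + cpoly (Q_plus m l j).1 z * F j z) /
            (cpoly (P_plus m l j).2 z + cpoly (P_plus m l j).1 z * F j z)].
Proof.
move=> lF; elim: j => [|j IH] jN.
  apply: genericT => z /=.
  rewrite /P_plus /Q_plus /= !cpoly0 !cpoly1 mul0r addr0 add0r mul1r divr1.
  by rewrite oner_neq0.
have [|lk _] := lF j.+1; first by rewrite jN.
apply: genericS (generic_and lk (IH (ltnW jN))) => z /= [[F0 lG E] [den ->]].
have T X0 : cpoly (three_term m l X0 j.+1).2 z
      + cpoly (three_term m l X0 j.+1).1 z * F j.+1 z =
    ((l j.+1)%:C%C + F j.+1 z) / F j z *
    (cpoly (three_term m l X0 j).2 z + cpoly (three_term m l X0 j).1 z * F j z).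
  rewrite /= !cpolyD cpolyZ !cpolyD !cpolyM cpolyN cpolyX.
  move: (cpoly (three_term m l X0 j).2 z) (cpoly (three_term m l X0 j).1 z) => x y.
  have Fi : (F j z)^-1 = ((l j.+1)%:C%C + F j.+1 z)^-1 - z * cpoly (m j.+1) z.
    by rewrite -E addrK.
  have -> : ((l j.+1)%:C%C + F j.+1 z) / F j z * (x + y * F j z) =
      ((l j.+1)%:C%C + F j.+1 z) * (x * (F j z)^-1 + y) by field.
  by rewrite Fi; field.
have h : ((l j.+1)%:C%C + F j.+1 z) / F j z != 0 by rewrite mulf_neq0 ?invr_eq0.
rewrite !T mulf_neq0 //; split=> //.
by rewrite -mulf_div divff // mul1r.
Qed.

End FixedData.

End Chain.

(** * The total change of indices *)

Section Indices.
Variable R : realType.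
Local Notation C := R[i].
Local Open Scope sesquilinear_scope.
Variables (N : nat) (n : nat -> nat) (s : seq R) (m : nat -> {poly R}) (l : nat -> R).
Hypothesis N_gt0 : (0 < N)%N.
Hypothesis n_0 : n 0%N = 0%N.
Hypothesis n_increasing : forall j, (j < N)%N -> (n j < n j.+1)%N.
Hypothesis size_s : size s = (2 * n N)%N.
Hypothesis normal_indices : forall p : nat,
  normal_index s p <-> exists2 j : nat, (1 <= j <= N)%N & p = n j.
Hypothesis regular_s : forall j : nat, (1 <= j <= N)%N ->
  \det (hankel_plus s (n j)) != 0.
Hypothesis m_l_schur : schur_recursion N n s m l.

Let v j := (n j - n j.-1)%N.
Let D j := (2 * n N - 2 * n j)%N.

Lemma order_step j : (1 <= j <= N)%N -> D j.-1 = (D j + v j + v j)%N.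
Proof.
case: j => // j jN; rewrite /D /v /=.
have : (n j <= n j.+1)%N by rewrite ltnW // n_increasing.
have : (n j.+1 <= n N)%N by apply: n_le n_increasing _ _ _; rewrite leqnn andbT.
by move: (n j) (n j.+1) (n N) => x y z; clear; lia.
Qed.

Lemma sum_steps : \sum_(1 <= j < N.+1) v j = n N.
Proof.
suff H j : (j <= N)%N -> \sum_(1 <= i < j.+1) v i = n j by exact: H.
elim: j => [|j IH] jN; first by rewrite big_geq.
rewrite big_nat_recr //= (IH (ltnW jN)).
by rewrite -[RHS](subnKC (ltnW (n_increasing jN))).
Qed.

Lemma hankel_sym (p : nat) : (hankel s p)^T = hankel s p.
Proof. by apply/matrixP => i j; rewrite !mxE addnC. Qed.

Lemma hankel_plus_sym (p : nat) : (hankel_plus s p)^T = hankel_plus s p.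
Proof. by apply/matrixP => i j; rewrite !mxE addnC. Qed.

Variable Sg : nat -> {poly R}.
Hypothesis Sg0 : Sg 0%N = Poly s.
Hypothesis SgN : Sg N = 0.
Hypothesis steps : forall j, (1 <= j <= N)%N ->
    (size (m j) <= v j)%N /\ exists U M Fs,
     step_data (v j) (D j) (m j) (l j) U M Fs (Sg j) /\ 'X * Sg j.-1 = 'X^(v j) * U.

Let steps' j (jN : (1 <= j <= N)%N) := (steps jN).2.

Lemma expands_last (g : C -> C) : axis_cvg g 0 <-> expands D Sg N g.
Proof.
rewrite /expands /D subnn SgN oppr0 mulr0.
by split; apply: axis_eq => z _; rewrite expr0 mul1r cpoly0 subr0.
Qed.

(** The Hankel matrix bounds [a] and [a'] from below by the numbers of its
    negative and of its positive eigenvalues, which add up to [p]. *)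
Lemma hankel_index p (S : 'M[R]_p) k g (P : {poly R}) a a' :
  happrox k g P -> (2 * p <= k.+1)%N -> (forall i j : 'I_p, S i j = - P`_(i + j).+1) ->
  S^T = S -> \det S != 0 -> (a + a' <= p)%N ->
  ~ negG g a.+1 -> ~ negG (fun z => - g z) a'.+1 -> a = nu_minus S.
Proof.
move=> hg pk SP ST S0 aa ga ga'.
have [L [d [LL SE]]] := symmetric_diag ST.
rewrite (nu_minus_diag LL SE).
have h1 := negG_leF (negG_hankel hg pk SP LL SE) ga.
have h2 : negG (fun z => - g z) #|[set i | (- d i < 0)%R]%SET|.
  have dN : ddiag (fun i => - d i) = - ddiag d :> 'M[C]_p.
    apply/matrixP => i j; rewrite !mxE rmorphN /=.
    by case: eqVneq => _; rewrite ?mulr0n ?oppr0.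
  have SNP (i j : 'I_p) : (- S) i j = - (- P)`_(i + j).+1 by rewrite mxE SP coefN.
  have SNE : map_mx (real_complex R) (- S) = L^t* *m ddiag (fun i => - d i) *m L.
    by rewrite map_mxN SE dN mulmxN mulNmx.
  exact: (negG_hankel (happroxN hg) pk SNP LL SNE).
have := negG_leF h2 ga'; have := nonsingular_signs SE S0.
move: aa h1; set x := #|_|; set y := #|_|; lia.
Qed.

(** The increments do not depend on the chain, and the chain that ends in [0]
    gives their values. *)
Lemma schur_indices (F : nat -> C -> C) : linked N m l F -> forall b,
  (negG (F 0%N) (b + nu_minus (hankel s (n N))) <-> negG (F N) b) /\
  (negG (fun z => z * F 0%N z) (b + nu_minus (hankel_plus s (n N))) <->
   negG (fun z => z * F N z) b).
Proof.
have [|a [a' [c [c' [aa cc H]]]]] := @chain_indices R N v m l.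
  move=> j jN; have [sm [U [M [Fs [sd _]]]]] := steps jN.
  have [_ _ l0 _] := step_data_neq0 sd.
  by split=> //; case: sd.
rewrite sum_steps in aa cc.
have nice0 : nice (fun=> 0 : C).
  by split; [exact: quasi_cst|apply: genericT => z /=; rewrite rmorph0].
have e0 : expands D Sg N (fun=> 0 : C) by apply: (expands_last _).1; exact: axis_cst.
have [G [GN lG nG eG]] := chain_down order_step steps' nice0 e0.
have {}HG := H G lG.
have zero g : (forall z, g z = 0 :> C) -> ~ negG g 1.
  by move=> g0 /(negG_ext (genericT g0))/negG_zero.
rewrite /expands Sg0 /D n_0 muln0 subn0 in eG.
have NN : (1 <= N <= N)%N by rewrite N_gt0 leqnn.
have aE : a = nu_minus (hankel s (n N)).
  apply: (hankel_index eG _ _ _ _ aa); first exact: leqW.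
  - by move=> i j; rewrite coefXM coefN coef_Poly opprK mxE.
  - exact: hankel_sym.
  - have /and3P[_ _ //] : normal_index s (n N) by apply/normal_indices; exists N.
  - by have [h _ _ _] := HG 1%N; rewrite -add1n h GN; exact: zero.
  - have [_ h _ _] := HG 1%N; rewrite -add1n h GN; apply: zero => z.
    by rewrite oppr0.
have nN0 : (0 < n N)%N.
  by rewrite -n_0; apply: (n_lt n_increasing); rewrite N_gt0 leqnn.
have cE : c = nu_minus (hankel_plus s (n N)).
  have ez : happrox (2 * n N).-1 (fun z => z * G 0%N z) (- Poly s).
    have := (@happrox_shift R (2 * n N).-1 1 (G 0%N) (- Poly s)).1.
    rewrite addn1 prednK ?muln_gt0 //= => /(_ eG); apply: happrox_eq => z _.
    by rewrite expr1.
  apply: (hankel_index ez _ _ _ _ cc); first by rewrite prednK ?muln_gt0.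
  - by move=> i j; rewrite coefN coef_Poly opprK mxE.
  - exact: hankel_plus_sym.
  - exact: regular_s.
  - have [_ _ h _] := HG 1%N; rewrite -add1n h GN; apply: zero => z.
    by rewrite mulr0.
  - have [_ _ _ h] := HG 1%N; rewrite -add1n h GN; apply: zero => z.
    by rewrite mulr0 oppr0.
by move=> lF b; have [h1 _ h2 _] := H F lF b; rewrite -aE -cE.
Qed.

End Indices.

(** * Values on the axis, and pairs of points *)

Section AxisValues.
Variable R : realType.
Local Notation C := R[i].
Implicit Types (f g tau : C -> C) (z : C).

Lemma hol_cpolyV (p : {poly R}) z : z != 0 -> holomorphic_at (fun w => cpoly p w^-1) z.
Proof.
move=> z0; elim/poly_ind: p => [|p c IH].
  have -> : (fun w => cpoly (0 : {poly R}) w^-1) = (fun=> 0 : C).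
    by apply/funext => w; rewrite cpoly0.
  exact: hol_cst.
have -> : (fun w => cpoly (p * 'X + c%:P) w^-1) =
    (fun w => cpoly p w^-1 * w^-1 + c%:C%C).
  by apply/funext => w; rewrite cpolyD cpolyM cpolyX cpolyC.
apply: holD; last exact: hol_cst.
by apply: holM IH _; apply: holV z0; exact: hol_id.
Qed.

(** Off its poles, a meromorphic function takes no values but the limits of
    its values nearby, and a pole contradicts the bound; so the estimate
    extends to the exceptional points. *)
Lemma meromorphic_axis_le f p k (y e : R) : meromorphic f -> 0 < y ->
  (\forall t \near (y : R^o)^', let z := (0 +i* t)%C in
     cabs (z ^+ k * (f z - cpoly p z^-1)) <= e) ->
  cabs ((0 +i* y)%C ^+ k * (f (0 +i* y)%C - cpoly p (0 +i* y)%C^-1)) <= e.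
Proof.
move=> mf y0; set z0 := (0 +i* y)%C => H.
have z00 : z0 != 0 by exact: iy_neq0.
have Iz : complex.Im z0 != 0 by rewrite /= gt_eqF.
pose h z := z ^+ k * (f z - cpoly p z^-1).
have hpow : holomorphic_at (fun z => z ^+ k) z0 by apply: hol_pow; exact: hol_id.
have [hf|[g [q [q0 hg g0 fg]]]] := mf z0 Iz.
  have hh : holomorphic_at h z0.
    apply: (holM hpow); apply: (holD hf); apply: holN; exact: hol_cpolyV.
  rewrite leNgt; apply/negP => lt; have d0 : 0 < cabs (h z0) - e by rewrite subr_gt0.
  have /cvgC/(_ _ d0)/near_dnbhs/near_axis Hh := hol_cvg hh.
  have [t [/= h1 h2]] := filter_ex (filterI H Hh).
  have := cabs_sub (h z0) (h (0 +i* t)%C); rewrite cabsB leNgt => /negP; apply.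
  by rewrite (lt_le_trans h2) // lerB.
have ph : pole_at h z0.
  exists (fun z => z ^+ k * g z - z ^+ k * cpoly p z^-1 * (z - z0) ^+ q), q; split; first exact: q0.
  - apply: holD; first exact: (holM hpow hg).
    apply: holN; apply: holM; first by apply: (holM hpow); exact: hol_cpolyV.
    by apply: hol_pow; exact: hol_sub.
  - by rewrite subrr expr0n gtn_eqF //= mulr0 subr0 mulf_neq0 // expf_neq0.
  - apply: filterS2 fg (dnbhs_neq z0) => z fz zz; rewrite /h fz.
    have d : (z - z0) ^+ q != 0 by rewrite expf_neq0 // subr_eq0.
    by field.
have Hh := near_axis (pole_large e ph).
have [t [/= h1 h2]] := filter_ex (filterI H Hh).
by move: h2; rewrite ltNge h1.
Qed.

Lemma cpoly_moments (s : seq R) l z : size s = l.+1 ->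
  cpoly ('X * - Poly s) z^-1 = - \sum_(j < l.+1) (s`_j)%:C%C / z ^+ j.+1.
Proof.
move=> sl; have hs : (size (Poly s) <= l.+1)%N by rewrite -sl size_Poly.
rewrite cpolyM cpolyN cpolyX (cpolyE _ hs) mulrN mulr_sumr; congr (- _).
apply: eq_bigr => j _; rewrite coef_Poly mulrCA; congr (_ * _).
by rewrite -exprS exprVn.
Qed.

Lemma littleo_happrox f (s : seq R) l : meromorphic f -> size s = l.+1 ->
  littleo_pinfty
      (fun y => f (0 +i* y)%C -
                (- \sum_(j < l.+1) (s`_j)%:C%C / (0 +i* y)%C ^+ j.+1))
      (fun y => 1 / (0 +i* y)%C ^+ l.+1) <-> happrox l.+1 f ('X * - Poly s).
Proof.
move=> mf sl.
have E (y e : R) : 0 < y -> (`|f (0 +i* y)%C -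
      (- \sum_(j < l.+1) (s`_j)%:C%C / (0 +i* y)%C ^+ j.+1)| <=
    e%:C%C * `|1 / (0 +i* y)%C ^+ l.+1|) =
    (cabs ((0 +i* y)%C ^+ l.+1 * (f (0 +i* y)%C - cpoly ('X * - Poly s) (0 +i* y)%C^-1)) <= e).
  move=> y0; rewrite -(cpoly_moments _ sl) !normcabs -rmorphM /= lecR.
  have z0 : 0 < cabs ((0 +i* y)%C ^+ l.+1) by rewrite cabs_gt0 expf_neq0 ?iy_neq0.
  by rewrite mul1r cabsV ler_pdivlMr // cabsM mulrC.
split=> [H|H].
  apply/axis_cvgP => e e0; have e2 : 0 < e / 2 by rewrite divr_gt0.
  apply: filterS2 (gen_infty_pinfty (H _ e2)) (gen_infty_gt 0) => y /= h y0.
  rewrite E // in h; rewrite subr0 (le_lt_trans h) //.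
  by rewrite ltr_pdivrMr // ltr_pMr // (ltr1n _ 2).
move=> e e0; have [Y HY] := (axis_cvgP _ _).1 H e e0.
exists (Num.max Y 0); split; first exact: num_real.
move=> y; rewrite gt_max => /andP[Yy y0]; rewrite E //.
apply: meromorphic_axis_le => //; apply: filterS (HY y (ltW Yy)) => t /=.
by rewrite subr0 => /ltW.
Qed.

Lemma nontangential_axis tau : nontangential_o1 tau -> axis_cvg tau 0.
Proof.
move=> H; apply/axis_cvgP => e e0.
have p0 := @pi_gt0 R; have p4 : 0 < pi / 4 :> R by rewrite divr_gt0.
apply: gen_infty_pinfty; apply: filterS (H _ p4 _ e0) => r /(_ (pi / 2)).
rewrite cos_pihalf sin_pihalf mulr0 mulr1 normcabs ltcR /= subr0; apply.
by apply/andP; split; lra.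
Qed.

Lemma sin_sector (e t : R) : 0 < e -> e < t < pi - e -> sin e <= sin t.
Proof.
move=> e0 /andP[et te]; have p0 := @pi_gt0 R.
have inc (x : R) : e < x -> x <= pi / 2 -> sin e <= sin x.
  move=> ex xp; apply/ltW; rewrite ltr_sin // in_itv /=; apply/andP; split; lra.
have [tp|pt] := leP t (pi / 2); first exact: inc.
have -> : sin t = sin (pi - t).
  by rewrite sinB sinpi cospi mul0r sub0r mulN1r opprK.
by apply: inc; lra.
Qed.

End AxisValues.

Section Nontangential.
Variable R : realType.
Local Notation C := R[i].
Local Open Scope sesquilinear_scope.
Implicit Types (tau : C -> C) (a z w : C).

Lemma sub_conj z : z - Num.conj z = 'i%C * (2 * complex.Im z)%:C%C.
Proof. by case: z => x y; apply/eqP; rewrite eq_complex /=; apply/andP; split; apply/eqP; ring. Qed.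

Lemma cabs_sub_conj z : 0 < complex.Im z -> cabs (z - Num.conj z) = 2 * complex.Im z.
Proof. by move=> h; rewrite sub_conj cabsM cabsi mul1r cabs_real gtr0_norm // mulr_gt0. Qed.

Lemma cabs_pick_diag tau z : 0 < complex.Im z ->
  cabs (pick tau z z) <= cabs (tau z) / complex.Im z.
Proof.
move=> h; rewrite /pick cabsM cabsV (cabs_sub_conj h) invfM mulrA ler_pM2r ?invr_gt0 //.
rewrite ler_pdivrMr // (le_trans (cabsD _ _)) // cabsN cabs_conj; lra.
Qed.

(** Two points, one on the imaginary axis where [tau] is small and one in a
    sector where it is not, at comparable distances from the origin, span a
    negative direction: the off-diagonal entry dominates. *)
Lemma negative_pair tau (del sig s : R) : 0 < del -> 0 < sig ->
  s = 4 * ((del * sig)^-1 + 2) ->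
  exists2 eta : R, 0 < eta & forall a (t : R), 0 < cabs a -> sig * cabs a <= complex.Im a ->
    del <= cabs (tau a) -> cabs a / 2 <= t -> t <= 2 * cabs a ->
    cabs (tau (0 +i* t)%C) <= eta ->
  exists u : 'rV[C]_2, let w : 'cV[C]_2 := \col_i (if i == 0 then a else (0 +i* t)%C) in
    [/\ (u *m pickmx tau w w *m u^t*) 0 0 = -1,
        cabs (u 0 0) * cabs (tau a) <= Num.sqrt (cabs a) &
        cabs (u 0 1) <= s * Num.sqrt (cabs a)].
Proof.
move=> d0 s0 sE; have ds : 0 < (del * sig)^-1 by rewrite invr_gt0 mulr_gt0.
have sp : 0 < s by rewrite sE; nra.
have ep : 0 < (2 * s ^+ 2)^-1 by rewrite invr_gt0 mulr_gt0 // exprn_gt0.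
exists (Num.min (del / 2) (2 * s ^+ 2)^-1); first by rewrite lt_min ep divr_gt0.
move=> a t a0 sa da at1 at2; set w2 : C := (0 +i* t)%C.
rewrite le_min => /andP[h1 h2].
set r := cabs a in a0 sa at1 at2 *; set g := cabs (tau a) in da *.
have Ia : 0 < complex.Im a by rewrite (lt_le_trans _ sa) // mulr_gt0.
have t0 : 0 < t by rewrite (lt_le_trans _ at1) // divr_gt0.
have g0 : 0 < g by rewrite (lt_le_trans d0).
have Iw : 0 < complex.Im w2 by [].
pose p := pick tau a w2.
have pE : g / (8 * r) <= cabs p.
  rewrite /p /pick conj_iy opprK cabsM cabsV.
  have aw : cabs (a + w2) <= 4 * r.
    rewrite (le_trans (cabsD _ _)) // cabs_iy gtr0_norm // -/r; lra.
  have aw0 : 0 < cabs (a + w2).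
    rewrite cabs_gt0; apply: contraTneq Ia => /(congr1 (@complex.Im R)).
    by rewrite raddfD /= => /eqP; rewrite addr_eq0 => /eqP ->; rewrite oppr_gt0 -leNgt ltW.
  have num : g / 2 <= cabs (tau a - Num.conj (tau w2)).
    rewrite (le_trans _ (cabs_sub _ _)) // cabs_conj -/g.
    by move: h1 da; rewrite -/w2; lra.
  rewrite ler_pdivrMr ?mulr_gt0 // mulrAC ler_pdivlMr //.
  have := ler_pM _ _ num aw; nra.
have p0 : 0 < cabs p by rewrite (lt_le_trans _ pE) // divr_gt0 // mulr_gt0.
have pn0 : p != 0 by rewrite -cabs_gt0.
pose q := Num.sqrt r; have q0 : 0 < q by rewrite sqrtr_gt0.
have qq : q * q = r by rewrite -expr2 sqr_sqrtr // ltW.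
(* weights for which the contribution of [p] is real and negative, of order
   [s]; the division by [g] covers points near poles of [tau], where [tau a]
   may be arbitrarily large *)
pose x := q / g; have x0 : 0 < x by rewrite divr_gt0.
pose b : C := - (q * s / cabs p)%:C%C * p.
pose u0 : 'rV[C]_2 := \row_j (if j == 0 then x%:C%C else b).
pose w : 'cV[C]_2 := \col_i (if i == 0 then a else w2).
have cb : cabs b = q * s.
  rewrite cabsM cabsN cabs_real gtr0_norm ?mulfVK ?gt_eqF //.
  by rewrite divr_gt0 // mulr_gt0.
have bp : b * Num.conj p = - (q * s * cabs p)%:C%C.
  have pp : p * Num.conj p = (cabs p ^+ 2)%:C%C by rewrite -normCK normcabs rmorphXn.
  transitivity (- ((q * s / cabs p)%:C%C * (p * Num.conj p))); first by rewrite /b; ring.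
  rewrite pp -rmorphM /= -!rmorphN; congr (_%:C)%C.
  by field; rewrite gt_eqF.
pose c := (u0 *m pickmx tau w w *m u0^t*) 0 0.
have cE : c = (x ^+ 2)%:C%C * pick tau a a - (2 * x * (q * s * cabs p))%:C%C
    + b * Num.conj b * pick tau w2 w2.
  have r1 : (x ^+ 2)%:C%C = x%:C%C * x%:C%C :> C by rewrite expr2 rmorphM.
  have r2 y : (2 * x * y)%:C%C = x%:C%C * y%:C%C + x%:C%C * y%:C%C :> C.
    by rewrite -rmorphM -rmorphD /=; congr (_%:C)%C; ring.
  rewrite r1 r2 /c mxE !big_ord_recl big_ord0 !mxE !big_ord_recl !big_ord0 !mxE /=.
  rewrite -[pick tau w2 a]pick_conj -/p conj_realC !addr0.
  have e1 : p * Num.conj b = - (q * s * cabs p)%:C%C.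
    by rewrite -[LHS]conjCK rmorphM /= conjCK mulrC bp rmorphN /= conj_realC.
  rewrite !mulrDl -[x%:C%C * p * _]mulrA e1 bp.
  ring.
have cr : Num.conj c = c.
  rewrite /c; set G := _ *m _ *m _; have GH : G^t* = G by exact: gram_herm.
  by rewrite -{2}GH trmxCE.
have cR : c = (complex.Re c)%:C%C.
  apply/eqP; rewrite eq_complex /= eqxx /=; have := congr1 (@complex.Im R) cr.
  by rewrite Im_conj => h; apply/eqP; lra.
have c1 : complex.Re c <= -1.
  have A : complex.Re ((x ^+ 2)%:C%C * pick tau a a) <= (del * sig)^-1.
    rewrite (le_trans (ler_norm _)) // (le_trans (Re_le_cabs _)) // cabsM cabs_real.
    rewrite ger0_norm ?sqr_ge0 //.
    have := cabs_pick_diag tau Ia; rewrite -/g => K.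
    apply: (le_trans (ler_wpM2l (sqr_ge0 _) K)).
    have -> : x ^+ 2 * (g / complex.Im a) = r / (g * complex.Im a).
      by rewrite /x expr2 mulf_div qq; field; rewrite !gt_eqF.
    rewrite ler_pdivrMr ?mulr_gt0 // mulrC ler_pdivlMr ?mulr_gt0 //.
    by rewrite mulrC -mulrA (ler_pM (ltW d0) (mulr_ge0 (ltW s0) (ltW a0)) da sa).
  have B : s / 4 <= 2 * x * (q * s * cabs p).
    have : q * (x * g) * (s * (g / (8 * r))) <= q * (x * g) * (s * cabs p).
      apply: ler_wpM2l; first exact: (mulr_ge0 (ltW q0) (mulr_ge0 (ltW x0) (ltW g0))).
      exact: (ler_wpM2l (ltW sp) pE).
    have xg : x * g = q by rewrite /x mulfVK ?gt_eqF.
    rewrite xg qq => K.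
    have {}K : s / 8 <= x * (q * s * cabs p).
      rewrite -(ler_pM2l g0); have -> : g * (x * (q * s * cabs p)) = q * q * (s * cabs p).
        by rewrite /x; field; rewrite gt_eqF.
      rewrite qq (le_trans _ K) // le_eqVlt; apply/orP; left; apply/eqP.
      by field; rewrite gt_eqF.
    lra.
  have D : complex.Re (b * Num.conj b * pick tau w2 w2) <= 1.
    rewrite (le_trans (ler_norm _)) // (le_trans (Re_le_cabs _)) //.
    have -> : cabs (b * Num.conj b * pick tau w2 w2) = q * s * (q * s) * cabs (pick tau w2 w2).
      by rewrite cabsM; congr (_ * _); rewrite cabsM cabs_conj cb.
    have := cabs_pick_diag tau Iw; rewrite /= => K.
    have K2 : cabs (pick tau w2 w2) <= (2 * s ^+ 2)^-1 / (r / 2).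
      apply: (le_trans K); apply: ler_pM (cabs_ge0 _) _ h2 _; first by rewrite invr_ge0 ltW.
      by rewrite lef_pV2 ?posrE ?divr_gt0.
    have -> : q * s * (q * s) = r * s ^+ 2 by rewrite -qq; ring.
    have rs : 0 <= r * s ^+ 2 by rewrite mulr_ge0 ?sqr_ge0 ?ltW.
    rewrite (le_trans (ler_wpM2l rs K2)) // le_eqVlt; apply/orP; left; apply/eqP.
    by field; rewrite !gt_eqF.
  have -> : complex.Re c = complex.Re ((x ^+ 2)%:C%C * pick tau a a)
      - 2 * x * (q * s * cabs p) + complex.Re (b * Num.conj b * pick tau w2 w2).
    by rewrite cE raddfD raddfB.
  have s4 : s / 4 = (del * sig)^-1 + 2 by rewrite sE; field; rewrite !gt_eqF.
  move: A B D; rewrite s4.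
  move: (complex.Re _) (2 * x * _) (complex.Re _) ((del * sig)^-1) => A1 A2 A3 A4.
  lra.
(* the factor that makes the value of the form exactly [-1] *)
pose k := (Num.sqrt (- complex.Re c))^-1.
have mc : 1 <= - complex.Re c by lra.
have sq1 : 1 <= Num.sqrt (- complex.Re c) by rewrite -[leLHS]sqrtr1 ler_wsqrtr.
have k0 : 0 <= k by rewrite invr_ge0 sqrtr_ge0.
have k1 : k <= 1 by rewrite invf_le1 // (lt_le_trans ltr01).
exists (k%:C%C *: u0); split.
- have -> : (k%:C%C *: u0)^t* = k%:C%C *: u0^t*.
    by apply/matrixP => i j; rewrite !mxE rmorphM /= conj_realC.
  rewrite -!scalemxAl -scalemxAr scalerA mxE -/w -/c cR -!rmorphM /=.
  have -> : k * k * complex.Re c = -1; last by rewrite rmorphN1.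
  rewrite /k -invfM -expr2 sqr_sqrtr; last lra.
  by field; rewrite -oppr_eq0; apply: lt0r_neq0; lra.
- rewrite !mxE /= cabsM !cabs_real ger0_norm // gtr0_norm // -mulrA.
  by rewrite /x mulfVK ?gt_eqF // ler_piMl // ltW.
- rewrite !mxE /= cabsM cabs_real ger0_norm // cb mulrC [s * _]mulrC.
  by rewrite ler_piMr // mulr_ge0 // ltW.
Qed.

End Nontangential.

(** * Nontangential limits *)

Section NontangentialLimit.
Variable R : realType.
Local Notation C := R[i].
Local Open Scope sesquilinear_scope.
Implicit Types (tau : C -> C) (a z w : C).

Lemma sum_ge_term (I : finType) (F : I -> R) i : (forall j, 0 <= F j) ->
  F i <= \sum_j F j.
Proof. by move=> F0; rewrite (bigD1 i) //= lerDl sumr_ge0. Qed.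

Lemma cabs_pick_le tau z w (b : R) : 0 < b -> b <= cabs (z - Num.conj w) ->
  cabs (pick tau z w) <= (cabs (tau z) + cabs (tau w)) / b.
Proof.
move=> b0 bz; rewrite /pick cabsM cabsV; apply: ler_pM; rewrite ?cabs_ge0 //.
- by rewrite invr_ge0 cabs_ge0.
- by rewrite (le_trans (cabsD _ _)) // cabsN cabs_conj.
- by rewrite lef_pV2 // posrE // (lt_le_trans b0).
Qed.

(** A pair of points far away is almost orthogonal to the points already
    chosen. *)
Lemma negG_grow tau m (del sig : R) : axis_cvg tau 0 -> 0 < del -> 0 < sig ->
  (forall E (R0 : R), generic E -> exists a, [/\ E a, R0 <= cabs a,
     sig * cabs a <= complex.Im a & del <= cabs (tau a)]) ->
  negG tau m -> negG tau m.+1.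
Proof.
move=> tau0 d0 s0 Hbad H E gE; have [n [z [U [zE HU]]]] := H E gE.
have [eta eta0 Hpair] := @negative_pair R tau del sig _ d0 s0 erefl.
set s := 4 * _ in Hpair.
have sp : 0 < s by rewrite mulr_gt0 // addr_gt0 // invr_gt0 mulr_gt0.
rewrite -addn1; apply: negG_approx => e e0.
pose T := \sum_i cabs (tau (z i 0)); pose Z := \sum_i cabs (z i 0).
pose UU := \sum_r \sum_i cabs (U r i).
(* [Kc / sqrt r] bounds the entries of the kernel between an old point and
   the new pair at distance [r] *)
pose Kc := 2 * (T / del + 1) + 4 * (T + eta) * s.
have T0 : 0 <= T by apply: sumr_ge0 => i _; exact: cabs_ge0.
have Z0 : 0 <= Z by apply: sumr_ge0 => i _; exact: cabs_ge0.
have U0 : 0 <= UU by apply: sumr_ge0 => r _; apply: sumr_ge0 => i _; exact: cabs_ge0.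
have K0 : 0 < Kc.
  have k1 : 0 <= T / del by rewrite divr_ge0 // ltW.
  have k2 : 0 <= (T + eta) * s by rewrite mulr_ge0 ?addr_ge0 // ltW.
  by rewrite /Kc -mulrA; move: k1 k2; move: (T / del) ((T + eta) * s) => x y; lra.
have [Y HY] : gen_infty [set y | cabs (tau (0 +i* y)%C) <= eta /\ E (0 +i* y)%C].
  have := (axis_cvgP _ _).1 tau0 _ eta0.
  move=> h; apply: filterS2 h (gen_infty_generic gE) => y /=.
  by rewrite subr0 => /ltW.
(* [r >= B ^ 2] makes the off-diagonal block smaller than [e] *)
pose B := (UU * Kc + 1) / e; have B0 : 0 < B by rewrite divr_gt0 // ltr_wpDl // mulr_ge0 // ltW.
have [a [Ea Ra sa da]] := Hbad E (Num.max (Num.max 1 (4 * Z)) (Num.max (B ^+ 2) Y)) gE.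
move: Ra; rewrite !ge_max => /andP[/andP[R1 RZ] /andP[RB RY]].
set r := cabs a in R1 RZ RB RY sa.
have r0 : 0 < r by rewrite (lt_le_trans ltr01).
have Ia : 0 < complex.Im a by rewrite (lt_le_trans _ sa) // mulr_gt0.
have [t [[t1 Et] [t2 t3]]] : exists t : R, (cabs (tau (0 +i* t)%C) <= eta /\
    E (0 +i* t)%C) /\ (r / 2 <= t /\ t <= 2 * r).
  have h2 : \forall t \near (r : R^o)^', r / 2 <= t /\ t <= 2 * r.
    apply/dnbhsR; exists (r / 2); first by rewrite divr_gt0.
    by move=> t _; rewrite ltr_norml => /andP[h1 h2]; split; lra.
  by have [t ?] := filter_ex (filterI (HY r RY) h2); exists t.
have [u] := Hpair a t r0 sa da t2 t3 t1; set w : 'cV[C]_2 := \col_i _.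
move=> [uw u1 u2]; rewrite -/r in u1 u2.
set q := Num.sqrt r in u1 u2; have q0 : 0 < q by rewrite sqrtr_gt0.
have qq : q * q = r by rewrite -expr2 sqr_sqrtr // ltW.
have Bq : B <= q.
  by rewrite -[B]gtr0_norm // -sqrtr_sqr /q ler_wsqrtr.
have t0 : 0 < t by rewrite (lt_le_trans _ t2) // divr_gt0.
have g0 : 0 < cabs (tau a) by rewrite (lt_le_trans d0).
have wE : upper_in E w.
  by move=> i; rewrite mxE; case: ifP => _; split.
have Tz i : cabs (tau (z i 0)) <= T.
  by apply: (sum_ge_term (F := fun i => cabs (tau (z i 0)))) => j; exact: cabs_ge0.
have Zz i : cabs (z i 0) <= Z.
  by apply: (sum_ge_term (F := fun i => cabs (z i 0))) => j; exact: cabs_ge0.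
have cross i : cabs ((pickmx tau z w *m u^t*) i 0) <= Kc / q.
  rewrite mxE !big_ord_recl big_ord0 addr0 !trmxCE !mxE /=.
  rewrite (le_trans (cabsD _ _)) // [X in X + _]cabsM [X in _ + X]cabsM !cabs_conj /Kc mulrDl.
  have -> : lift ord0 ord0 = 1 :> 'I_2 by apply/val_inj.
  apply: lerD.
    have b1 : r / 2 <= cabs (z i 0 - Num.conj a).
      rewrite cabsB (le_trans _ (cabs_sub _ _)) // cabs_conj -/r.
      by have := Zz i; lra.
    have r2 : 0 < r / 2 by rewrite divr_gt0.
    have k1 := @cabs_pick_le tau _ _ _ r2 b1.
    have u3 : cabs (u 0 0) <= q / cabs (tau a) by rewrite ler_pdivlMr.
    apply: (le_trans (ler_pM (cabs_ge0 _) (cabs_ge0 _) k1 u3)).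
    have -> : (cabs (tau (z i 0)) + cabs (tau a)) / (r / 2) * (q / cabs (tau a)) =
        2 * (cabs (tau (z i 0)) / cabs (tau a) + 1) / q.
      by rewrite -qq; field; rewrite !gt_eqF.
    rewrite ler_pM2r ?invr_gt0 // ler_pM2l // lerD2r.
    apply: ler_pM; rewrite ?cabs_ge0 ?invr_ge0 ?cabs_ge0 //.
    by rewrite lef_pV2 ?posrE.
  have b1 : r / 4 <= cabs (z i 0 - Num.conj (0 +i* t)%C).
    rewrite cabsB (le_trans _ (cabs_sub _ _)) // cabs_conj cabs_iy gtr0_norm //.
    by have := Zz i; lra.
  have r4 : 0 < r / 4 by rewrite divr_gt0.
  have k1 := @cabs_pick_le tau _ _ _ r4 b1.
  apply: (le_trans (ler_pM (cabs_ge0 _) (cabs_ge0 _) k1 u2)).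
  have -> : (cabs (tau (z i 0)) + cabs (tau (0 +i* t)%C)) / (r / 4) * (s * q) =
        4 * (cabs (tau (z i 0)) + cabs (tau (0 +i* t)%C)) * s / q.
    by rewrite -qq; field; rewrite gt_eqF.
  by rewrite ler_pM2r ?invr_gt0 // ler_pM2r // ler_pM2l // lerD.
have crossU i j : cabs ((U *m pickmx tau z w *m u^t*) i j) < e.
  rewrite [j]ord1 -mulmxA mxE (le_lt_trans (cabs_sum _ _ _)) //.
  apply: (@le_lt_trans _ _ (UU * (Kc / q))).
    rewrite /UU (@le_trans _ _ (\sum_k cabs (U i k) * (Kc / q))) //.
      by apply: ler_sum => k _; rewrite cabsM ler_wpM2l ?cabs_ge0.
    rewrite -mulr_suml; apply: ler_wpM2r; first exact: divr_ge0 (ltW K0) (ltW q0).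
    apply: (sum_ge_term (F := fun r => \sum_i cabs (U r i))) => k.
    by apply: sumr_ge0 => k' _; exact: cabs_ge0.
  rewrite mulrA ltr_pdivrMr //.
  have : e * B <= e * q by rewrite ler_pM2l.
  have -> : e * B = UU * Kc + 1 by rewrite /B; field; rewrite gt_eqF.
  lra.
exists (n + 2)%N, (col_mx z w), (block_mx U 0 0 u); split.
  exact: upper_in_col.
have -> : block_mx U 0 0 u *m pickmx tau (col_mx z w) (col_mx z w) *m (block_mx U 0 0 u)^t* =
    block_mx (- 1%:M) (U *m pickmx tau z w *m u^t*)
      ((U *m pickmx tau z w *m u^t*)^t*) (- 1%:M) :> 'M[C]_(m + 1).
  rewrite pickmx_col tr_block_mx map_block_mx !mulmx_block !trmx0 !map_mx0.
  rewrite !(mulmx0, mul0mx, addr0, add0r) HU; congr (block_mx _ _ _ _).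
    have pT : (pickmx tau z w)^t* = pickmx tau w z.
      by apply/matrixP => i j; rewrite !mxE pick_conj.
    by rewrite !trmxC_mul trmxCK pT mulmxA.
  by apply/matrixP => i j; rewrite !ord1 uw !mxE.
move=> i j; case: (split_ordP i) => i' ->; case: (split_ordP j) => j' ->.
- rewrite block_mxEul !mxE (inj_eq (@lshift_inj _ _)) addNr cabs0 //.
- by rewrite block_mxEur eq_lrshift addr0.
- by rewrite block_mxEdl eq_rlshift addr0 trmxCE cabs_conj.
- by rewrite block_mxEdr !mxE (inj_eq (@rshift_inj _ _)) addNr cabs0.
Qed.

(** Otherwise there are points of a sector, tending to infinity, at which
    [tau] stays away from [0]; each of them adds a negative square. *)
Lemma axis_nontangential tau m : meromorphic tau -> ~ negG tau m ->
  axis_cvg tau 0 -> nontangential_o1 tau.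
Proof.
move=> mt nm tau0 eps eps0 del del0; apply: contrapT => Hbad; apply: nm.
have bad (R0 : R) : exists r theta : R, [/\ R0 < r, eps < theta < pi - eps &
    del <= cabs (tau ((r * cos theta) +i* (r * sin theta))%C)].
  apply: contrapT => no; apply: Hbad; exists R0; split; first exact: num_real.
  move=> r R0r theta ht; rewrite normcabs ltcR ltNge; apply/negP => h.
  by apply: no; exists r, theta.
have [_ [th0 [_ h0 _]]] := bad 0.
have se : 0 < sin eps by apply: sin_gt0_pi; apply/andP; split=> //; move/andP: h0; lra.
have Hb E (R0 : R) : generic E -> exists a, [/\ E a, R0 <= cabs a,
     sin eps / 2 * cabs a <= complex.Im a & del / 2 <= cabs (tau a)].
  move=> gE; have [r [th [Rr hth ht]]] := bad (Num.max (R0 + 1) 1).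
  move: Rr; rewrite gt_max => /andP[Rr r1]; have r0 : 0 < r by lra.
  set a0 := (_ +i* _)%C in ht.
  have ca0 : cabs a0 = r.
    rewrite /cabs normc_def /= !exprMn -mulrDr cos2Dsin2 mulr1 sqrtr_sqr gtr0_norm //.
  have sth := sin_sector eps0 hth.
  have Ia : complex.Im a0 = r * sin th by [].
  have Ia0 : 0 < complex.Im a0 by rewrite Ia mulr_gt0 // (lt_le_trans se).
  have near_big : \forall z \near (a0 : C^o)^', del / 2 <= cabs (tau z).
    have [ha|pa] := mt a0 (lt0r_neq0 Ia0); last first.
      by apply: filterS (pole_large (del / 2) pa) => z /ltW.
    have d2 : 0 < del / 2 by rewrite divr_gt0.
    have /cvgC/(_ _ d2)/near_dnbhs := hol_cvg ha; apply: filterS => z hz.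
    by have := cabs_sub (tau a0) (tau z); rewrite cabsB; lra.
  have del1 : 0 < Num.min (1 / 2) (r * sin eps / 4).
    by rewrite lt_min !divr_gt0 // mulr_gt0.
  have [a [[Ea ta] aa da]] := dnbhs_ex (filterI (gE a0 (lt0r_neq0 Ia0)) near_big) del1.
  move: da; rewrite lt_min => /andP[da1 da2].
  have c1 := cabs_sub a0 a; rewrite cabsB ca0 in c1.
  have c2 := cabs_sub a a0; rewrite ca0 in c2.
  have im : complex.Im a0 - cabs (a - a0) <= complex.Im a.
    have := Im_le_cabs (a - a0); rewrite raddfB /= ler_norml => /andP[]; lra.
  have rs : r * sin eps <= r * sin th by rewrite ler_pM2l.
  have s1 : sin eps <= 1 by exact: sin_le1.
  exists a; split=> //; first lra.
  have : sin eps / 2 * cabs a <= sin eps / 2 * (r + 1 / 2).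
    by rewrite ler_pM2l ?divr_gt0 //; lra.
  rewrite Ia in im; have : sin eps * 1 <= sin eps * r by rewrite ler_pM2l // ltW.
  lra.
elim: m => [|m IH]; first exact: negG0.
by apply: (negG_grow (del := del / 2) (sig := sin eps / 2)) => //; rewrite divr_gt0.
Qed.

End NontangentialLimit.

(** * A parameter for every pair of indices *)

Section SimplePoles.
Variable R : realType.
Local Notation C := R[i].
Local Open Scope sesquilinear_scope.
Variables (D : nat) (x c : 'I_D -> R).
Hypothesis x_inj : injective x.

Definition poles (z : C) : C := \sum_i (c i)%:C%C / (z - (x i)%:C%C).

Definition cauchy_mx n (z : 'cV[C]_n) : 'M[C]_(n, D) :=
  \matrix_(p, i) (z p 0 - (x i)%:C%C)^-1.

Lemma upper_sub_real (z : C) (r : R) : complex.Im z != 0 -> z - r%:C%C != 0.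
Proof.
by apply: contraNneq => /(congr1 (@complex.Im R)); rewrite raddfB /= subr0 => ->.
Qed.

Lemma cauchy_unit (z : 'cV[C]_D) : (forall i, complex.Im (z i 0) != 0) ->
  injective (fun i => z i 0) -> cauchy_mx z \in unitmx.
Proof.
move=> zI z_inj; rewrite -unitmx_tr unitmxE unitfE; apply/negP => /det0P[v v0 H].
(* a kernel vector gives a polynomial of degree less than [D] with [D] zeros;
   its value at [x i] is a multiple of [v 0 i] *)
pose p : {poly C} := \sum_i v 0 i *: \prod_(j | j != i) ('X - ((x j)%:C%C)%:P).
have pE w : p.[w] = \sum_i v 0 i * \prod_(j | j != i) (w - (x j)%:C%C).
  rewrite /p horner_sum; apply: eq_bigr => i _; rewrite hornerZ horner_prod.
  by congr (_ * _); apply: eq_bigr => j _; rewrite hornerXsubC.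
have p0 : p = 0.
  apply/eqP/negPn/negP => pn0.
  have ur : uniq [seq z i 0 | i <- enum 'I_D] by rewrite map_inj_uniq // enum_uniq.
  have rr : all (root p) [seq z i 0 | i <- enum 'I_D].
    apply/allP => _ /mapP[k _ ->]; rewrite rootE pE.
    have := congr1 (fun A : 'rV[C]_D => A 0 k) H; rewrite !mxE => Hk.
    have -> : \sum_i v 0 i * \prod_(j | j != i) (z k 0 - (x j)%:C%C) =
        (\prod_j (z k 0 - (x j)%:C%C)) * \sum_i v 0 i * (cauchy_mx z)^T i k.
      rewrite mulr_sumr; apply: eq_bigr => i _; rewrite !mxE [in RHS](bigD1 i) //=.
      by have := upper_sub_real (x i) (zI k) => h; field.
    by rewrite Hk mulr0.
  have := max_poly_roots pn0 rr ur; rewrite size_map size_enum_ord ltnNge => /negP; apply.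
  rewrite /p (leq_trans (size_sum _ _ _)) //; apply/bigmax_leqP => i _.
  rewrite (leq_trans (size_scale_leq _ _)) //.
  have -> : \prod_(j | j != i) ('X - ((x j)%:C%C)%:P) =
      \prod_(j <- enum (predC1 i)) ('X - ((x j)%:C%C)%:P).
    by rewrite big_enum /=; apply: eq_bigl => j; rewrite inE.
  rewrite (size_prod_XsubC _ (fun j => (x j)%:C%C)) -cardE cardC1 card_ord prednK //.
  by rewrite (leq_ltn_trans _ (ltn_ord i)).
move/negP: v0; apply; apply/eqP/rowP => i; rewrite mxE.
have := pE (x i)%:C%C; rewrite p0 horner0 (bigD1 i) //= [X in _ + X]big1 ?addr0 => [|j ji].
  move/esym/eqP; rewrite mulf_eq0 => /orP[/eqP //|/prodf_eq0[j ji]].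
  rewrite subr_eq0 (inj_eq (@complexI R)) => /eqP/x_inj/eqP.
  by rewrite eq_sym (negPf ji).
by rewrite (bigD1 i) 1?eq_sym //= subrr mul0r mulr0.
Qed.

Lemma pickmx_poles n (z : 'cV[C]_n) E : upper_in E z ->
  pickmx poles z z = cauchy_mx z *m ddiag (fun i => - c i) *m (cauchy_mx z)^t*.
Proof.
move=> zE; apply/matrixP => p q; rewrite mxE [RHS]mxE /pick /poles rmorph_sum -sumrB mulr_suml.
apply: eq_bigr => i _; rewrite mul_mx_diag !mxE rmorphM !fmorphV !rmorphB /= !conj_realC rmorphN /=.
have h := upper_conj_neq (zE p).1 (zE q).1.
have h1 := upper_sub_real (x i) (lt0r_neq0 (zE p).1).
have h2 : Num.conj (z q 0) - (x i)%:C%C != 0.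
  by apply: upper_sub_real; rewrite Im_conj oppr_eq0 lt0r_neq0 // (zE q).1.
by field; rewrite h h1 h2.
Qed.

Lemma negG_poles : negG poles #|[set i | (- c i < 0)%R]%SET|.
Proof.
move=> E gE; have [Sel HSel] := negative_directions (fun i => - c i).
have [y [uE y0]] := filter_ex (filterI (axis_points D gE) (gen_infty_gt 0)).
pose w : 'cV[C]_D := \col_(i < D) ((i.+1%:R)%:C%C * (0 +i* y)%C).
have {}uE : upper_in E w by exact: uE.
have y0c := iy_neq0 y0.
have Wu : cauchy_mx w \in unitmx.
  apply: cauchy_unit => [i|i j]; first exact/lt0r_neq0/(uE i).1.
  rewrite !mxE => /(mulIf y0c)/complexI/eqP; rewrite eqr_nat eqSS => /eqP.
  exact: val_inj.
exists D, w, (Sel *m invmx (cauchy_mx w)); split=> //.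
rewrite (pickmx_poles uE) trmxC_mul -!mulmxA (mulmxA (invmx _)) mulVmx // mul1mx.
have -> : (cauchy_mx w)^t* *m ((invmx (cauchy_mx w))^t* *m Sel^t*) = Sel^t*.
  by rewrite mulmxA -trmxC_mul mulVmx // trmxC1 mul1mx.
by rewrite mulmxA.
Qed.

(** The kernel is a sum of [D] squares with coefficients [- c i]. *)
Lemma poles_negG m : negG poles m -> (m <= #|[set i | (- c i < 0)%R]%SET|)%N.
Proof.
move=> /(_ setT (genericT (fun=> I)))[n [z [U [zE]]]].
rewrite (pickmx_poles zE) => HU.
have [y|q [W [mq HW]]] := @negdef_complement _ m D (U *m cauchy_mx z) (fun i => - c i) 0.
  rewrite mulmx0 mul0mx mxE add0r -ddiag_form.
  have -> : y *m (U *m cauchy_mx z) *m ddiag (fun i => - c i) *m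
      (y *m (U *m cauchy_mx z))^t* = y *m (U *m (cauchy_mx z *m
        ddiag (fun i => - c i) *m (cauchy_mx z)^t*) *m U^t*) *m y^t*.
    by rewrite !trmxC_mul !mulmxA.
  by rewrite HU mulmxN mulmx1 mulNmx mxE.
case: q W mq HW => [|q] W mq HW; first by rewrite leqn0 subn_eq0 in mq.
have := HW (const_mx 1); rewrite mulmx0 mul0mx mulmx0 mul0mx mxE ltxx => H.
suff : false by []; apply: H; apply/eqP => /matrixP/(_ 0 0).
by rewrite !mxE => /eqP; rewrite oner_eq0.
Qed.

Lemma poles_hol z : complex.Im z != 0 -> holomorphic_at poles z.
Proof.
move=> hz; rewrite /poles.
elim: (index_enum 'I_D) => [|i s IH].
  have -> : (fun w => \sum_(i <- [::]) (c i)%:C%C / (w - (x i)%:C%C)) = (fun=> 0 : C).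
    by apply/funext => w; rewrite big_nil.
  exact: hol_cst.
have -> : (fun w => \sum_(i <- i :: s) (c i)%:C%C / (w - (x i)%:C%C)) =
    (fun w => (c i)%:C%C / (w - (x i)%:C%C) + \sum_(i <- s) (c i)%:C%C / (w - (x i)%:C%C)).
  by apply/funext => w; rewrite big_cons.
apply: holD IH; apply: holM; first exact: hol_cst.
by apply: holV; [exact: hol_sub|exact: upper_sub_real].
Qed.

Lemma poles_gsym : gsym poles.
Proof.
apply: genericT => z /=; rewrite /poles rmorph_sum; apply: eq_bigr => i _.
by rewrite rmorphM fmorphV rmorphB /= !conj_realC.
Qed.

Lemma poles_axis : axis_cvg poles 0.
Proof.
have H i : axis_cvg (fun z => (c i)%:C%C / (z - (x i)%:C%C)) 0.
  have h := axisB (axis_cst 1) (axisM (axis_cst (x i)%:C%C) (@axis_inv R)).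
  rewrite mulr0 subr0 in h; have := axisV (oner_neq0 C) h.
  move=> /(axisM (axisM (axis_cst (c i)%:C%C) (@axis_inv R))); rewrite mulr0 mul0r.
  apply: axis_near; apply: filterS (gen_infty_gt 0) => y y0; set z := (0 +i* y)%C.
  have z0 : z != 0 by exact: iy_neq0.
  have h1 : z - (x i)%:C%C != 0 by apply: upper_sub_real; rewrite /= gt_eqF.
  by field; rewrite h1 z0.
by have := axis_sum (index_enum 'I_D) H; rewrite big1.
Qed.

End SimplePoles.

Lemma mul_poles (R : realType) D (x c : 'I_D -> R) :
  generic [set z | z * poles x c z =
    (\sum_i c i)%:C%C + poles x (fun i => c i * x i) z].
Proof.
apply: genericS (_ : generic [set z : R[i] | complex.Im z != 0]) => [z hz|z hz]; last first.
  by apply: near_dnbhs; exact: near_Im_neq0.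
rewrite /= /poles mulr_sumr rmorph_sum -big_split; apply: eq_bigr => i _ /=.
by have h := upper_sub_real (x i) hz; rewrite rmorphM /=; field.
Qed.

(** A pole at [x < 0] with residue 1 adds one negative square to [tau] and,
    the residue of [z tau] being [x], none to [z tau]; a pole with residue
    [-1] does the opposite. *)
Lemma nevanlinna2_nonempty (R : realType) (a b : nat) : exists tau : R[i] -> R[i],
  nevanlinna2 a%:Z b%:Z tau /\ nontangential_o1 tau.
Proof.
pose x (i : 'I_(a + b)) : R := - i.+1%:R.
pose c (i : 'I_(a + b)) : R := if (i < a)%N then 1 else -1.
have xi : injective x.
  by move=> i j /oppr_inj/eqP; rewrite eqr_nat eqSS => /eqP/val_inj.
have na : #|[set i | (- c i < 0)%R]%SET| = a.
  rewrite -sum1_card big_split_ord /= [X in (_ + X)%N]big1 => [|i]; last first.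
    by rewrite inE /c /= ltnNge leq_addr /= opprK ltNge ler01.
  rewrite addn0 (eq_bigl xpredT) => [|i]; first by rewrite sum1_card card_ord.
  by rewrite inE /c /= ltn_ord oppr_lt0 ltr01.
have nb : #|[set i | (- (c i * x i) < 0)%R]%SET| = b.
  rewrite -sum1_card big_split_ord /= [X in (X + _)%N]big1 => [|i]; last first.
    by rewrite inE /c /x /= ltn_ord mul1r opprK ltNge ler0n.
  rewrite add0n (eq_bigl xpredT) => [|i]; first by rewrite sum1_card card_ord.
  by rewrite inE /c /x /= ltnNge leq_addr /= mulrNN mul1r oppr_lt0 ltr0n.
have mt : meromorphic (poles x c) by move=> z hz; left; exact: poles_hol.
have n1 : ~ negG (poles x c) a.+1 by move=> /poles_negG; rewrite na ltnn.
have n2 : negG (poles x c) a by rewrite -{2}na; exact: negG_poles.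
have E2 k : negG (fun z => z * poles x c z) k <-> negG (poles x (fun i => c i * x i)) k.
  by rewrite (negG_eq _ (mul_poles x c)) negG_addreal.
exists (poles x c); split; last by apply: (axis_nontangential mt n1); exact: poles_axis.
split; apply/nevanlinnaP; split=> //.
- exact: poles_gsym.
- by exists a.
- move=> z hz; left; apply: holM; [exact: hol_id|exact: poles_hol].
- by apply: genericS (poles_gsym x c) => z /= h; rewrite h rmorphM.
exists b; split=> //; rewrite E2; last by move=> /poles_negG; rewrite nb ltnn.
by have := @negG_poles R _ x (fun i => c i * x i) xi; rewrite nb.
Qed.

(** * The parametrization of the solutions *)

Section Transfer.
Variable R : realType.
Local Notation C := R[i].

Lemma nevanlinna_shift (f tau : C -> C) (k A : nat) :
  meromorphic f -> gsym f -> meromorphic tau -> gsym tau ->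
  (forall b, negG f (b + A) <-> negG tau b) ->
  nevanlinna k%:Z f <-> (A <= k)%N /\ nevanlinna (k%:Z - A%:Z) tau.
Proof.
move=> mf sf mt st H; split.
  move=> /nevanlinnaP[_ _ [a [/eqP]]]; rewrite eqz_nat => /eqP <- fk fk'.
  have Ak : (A <= k)%N.
    by apply: negG_leF fk'; rewrite -[A]add0n H; exact: negG0.
  split=> //; apply/nevanlinnaP; split=> //; exists (k - A)%N.
  split; first by rewrite subzn.
    by rewrite -H subnK.
  by rewrite -H addSn subnK.
move=> [Ak /nevanlinnaP[_ _ [a [/eqP]]]]; rewrite subzn // eqz_nat => /eqP <- tk tk'.
apply/nevanlinnaP; split=> //; exists k; split=> //.
  by rewrite -(subnK Ak) H.
by rewrite -(subnK Ak) -addSn H.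
Qed.

Lemma gsym_generic (f g : C -> C) : generic [set z | f z = g z] -> gsym f -> gsym g.
Proof.
move=> fg sf z0 hz; have hc : complex.Im (Num.conj z0) != 0 by rewrite Im_conj_neq0.
apply: filterS2 (filterI (sf z0 hz) (fg z0 hz)) (near_conj (fg _ hc)) => z /= [h1 h2] h3.
by rewrite -h3 h1 h2.
Qed.

Lemma gsym_mulz (f : C -> C) : gsym f -> gsym (fun z => z * f z).
Proof. by apply: genericS => z /= ->; rewrite rmorphM. Qed.

Lemma meromorphic_mulz (f : C -> C) : meromorphic f -> meromorphic (fun z => z * f z).
Proof.
move=> mf z0 hz; have z00 : z0 != 0 by apply: contraNneq hz => ->.
have [hf|[g [p [p0 hg g0 fg]]]] := mf z0 hz.
  by left; apply: holM; [exact: hol_id|exact: hf].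
right; exists (fun z => z * g z), p; split; first exact: p0.
- by apply: holM; [exact: hol_id|exact: hg].
- by rewrite mulf_neq0.
- by apply: filterS fg => z ->; rewrite mulrA.
Qed.

Lemma generic_mulz (f g : C -> C) : generic [set z | f z = g z] ->
  generic [set z | z * f z = z * g z].
Proof. by apply: genericS => z /= ->. Qed.

Lemma generic_sym (f g : C -> C) : generic [set z | f z = g z] ->
  generic [set z | g z = f z].
Proof. by apply: genericS => z /= ->. Qed.

End Transfer.

Theorem theorem5p9 (R : realType) (N kappa k : nat) (n : nat -> nat)
    (s : seq R) (m : nat -> {poly R}) (l : nat -> R)
    (N_gt0 : (0 < N)%N)
    (n_0 : n 0%N = 0%N)
    (n_increasing : forall j, (j < N)%N -> (n j < n j.+1)%N)
    (size_s : size s = (2 * n N)%N)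
    (normal_indices : forall p : nat,
       normal_index s p <-> exists2 j : nat, (1 <= j <= N)%N & p = n j)
    (regular_s : forall j : nat, (1 <= j <= N)%N ->
       \det (hankel_plus s (n j)) != 0)
    (m_l_schur : schur_recursion N n s m l) :
  let kappaN := nu_minus (hankel s (n N)) in
  let kN := nu_minus (hankel_plus s (n N)) in
  (moment_solutions kappa%:Z k%:Z s (2 * n N - 1) !=set0 <->
     (kappaN <= kappa)%N /\ (kN <= k)%N) /\
  (forall f : R[i] -> R[i], meromorphic f ->
     (moment_solutions kappa%:Z k%:Z s (2 * n N - 1) f <->
      exists tau : R[i] -> R[i],
        [/\ nevanlinna2 (kappa%:Z - kappaN%:Z) (k%:Z - kN%:Z) tau,
            nontangential_o1 tau &
            mero_eq_quotient f
              (fun z => cpoly (Q_plus m l N).2 z + cpoly (Q_plus m l N).1 z * tau z)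
              (fun z => cpoly (P_plus m l N).2 z
                          + cpoly (P_plus m l N).1 z * tau z)])).
Proof.
move=> kappaN kN.
have [Sg [Sg0 SgN steps]] := recursion_steps N_gt0 n_0 n_increasing size_s
  normal_indices regular_s m_l_schur.
pose v j := (n j - n j.-1)%N; pose D j := (2 * n N - 2 * n j)%N.
have D_step : forall j, (1 <= j <= N)%N -> D j.-1 = (D j + v j + v j)%N.
  exact: (order_step n_increasing).
have steps' j (jN : (1 <= j <= N)%N) := (steps j jN).2.
have nN0 : (0 < n N)%N.
  by rewrite -n_0; apply: (n_lt n_increasing); rewrite N_gt0 leqnn.
have sl : size s = (2 * n N - 1).+1 by rewrite size_s subn1 prednK // muln_gt0.
have ind F : linked N m l F -> forall b,
    (negG (F 0%N) (b + kappaN) <-> negG (F N) b) /\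
    (negG (fun z => z * F 0%N z) (b + kN) <-> negG (fun z => z * F N z) b).
  exact: (schur_indices N_gt0 n_0 n_increasing size_s normal_indices regular_s Sg0 SgN steps).
have exp0 f : expands D Sg 0 f <-> happrox (2 * n N - 1).+1 f ('X * - Poly s).
  by rewrite /expands Sg0 /D n_0 muln0 subn0 -sl size_s.
have expN g : axis_cvg g 0 <-> expands D Sg N g by exact: (expands_last n SgN).
(* [F 0] and [F N] may differ from the functions [f] and [tau] of the two
   classes on a discrete set *)
have ends F f tau : linked N m l F -> generic [set z | F 0%N z = f z] ->
    generic [set z | F N z = tau z] -> nice (F 0%N) -> nice (F N) ->
    meromorphic f -> meromorphic tau ->
    nevanlinna2 kappa%:Z k%:Z f <-> [/\ (kappaN <= kappa)%N, (kN <= k)%N &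
      nevanlinna2 (kappa%:Z - kappaN%:Z) (k%:Z - kN%:Z) tau].
  move=> lF Ff Ft [_ s0] [_ sN] mf mt; have I := ind F lF.
  have sf := gsym_generic Ff s0; have st := gsym_generic Ft sN.
  have E1 := @nevanlinna_shift R f tau kappa kappaN mf sf mt st.
  have E2 := @nevanlinna_shift R _ _ k kN (meromorphic_mulz mf) (gsym_mulz sf)
    (meromorphic_mulz mt) (gsym_mulz st).
  have {}E1 := E1 (fun b => iff_trans (iff_sym (negG_eq _ Ff))
    (iff_trans (I b).1 (negG_eq _ Ft))).
  have {}E2 := E2 (fun b => iff_trans (iff_sym (negG_eq _ (generic_mulz Ff)))
    (iff_trans (I b).2 (negG_eq _ (generic_mulz Ft)))).
  split=> [[/E1[h1 h2] /E2[h3 h4]]|[h1 h2 [h3 h4]]]; first by split.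
  by split; [apply/E1|apply/E2].
have quot F f tau : linked N m l F -> generic [set z | F 0%N z = f z] ->
    generic [set z | F N z = tau z] ->
    mero_eq_quotient f
      (fun z => cpoly (Q_plus m l N).2 z + cpoly (Q_plus m l N).1 z * tau z)
      (fun z => cpoly (P_plus m l N).2 z + cpoly (P_plus m l N).1 z * tau z).
  move=> lF Ff Ft z0 hz; have := generic_and (linked_quotient lF (leqnn N))
    (generic_and Ff Ft).
  by move=> /(_ z0 hz); apply: filterS => z /= [[h1 h2] [<- <-]].
(* the last function of the chain may take wrong values at single points *)
have up f : moment_solutions kappa%:Z k%:Z s (2 * n N - 1) f -> meromorphic f ->
    [/\ (kappaN <= kappa)%N, (kN <= k)%N & exists tau : R[i] -> R[i],
      [/\ nevanlinna2 (kappa%:Z - kappaN%:Z) (k%:Z - kN%:Z) tau,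
          nontangential_o1 tau &
          mero_eq_quotient f
            (fun z => cpoly (Q_plus m l N).2 z + cpoly (Q_plus m l N).1 z * tau z)
            (fun z => cpoly (P_plus m l N).2 z + cpoly (P_plus m l N).1 z * tau z)]].
  move=> [f2 flo] mf.
  have /nevanlinnaP[_ sf _] := f2.1.
  have nf : nice f by split=> //; exact: meromorphic_quasi.
  have ef : expands D Sg 0 f by apply/exp0/(littleo_happrox mf sl).
  have [F [F0 lF nN eN]] := chain_up D_step steps' nf ef.
  pose tau := reg (F N).
  have Ft : generic [set z | F N z = tau z] by exact/generic_sym/reg_generic/nN.1.
  have mt : meromorphic tau by exact/reg_meromorphic/nN.1.
  have Ff : generic [set z | F 0%N z = f z] by apply: genericT => z; rewrite /= F0.
  have n0 : nice (F 0%N) by rewrite F0.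
  have [h1 h2 h3] := (ends F f tau lF Ff Ft n0 nN mf mt).1 f2.
  split=> //; exists tau; split=> //; last exact: quot lF Ff Ft.
  have /nevanlinnaP[_ _ [a [_ _ nt]]] := h3.1.
  apply: (axis_nontangential mt nt); apply: axis_generic Ft _.
  exact/expN.
have down tau : nevanlinna2 (kappa%:Z - kappaN%:Z) (k%:Z - kN%:Z) tau ->
    (kappaN <= kappa)%N -> (kN <= k)%N -> nontangential_o1 tau ->
    exists F : nat -> R[i] -> R[i], [/\ F N = tau, linked N m l F, nice (F 0%N) &
     forall f, meromorphic f -> generic [set z | F 0%N z = f z] ->
       moment_solutions kappa%:Z k%:Z s (2 * n N - 1) f].
  move=> t2 h1 h2 t0; have /nevanlinnaP[mt st _] := t2.1.
  have nt : nice tau by split=> //; exact: meromorphic_quasi.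
  have et : expands D Sg N tau by apply: (expN _).1; exact: nontangential_axis.
  have [F [FN lF n0 e0]] := chain_down D_step steps' nt et.
  exists F; split=> // f mf Ff.
  have Ft : generic [set z | F N z = tau z] by apply: genericT => z; rewrite /= FN.
  have nN : nice (F N) by rewrite FN.
  split; first by apply/(ends F f tau lF Ff Ft n0 nN mf mt).
  apply/(littleo_happrox mf sl)/exp0; exact: happrox_generic Ff e0.
have index_le (tau : R[i] -> R[i]) : nevanlinna2 (kappa%:Z - kappaN%:Z) (k%:Z - kN%:Z) tau ->
    (kappaN <= kappa)%N /\ (kN <= k)%N.
  move=> [/nevanlinnaP[_ _ [a [Ea _ _]]] /nevanlinnaP[_ _ [b [Eb _ _]]]].
  by split; rewrite -lez_nat -subr_ge0 ?Ea ?Eb.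
split.
  split=> [[f fs]|[h1 h2]].
    have /nevanlinnaP[mf _ _] := fs.1.1.
    by have [] := up f fs mf.
  have [tau [t2 t0]] := nevanlinna2_nonempty R (kappa - kappaN) (k - kN).
  rewrite -!subzn // in t2.
  have [F [_ _ n0 H]] := down tau t2 h1 h2 t0.
  exists (reg (F 0%N)); apply: H; first exact/reg_meromorphic/n0.1.
  exact/generic_sym/reg_generic/n0.1.
move=> f mf; split=> [fs|[tau [t2 t0 q]]]; first by have [] := up f fs mf.
have [h1 h2] := index_le _ t2.
have [F [FN lF n0 H]] := down tau t2 h1 h2 t0.
apply: H mf _ => z0 hz.
have Ft : generic [set z | F N z = tau z] by apply: genericT => z; rewrite /= FN.
have := linked_quotient lF (leqnn N) => /(_ z0 hz) LQ.
apply: filterS2 (filterI LQ (Ft z0 hz)) (q z0 hz) => z /= [[_ ->] E] [_ ->].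
by rewrite E.
Qed.
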